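(* Let $n\ge 1$ and let $\alpha\in(0,n+2)$, $\lambda>0$, $T>0$ and $\sigma$ be constants with $$0\le\sigma<g_\alpha(\lambda),$$ and let $\Omega$ be an open subset of $\mathbb{R}^n$. Suppose $u$ is a nonnegative function with $$u\in C^{2,1}(\mathbb{R}^n\times(0,T))\cap L^\lambda(\mathbb{R}^n\times(0,T))$$ satisfying $$0\le u_t-\Delta u\le \Big(\iint_{\mathbb{R}^n\times(0,T)}\Phi(x-y,t-s)^{\alpha/n}u(y,s)^\lambda\,dy\,ds\Big)\,u(x,t)^\sigma\quad\text{for }(x,t)\in\Omega\times(0,T).$$ Then for each compact subset $K$ of $\Omega$, as $t\to0^+$, $$\max_{x\in K}u(x,t)=O(t^{-n/2})\ \text{ if } 0<\lambda<\tfrac{n+2}{n},\qquad \max_{x\in K}u(x,t)=o\big(t^{-(n+2)/(2\lambda)}\big)\ \text{ if } \lambda\ge\tfrac{n+2}{n}.$$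
   Context: $\Phi$ is the heat kernel: $\Phi(x,t)=(4\pi t)^{-n/2}e^{-|x|^2/(4t)}$ for $(x,t)\in\mathbb{R}^n\times(0,\infty)$ and $\Phi(x,t)=0$ for $t\le 0$. For $\alpha\in(0,n+2)$, $g_\alpha:(0,\infty)\to[0,\infty)$ is defined by $g_\alpha(\lambda)=\frac{n+2}{n}$ if $0<\lambda<\frac{n+2-\alpha}{n}$; $g_\alpha(\lambda)=\frac{2(n+2)-\alpha}{n}-\lambda$ if $\frac{n+2-\alpha}{n}\le\lambda<\frac{n+2}{n}$; $g_\alpha(\lambda)=\max\{0,1-\frac{\alpha-2}{n+2}\lambda\}$ if $\lambda\ge\frac{n+2}{n}$. *)

(* Defs.v *)
From HB Require Import structures.
From mathcomp Require Import all_boot all_order all_algebra.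
From mathcomp Require Import all_classical all_reals all_analysis.
Set Implicit Arguments. Unset Strict Implicit. Unset Printing Implicit Defensive.
Import Order.TTheory GRing.Theory Num.Theory.
Import numFieldNormedType.Exports.
Local Open Scope classical_set_scope.
Local Open Scope ring_scope.

Section Defs.
Variable R : realType.

Definition evec (n : nat) (i : 'I_n) : 'rV[R]_n := delta_mx 0 i.

(* squared Euclidean norm |x|^2 (the library norm on 'rV is the max norm) *)
Definition sqnorm (n : nat) (x : 'rV[R]_n) : R := \sum_(i < n) x 0 i ^+ 2.

Definition heat_kernel (n : nat) (x : 'rV[R]_n) (t : R) : R :=
  if 0 < t then (4 * pi * t) `^ (- (n%:R / 2)) * expR (- (sqnorm x / (4 * t)))
  else 0.

Definition g_alpha (n : nat) (alpha lam : R) : R :=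
  if lam < (n%:R + 2 - alpha) / n%:R then (n%:R + 2) / n%:R
  else if lam < (n%:R + 2) / n%:R then (2 * (n%:R + 2) - alpha) / n%:R - lam
  else Num.max 0 (1 - (alpha - 2) / (n%:R + 2) * lam).

Definition dx (n : nat) (i : 'I_n) (u : 'rV[R]_n -> R -> R) : 'rV[R]_n -> R -> R :=
  fun x t => 'D_(evec i) (fun y => u y t) x.
Definition dt (n : nat) (u : 'rV[R]_n -> R -> R) : 'rV[R]_n -> R -> R :=
  fun x t => derive1 (fun s => u x s) t.
Definition laplacian (n : nat) (u : 'rV[R]_n -> R -> R) : 'rV[R]_n -> R -> R :=
  fun x t => \sum_(i < n) dx i (dx i u) x t.

Definition jcont (n : nat) (f : 'rV[R]_n -> R -> R) (x : 'rV[R]_n) (t : R) :=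
  {for (x, t), continuous (fun p : 'rV[R]_n * R => f p.1 p.2)}.

Definition C21 (n : nat) (T : R) (u : 'rV[R]_n -> R -> R) :=
  forall x t, 0 < t < T ->
  [/\ derivable (fun s => u x s) t 1,
      forall i, derivable (fun y => u y t) x (evec i),
      forall i j, derivable (fun y => dx i u y t) x (evec j),
      jcont u x t /\ jcont (dt u) x t &
      (forall i, jcont (dx i u) x t) /\
      (forall i j, jcont (dx j (dx i u)) x t)].

(* Lebesgue integral over R^n of a nonnegative extended-real function,
   as the iterated integral over the coordinates (Tonelli). *)
Fixpoint intRn (n : nat) : ('rV[R]_n -> \bar R) -> \bar R :=
  match n return ('rV[R]_n -> \bar R) -> \bar R with
  | 0 => fun f => f 0
  | m.+1 => fun f => (\int[@lebesgue_measure R]_(z in [set: R])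
        intRn (fun y : 'rV[R]_m =>
          f (\row_(k < m.+1) match unlift ord0 k with
                             | Some j => y ord0 j | None => (z : R) end)))%E
  end.

Definition int_strip (n : nat) (T : R) (f : 'rV[R]_n -> R -> \bar R) : \bar R :=
  (\int[@lebesgue_measure R]_(s in `]0%R, T[%classic) intRn (fun y => f y s))%E.

End Defs.

(* Main.v *)
Require Import Defs.
From HB Require Import structures.
From mathcomp Require Import all_boot all_order all_algebra.
From mathcomp Require Import ring lra.
From mathcomp Require Import all_classical all_reals all_analysis measurable_realfun.
Import Order.TTheory GRing.Theory Num.Theory.
Import numFieldNormedType.Exports.
Local Open Scope classical_set_scope.
Local Open Scope ring_scope.
Set Implicit Arguments.
Unset Strict Implicit.
Unset Printing Implicit Defensive.

(** Write H = d_t - Delta, and let theta = 1/n if lam < (n+2)/n and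
    theta = lam/(n+2) otherwise; both rates read u = O(t^(-1/(2 theta))), with
    an arbitrarily small constant in the second case.  Suppose
    u(x0,t0)^(2 theta) t0 > 32 kappa^2.  Maximizing u^(2 theta) against the
    squared parabolic distance to the boundary of a cylinder at (x0,t0) gives a
    point (x1,t1) with u(x1,t1) = M large and u <= L M on a parabolic cylinder
    of radius 2 rho, rho = kappa M^(-theta), where L depends on theta only.

    There the nonlocal term is split at distance rho: near (x1,t1) bound u by
    L M and integrate the kernel; far away bound a power of the kernel by a
    power of rho and use an integral of u.  That integral is the L^lam norm in
    the second case; in the first one it is controlled by local integrability
    of u^q for all q < (n+2)/n.  The condition sigma < g_alpha(lam) says exactly
    that the outcome is Hu <= L M / rho^2 for M large.  An interior gradient
    estimate then gives u >= M/2 on a parabolic box of size c rho, c independent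
    of kappa.

    For lam >= (n+2)/n the integral of u^lam over that box is a fixed multiple
    of kappa^(n+2), which is impossible as t0 -> 0.  For lam < (n+2)/n a single
    box contradicts, for kappa large, the capacity estimate: if a nonnegative
    supersolution is at least m on N disjoint parabolic boxes of size h, then
    m N^(n/(n+2)) h^n is bounded, as one sees by placing a sum of differences of
    Gaussians under u and evaluating at a later time.  The same estimate is of
    weak type (n+2)/n, hence yields the local integrability used above.

    Everything rests on the maximum principle alone; integrands are kept lower
    semicontinuous, so that Fatou's lemma makes all iterated integrals
    measurable and no measure on R^n is needed. *)

(** * Expansions along lines and the maximum principle *)

(** Scaling dictates [theta]. On a parabolic box of radius rho = kappa M^(-theta), where u is of
    size M, theta = lam/(n+2) gives M^lam rho^(n+2) = kappa^(n+2), the contribution of the box to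
    the integral of u^lam, and theta = 1/n gives M rho^n = kappa^n, which stands for its mass. For
    lam < (n+2)/n and theta = 1/n, M^lam rho^(n+2) tends to 0 as M grows, so the L^lam norm yields
    no contradiction; a bound on mass is required, and capacity supplies it without a representation
    formula for supersolutions. The weak exponent (n+2)/n is that of the heat kernel itself.

    Multiplied by u^sigma, the nonlocal term contributes M^(lam+sigma) rho^(n+2-alpha) from nearby
    points and M^sigma rho^(-(alpha-gam)) from distant ones, where integrability of u pays for the
    power gam/n of the kernel. Both must be of lower order than M/rho^2, which amounts to two linear
    inequalities. With theta = 1/n, a suitable gam exists exactly on the first two branches of
    [g_alpha]; with theta = lam/(n+2) and gam = 0 they reduce to the third. *)

Section Peano.
Variable R : realType.
Implicit Types (v w : R -> R) (a b c d e r s t : R).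

(* All that the maximum principle uses; unlike [derivable], these expansions pass
   to sums and restrictions to lines without side conditions. *)
Definition peano1 v d := forall e, 0 < e ->
  exists2 r, 0 < r & forall s, `|s| <= r -> `|v s - v 0 - d * s| <= e * `|s|.

Definition peano2 v a := exists b, forall e, 0 < e ->
  exists2 r, 0 < r &
    forall s, `|s| <= r -> `|v s - v 0 - b * s - a / 2 * s ^+ 2| <= e * s ^+ 2.

Lemma peano1D v w d d' : peano1 v d -> peano1 w d' ->
  peano1 (fun s => v s + w s) (d + d').
Proof.
move=> pv pw e e0; have e20 : 0 < e / 2 by rewrite divr_gt0.
have [r r0 hr] := pv _ e20; have [r' r'0 hr'] := pw _ e20.
exists (Num.min r r'); first by rewrite lt_min r0.
move=> s; rewrite le_min => /andP[/hr h1 /hr' h2].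
have -> : v s + w s - (v 0 + w 0) - (d + d') * s =
  (v s - v 0 - d * s) + (w s - w 0 - d' * s) by ring.
by rewrite (le_trans (ler_normD _ _))//; lra.
Qed.

Lemma peano1Z v d c : peano1 v d -> peano1 (fun s => c * v s) (c * d).
Proof.
move=> pv e e0; have c0 : 0 < `|c| + 1 by rewrite ltr_wpDl.
have [r r0 hr] := pv _ (divr_gt0 e0 c0).
exists r => // s /hr h.
have -> : c * v s - c * v 0 - c * d * s = c * (v s - v 0 - d * s) by ring.
rewrite normrM (le_trans (ler_wpM2l _ h))// mulrA ler_wpM2r//.
by rewrite mulrCA ger_pMr// ler_pdivrMr// mul1r lerDl.
Qed.

Lemma peano2D v w a a' : peano2 v a -> peano2 w a' ->
  peano2 (fun s => v s + w s) (a + a').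
Proof.
move=> [b pv] [b' pw]; exists (b + b') => e e0.
have e20 : 0 < e / 2 by rewrite divr_gt0.
have [r r0 hr] := pv _ e20; have [r' r'0 hr'] := pw _ e20.
exists (Num.min r r'); first by rewrite lt_min r0.
move=> s; rewrite le_min => /andP[/hr h1 /hr' h2].
have -> : v s + w s - (v 0 + w 0) - (b + b') * s - (a + a') / 2 * s ^+ 2 =
  (v s - v 0 - b * s - a / 2 * s ^+ 2) + (w s - w 0 - b' * s - a' / 2 * s ^+ 2)
  by field.
by rewrite (le_trans (ler_normD _ _))//; lra.
Qed.

Lemma peano2Z v a c : peano2 v a -> peano2 (fun s => c * v s) (c * a).
Proof.
move=> [b pv]; exists (c * b) => e e0; have c0 : 0 < `|c| + 1 by rewrite ltr_wpDl.
have [r r0 hr] := pv _ (divr_gt0 e0 c0).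
exists r => // s /hr h.
have -> : c * v s - c * v 0 - c * b * s - c * a / 2 * s ^+ 2 =
  c * (v s - v 0 - b * s - a / 2 * s ^+ 2) by field.
rewrite normrM (le_trans (ler_wpM2l _ h))// mulrA ler_wpM2r ?sqr_ge0//.
by rewrite mulrCA ger_pMr// ler_pdivrMr// mul1r lerDl.
Qed.

Lemma peano1_affine c d : peano1 (fun s => c + d * s) d.
Proof.
move=> e e0; exists 1 => // s _.
have -> : c + d * s - (c + d * 0) - d * s = 0 by ring.
by rewrite normr0 mulr_ge0// ltW.
Qed.

Lemma peano2_quadratic c b a : peano2 (fun s => c + b * s + a * s ^+ 2) (2 * a).
Proof.
exists b => e e0; exists 1 => // s _.
have -> : c + b * s + a * s ^+ 2 - (c + b * 0 + a * 0 ^+ 2) - b * s -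
  2 * a / 2 * s ^+ 2 = 0 by field.
by rewrite normr0 mulr_ge0 ?sqr_ge0// ltW.
Qed.

(** Only earlier points are compared, because in the maximum principle the extremum may lie at the
    final time. *)
Lemma peano1_left_max v d r : peano1 v d -> 0 < r ->
  (forall s, - r <= s <= 0 -> v s <= v 0) -> 0 <= d.
Proof.
move=> pv r0 vmax; rewrite leNgt; apply/negP => d0.
have [r' r'0 hr] := pv (- d / 2) ltac:(by rewrite divr_gt0// oppr_gt0).
pose s := - Num.min r r'.
have m0 : 0 < Num.min r r' by rewrite lt_min r0.
have s0 : s < 0 by rewrite /s oppr_lt0.
have h1 : v s <= v 0.
  by apply: vmax; rewrite (ltW s0) andbT /s lerN2 ge_min lexx.
have := hr s; rewrite ltr0_norm// /s opprK ge_min lexx orbT => /(_ isT).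
rewrite -/s ler_norml => /andP[h2 _].
have : d * s <= - (- d / 2 * (- s)) + (v s - v 0) - 2 * (- (- d / 2 * (- s))) by rewrite /s in h2 *; lra.
have : 0 < d * s by rewrite nmulr_rgt0.
rewrite /s in h1 h2 *; set m := Num.min r r' in h1 h2 *; nra.
Qed.

Lemma peano2_max v a r : peano2 v a -> 0 < r ->
  (forall s, `|s| <= r -> v s <= v 0) -> a <= 0.
Proof.
move=> [b pv] r0 vmax; rewrite leNgt; apply/negP => a0.
have [r' r'0 hr] := pv (a / 4) ltac:(by rewrite divr_gt0).
pose m := Num.min r r'.
have m0 : 0 < m by rewrite lt_min r0.
have nm : `|m| = m by rewrite gtr0_norm.
have mr : m <= r by rewrite /m ge_min lexx.
have mr' : m <= r' by rewrite /m ge_min lexx orbT.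
(* Adding the expansions at [m] and [- m] cancels the unknown linear coefficient [b]. *)
have := vmax m; rewrite nm => /(_ mr) h1.
have := vmax (- m); rewrite normrN nm => /(_ mr) h2.
have := hr m; rewrite nm => /(_ mr'); rewrite ler_norml => /andP[h3 _].
have := hr (- m); rewrite normrN nm => /(_ mr'); rewrite ler_norml => /andP[h4 _].
rewrite sqrrN in h4.
have : 0 < m ^+ 2 by rewrite exprn_gt0.
by nra.
Qed.

Lemma peano1_ext v w d : v =1 w -> peano1 v d -> peano1 w d.
Proof. by move=> /funext ->. Qed.

Lemma peano2_ext v w d : v =1 w -> peano2 v d -> peano2 w d.
Proof. by move=> /funext ->. Qed.

Lemma is_derive_peano1 (f : R -> R) t d :
  is_derive t 1 f d -> peano1 (fun s => f (t + s)) d.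
Proof.
move=> [df fd] e e0.
have /cvgrPdist_le/(_ _ e0) : h^-1 *: (f (h *: (1 : R) + t) - f t) @[h --> 0^'] --> d.
  by rewrite -fd; exact: df.
move=> [r/= r0 hr]; exists (r / 2); first by rewrite divr_gt0.
move=> s sr; have [->|s0] := eqVneq s 0.
  by rewrite addr0 mulr0 subr0 subrr normr0 mulr0.
have sr' : `|0 - s| < r by rewrite sub0r normrN; lra.
have := hr s sr' s0; rewrite /= addr0 [s *: _]mulr1 [s + t]addrC => h.
have -> : f (t + s) - f t - d * s = - s * (d - s^-1 *: (f (t + s) - f t)).
  by rewrite [_ *: _]mulrDr mulrBr; field.
by rewrite normrM normrN mulrC ler_wpM2r.
Qed.

Lemma is_derive1_translate (f : R -> R) t z d :
  is_derive (t + z) 1 f d -> is_derive z 1 (fun z => f (t + z)) d.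
Proof.
move=> H; have -> : (fun z0 : R => f (t + z0)) = f \o shift t.
  by apply/funext => y; rewrite /= addrC.
rewrite -[d]mulr1; apply: is_derive1_comp; last exact: is_derive_shift.
by rewrite /= addrC.
Qed.

(** Second-order Taylor formula from f' near [t] and f'' at [t] only: the remainder [g] has
    derivative o(s) by the first-order expansion of [df], and the mean value theorem turns this into
    o(s^2). *)
Lemma is_derive_peano2 (f df : R -> R) t a r : 0 < r ->
  (forall s, `|s - t| < r -> is_derive s 1 f (df s)) ->
  is_derive t 1 df a -> peano2 (fun s => f (t + s)) a.
Proof.
move=> r0 hf hdf; exists (df t) => e e0.
have [r1 r10 hr1] := @is_derive_peano1 df t a hdf e e0.
exists (Num.min r1 (r / 2)); first by rewrite lt_min r10 divr_gt0.
move=> s; rewrite le_min => /andP[sr1 sr]; rewrite addr0 in hr1 *.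
pose g (z : R) := f (t + z) - df t * z - a / 2 * z ^+ 2.
have dg (z : R) : `|z| < r -> is_derive z 1 g (df (t + z) - df t - a * z).
  move=> zr; rewrite /g.
  have H : is_derive (t + z) 1 f (df (t + z)) by apply: hf; rewrite addrAC subrr add0r.
  have H1 : is_derive z 1 (fun z => f (t + z)) (df (t + z)).
    exact: is_derive1_translate.
  apply: is_derive_eq.
  by rewrite /GRing.scale/=; field.
have -> : f (t + s) - f t - df t * s - a / 2 * s ^+ 2 = g s - g 0.
  by rewrite /g addr0 mulr0 expr0n/= mulr0 !subr0; ring.
have key (z : R) : `|z| <= `|s| -> `|df (t + z) - df t - a * z| <= e * `|s|.
  move=> zs; rewrite (le_trans (hr1 z (le_trans zs sr1)))//.
  by rewrite ler_wpM2l// ltW.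
have cg (z : R) : `|z| < r -> {for z, continuous g}.
  by move=> zr; apply: differentiable_continuous; apply/derivable1_diffP; have [] := dg z zr.
have [s0|s0|->] := ltgtP s 0; last by rewrite subrr normr0 expr0n mulr0.
- have [z zin E] : exists2 z, z \in `]s, 0[%R & g 0 - g s = (df (t + z) - df t - a * z) * (0 - s).
    apply: (@MVT _ g) => //.
    + move=> z; rewrite in_itv/= => /andP[z1 z2]; apply: dg.
      by rewrite ltr0_norm// ltrNl (lt_trans _ z1)// ltrNl; rewrite ltr0_norm in sr => //; lra.
    + apply: continuous_in_subspaceT => z; rewrite inE/= in_itv/= => /andP[z1 z2]; apply: cg.
      by rewrite ler0_norm//; rewrite ltr0_norm in sr => //; lra.
  rewrite -normrN opprB E.
  rewrite normrM sub0r normrN.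
  have : e * s ^+ 2 = e * `|s| * `|s| by rewrite -mulrA -expr2 real_normK// num_real.
  move=> ->; rewrite ler_wpM2r// key//.
  by move: zin; rewrite in_itv/= => /andP[z1 z2]; rewrite !ltr0_norm//; lra.
- have [z zin ->] : exists2 z, z \in `]0, s[%R & g s - g 0 = (df (t + z) - df t - a * z) * (s - 0).
    apply: (@MVT _ g) => //.
    + move=> z; rewrite in_itv/= => /andP[z1 z2]; apply: dg.
      by rewrite gtr0_norm// (lt_trans z2)//; rewrite gtr0_norm in sr => //; lra.
    + apply: continuous_in_subspaceT => z; rewrite inE/= in_itv/= => /andP[z1 z2]; apply: cg.
      by rewrite ger0_norm//; rewrite gtr0_norm in sr => //; lra.
  rewrite normrM subr0.
  have : e * s ^+ 2 = e * `|s| * `|s| by rewrite -mulrA -expr2 real_normK// num_real.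
  move=> ->; rewrite ler_wpM2r// key//.
  by move: zin; rewrite in_itv/= => /andP[z1 z2]; rewrite !gtr0_norm//; lra.
Qed.

End Peano.

(** * Pointwise continuity of sums, products and powers *)

Lemma cvg_sum_seq (R : realType) (T : Type) (F : set_system T) (FF : Filter F)
    (I : eqType) (s : seq I) (f : I -> T -> R) (l : I -> R) :
  (forall i, i \in s -> f i x @[x --> F] --> l i) ->
  \sum_(i <- s) f i x @[x --> F] --> \sum_(i <- s) l i.
Proof.
elim: s => [_|i s IH h].
  by rewrite big_nil; under eq_fun do rewrite big_nil; exact: cvg_cst.
rewrite big_cons; under eq_fun do rewrite big_cons.
apply: cvgD; first by apply: h; rewrite mem_head.
by apply: IH => j js; apply: h; rewrite in_cons js orbT.
Qed.

Section ContinuousAt.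
Variables (R : realType) (T : topologicalType) (p : T).
Implicit Types f g : T -> R.

Lemma contAtC (c : R) : {for p, continuous (fun _ : T => c)}.
Proof. exact: cvg_cst. Qed.

Lemma contAtD f g : {for p, continuous f} -> {for p, continuous g} ->
  {for p, continuous (fun x => f x + g x)}.
Proof. by move=> cf cg; exact: (cvgD cf cg). Qed.

Lemma contAtB f g : {for p, continuous f} -> {for p, continuous g} ->
  {for p, continuous (fun x => f x - g x)}.
Proof. by move=> cf cg; exact: (cvgB cf cg). Qed.

Lemma contAtM f g : {for p, continuous f} -> {for p, continuous g} ->
  {for p, continuous (fun x => f x * g x)}.
Proof. by move=> cf cg; exact: (cvgM cf cg). Qed.

Lemma contAtV f : f p != 0 -> {for p, continuous f} ->
  {for p, continuous (fun x => (f x)^-1)}.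
Proof. by move=> f0 cf; exact: (cvgV f0 cf). Qed.

Lemma contAt_comp (h : R -> R) f : {for p, continuous f} ->
  {for f p, continuous h} -> {for p, continuous (fun x => h (f x))}.
Proof. by move=> cf ch; exact: (continuous_comp cf ch). Qed.

Lemma contAt_sum (I : eqType) (s : seq I) (f : I -> T -> R) :
  (forall i, i \in s -> {for p, continuous (f i)}) ->
  {for p, continuous (fun x => \sum_(i <- s) f i x)}.
Proof. by move=> cf; apply: cvg_sum_seq => i si; exact: cf. Qed.

End ContinuousAt.

Lemma contAt_powR (R : realType) (T : topologicalType) (p : T) (f : T -> R) (q : R) :
  0 < f p -> {for p, continuous f} -> {for p, continuous (fun x => f x `^ q)}.
Proof.
move=> fp cf; apply: (@contAt_comp _ _ _ (fun z : R => z `^ q)) => //.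
apply: differentiable_continuous; apply/derivable1_diffP => /=.
by have [] := @is_derive1_powR R q _ fp.
Qed.

(** * Row vectors: the max norm against the Euclidean norm *)

Section RowVectors.
Variables (R : realType) (n : nat).
Implicit Types (x y : 'rV[R]_n) (i : 'I_n).

Lemma coord_le_norm x i : `|x 0 i| <= `|x|.
Proof.
rewrite [leRHS]/Num.Def.normr /= mx_normrE; apply/bigmax_geP; right => /=.
by exists (0, i).
Qed.

Lemma norm_rV_le x (r : R) : 0 <= r -> (forall i, `|x 0 i| <= r) -> `|x| <= r.
Proof.
move=> r0 h; rewrite [leLHS]/Num.Def.normr /= mx_normrE; apply/bigmax_leP; split=> //.
by case=> [j i] _ /=; rewrite ord1.
Qed.

Lemma evecE i j : (@evec R n i) 0 j = (j == i)%:R.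
Proof. by rewrite /evec mxE eqxx. Qed.

Lemma norm_scale_evec (s : R) i : `|s *: @evec R n i| <= `|s|.
Proof.
apply: norm_rV_le => // j; rewrite mxE evecE.
by case: eqP => _; rewrite ?mulr1 ?mulr0 ?normr0.
Qed.

Lemma sqnorm_ge0 x : 0 <= sqnorm x.
Proof. by apply: sumr_ge0 => i _; exact: sqr_ge0. Qed.

Lemma norm_sqr_le_sqnorm x : `|x| ^+ 2 <= sqnorm x.
Proof.
have [x0|/mx_norm_neq0[[j i]/= xi]] := eqVneq (mx_norm x) 0.
  by rewrite [`|x|]/Num.Def.normr/= x0 expr0n sqnorm_ge0.
rewrite [`|x|]/Num.Def.normr/= xi ord1 /sqnorm (bigD1 i)//=.
rewrite real_normK ?num_real// lerDl sumr_ge0// => k _; exact: sqr_ge0.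
Qed.

Lemma sqnorm_le_norm_sqr x : sqnorm x <= n%:R * `|x| ^+ 2.
Proof.
rewrite /sqnorm mulr_natl -[X in _ *+ X]card_ord -sumr_const.
apply: ler_sum => i _; rewrite -[leLHS]real_normK ?num_real//.
by rewrite lerXn2r// ?nnegrE// coord_le_norm.
Qed.

Lemma add_scale_evecE x i (s : R) j :
  (x + s *: evec R i) 0 j = x 0 j + s * (j == i)%:R.
Proof. by rewrite mxE [X in _ + X]mxE evecE. Qed.

Lemma sqnorm_add_evec x i (s : R) :
  sqnorm (x + s *: evec R i) = sqnorm x + 2 * x 0 i * s + s ^+ 2.
Proof.
rewrite /sqnorm (bigD1 i)//= [in RHS](bigD1 i)//= add_scale_evecE eqxx mulr1.
rewrite (eq_bigr (fun j => x 0 j ^+ 2)); last first.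
  by move=> j /negbTE ji; rewrite add_scale_evecE ji mulr0 addr0.
by ring.
Qed.

Lemma continuous_norm_sub x : continuous (fun y : 'rV[R]_n => `|y - x|).
Proof.
move=> y; apply: (@cvg_norm _ _ _ (nbhs (y : 'rV[R]_n))).
apply: (@cvgB _ _ _ (nbhs (y : 'rV[R]_n))); [exact: cvg_id|exact: cvg_cst].
Qed.

Lemma closed_cube_compact x (r : R) : compact [set y | `|y - x| <= r].
Proof.
apply: bounded_closed_compact.
  exists (`|x| + r); split; first exact: num_real.
  move=> M hM y /= yr; rewrite (le_trans _ (ltW hM))//.
  by rewrite -[y](subrK x) (le_trans (ler_normD _ _))// addrC lerD2l.
apply: (@closed_comp _ _ (fun y : 'rV[R]_n => `|y - x|) [set z | z <= r]).
  by move=> y _; exact: continuous_norm_sub.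
exact: closed_le.
Qed.

Lemma cylinder_compact x (r a b : R) :
  compact ([set y : 'rV[R]_n | `|y - x| <= r] `*` `[a, b]).
Proof. by apply: compact_setX; [exact: closed_cube_compact|exact: segment_compact]. Qed.

Lemma continuous_coord_sub x i : continuous (fun y : 'rV[R]_n => (y - x) 0 i).
Proof.
move=> y; have -> : (fun z : 'rV[R]_n => (z - x) 0 i) = (fun z : 'rV[R]_n => z 0 i - x 0 i).
  by apply/funext => z; rewrite !mxE.
rewrite /continuous_at.
apply: (@cvgB _ _ _ _ (nbhs_filter (y : 'rV[R]_n))); last exact: cvg_cst.
exact: (@coord_continuous R 1 n 0 i (y : 'rV[R]_n)).
Qed.

Lemma continuous_sqnorm_sub x : continuous (fun y : 'rV[R]_n => sqnorm (y - x)).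
Proof.
move=> y; rewrite /sqnorm.
apply: (@cvg_sum_seq _ _ _ (nbhs_filter (y : 'rV[R]_n)) _ _
  (fun i (z : 'rV[R]_n) => (z - x) 0 i ^+ 2)) => i _.
have c := @continuous_coord_sub x i y.
exact: (cvgM c c).
Qed.

End RowVectors.

(** * The heat operator and the comparison principle *)

Section HeatOperator.
Variables (R : realType) (n : nat).
Implicit Types (u w : 'rV[R]_n -> R -> R) (x : 'rV[R]_n) (t c : R).

(* [c] plays the role of [w_t - Delta w] at [(x, t)]. *)
Definition heat_at w x t c := exists d, exists a : 'I_n -> R,
  [/\ peano1 (fun s => w x (t + s)) d,
      forall i, peano2 (fun s => w (x + s *: evec R i) t) (a i) &
      c = d - \sum_i a i].

Lemma heat_atD u w x t c c' : heat_at u x t c -> heat_at w x t c' ->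
  heat_at (fun x t => u x t + w x t) x t (c + c').
Proof.
move=> [d [a [h1 h2 ->]]] [d' [a' [h1' h2' ->]]].
exists (d + d'), (fun i => a i + a' i); split.
- exact: peano1D.
- by move=> i; exact: peano2D.
- by rewrite big_split/=; ring.
Qed.

Lemma heat_atZ w x t c k : heat_at w x t c ->
  heat_at (fun x t => k * w x t) x t (k * c).
Proof.
move=> [d [a [h1 h2 ->]]].
exists (k * d), (fun i => k * a i); split.
- exact: peano1Z.
- by move=> i; exact: peano2Z.
- by rewrite -mulr_sumr; ring.
Qed.

Lemma heat_at_affine x t (k l : R) : heat_at (fun _ t => k + l * t) x t l.
Proof.
exists l, (fun=> 0); split.
- apply: (@peano1_ext _ (fun s => (k + l * t) + l * s)); last exact: peano1_affine.
  by move=> s; ring.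
- move=> i; rewrite -[X in peano2 _ X](mulr0 2).
  apply: peano2_ext; last exact: (@peano2_quadratic _ (k + l * t) 0 0).
  by move=> s /=; ring.
- by rewrite big1// subr0.
Qed.

Lemma heat_at_sum (I : eqType) (s : seq I) (w : I -> 'rV[R]_n -> R -> R)
    (c : I -> R) x t : (forall i, i \in s -> heat_at (w i) x t (c i)) ->
  heat_at (fun x t => \sum_(i <- s) w i x t) x t (\sum_(i <- s) c i).
Proof.
elim: s => [_|i s IH h].
  rewrite big_nil.
  have -> : (fun (x : 'rV[R]_n) (t : R) => \sum_(i <- [::]) w i x t) = (fun _ t => 0 + 0 * t).
    by apply/funext => y; apply/funext => z; rewrite big_nil mul0r addr0.
  exact: heat_at_affine.
have -> : (fun (x : 'rV[R]_n) (t : R) => \sum_(i <- i :: s) w i x t) =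
   (fun x t => w i x t + \sum_(i <- s) w i x t).
  by apply/funext => y; apply/funext => z; rewrite big_cons.
rewrite big_cons; apply: heat_atD; first by apply: h; rewrite mem_head.
by apply: IH => j js; apply: h; rewrite in_cons js orbT.
Qed.

Lemma heat_at_sqnorm x (y : 'rV[R]_n) t : heat_at (fun z _ => sqnorm (z - y)) x t (- (2 * n%:R)).
Proof.
exists 0, (fun=> 2); split.
- apply: (@peano1_ext _ (fun s => sqnorm (x - y) + 0 * s)); last exact: peano1_affine.
  by move=> s; ring.
- move=> i; rewrite -[X in peano2 _ X](mulr1 2).
  apply: peano2_ext; last exact: (@peano2_quadratic _ (sqnorm (x - y)) (2 * (x - y) 0 i) 1).
  by move=> s /=; rewrite (addrAC x) sqnorm_add_evec; ring.
- by rewrite sumr_const card_ord sub0r mulr_natr.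
Qed.

Lemma is_derive_line (F : 'rV[R]_n -> R) x (v : 'rV[R]_n) (s : R) :
  derivable F (x + s *: v) v ->
  is_derive s 1 (fun s : R => F (x + s *: v)) ('D_v F (x + s *: v)).
Proof.
move=> dF.
have E : (fun h : R => h^-1 *: (((fun s : R => F (x + s *: v)) \o shift s) (h *: (1 : R)) - F (x + s *: v))) =
         (fun h : R => h^-1 *: ((F \o shift (x + s *: v)) (h *: v) - F (x + s *: v))).
  apply/funext => h /=; rewrite [h *: _]mulr1.
  by rewrite scalerDl addrCA.
by apply: DeriveDef; rewrite /derivable /derive E.
Qed.

Lemma C21_heat_at T u x t : C21 T u -> 0 < t < T ->
  heat_at u x t (dt u x t - laplacian u x t).
Proof.
move=> uC t0T; have [ut _ _ _ _] := uC x t t0T.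
exists (dt u x t), (fun i => dx i (dx i u) x t); split => //.
- by apply: is_derive_peano1; rewrite /dt derive1E; exact: derivableP.
- move=> i.
  apply: (@peano2_ext _ (fun s => u (x + (0 + s) *: evec R i) t)).
    by move=> s; rewrite add0r.
  apply: (@is_derive_peano2 _ (fun s => u (x + s *: evec R i) t)
     (fun s => dx i u (x + s *: evec R i) t) 0 _ 1) => //.
    move=> s _; apply: (@is_derive_line (fun y => u y t)).
    by have [_ + _ _ _] := uC (x + s *: evec R i) t t0T; exact.
  have := @is_derive_line (fun y => dx i u y t) x (evec R i) 0.
  rewrite scale0r addr0; apply.
  by have [_ _ + _ _] := uC x t t0T; exact.
Qed.

(** At a negative minimum of D + e (t - a), away from the bottom and the sides, the time derivative
    of [D] is at most - e while its pure second derivatives are nonnegative, against the sign of the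
    heat operator. The expansions are asked for at the final time [b] as well, so a minimum there is
    treated like any other. *)
Lemma comparison (D : 'rV[R]_n -> R -> R) (x0 : 'rV[R]_n) (r a b : R) :
  (forall x t, `|x - x0| <= r -> a <= t <= b -> jcont D x t) ->
  (forall x, `|x - x0| <= r -> 0 <= D x a) ->
  (forall x t, `|x - x0| = r -> a <= t <= b -> 0 <= D x t) ->
  (forall x t, `|x - x0| < r -> a < t <= b -> exists2 c, 0 <= c & heat_at D x t c) ->
  forall x t, `|x - x0| <= r -> a <= t <= b -> 0 <= D x t.
Proof.
move=> cD Da Dr Dh x1 t1 x1r t1ab; rewrite leNgt; apply/negP => D10.
have ab : a <= b by lra.
(* Small enough that adding e (t - a) keeps the value at [(x1, t1)] negative. *)
pose e := - D x1 t1 / (2 * (b - a + 1)).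
have e0 : 0 < e by apply: divr_gt0; lra.
have eab : e * (b - a) < - D x1 t1.
  have h : e * (2 * (b - a + 1)) = - D x1 t1 by rewrite /e divfK// gt_eqF//; lra.
  nra.
pose F (p : 'rV[R]_n * R) := D p.1 p.2 + e * (p.2 - a).
pose A : set ('rV[R]_n * R) := [set y : 'rV[R]_n | `|y - x0| <= r] `*` `[a, b].
have A1 : A (x1, t1) by split => //=; rewrite in_itv.
have cF : {within A, continuous F}.
  apply: continuous_in_subspaceT => -[y s]; rewrite inE => -[/= yr]; rewrite in_itv/= => sab.
  apply: cvgD; first exact: cD.
  apply: cvgM; first exact: cvg_cst.
  by apply: cvgB; [exact: cvg_snd|exact: cvg_cst].
have [[x2 t2]] := compact_EVT_min (ex_intro _ _ A1) (@cylinder_compact _ _ _ _ _ _) cF.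
rewrite inE => -[/= x2r]; rewrite in_itv/= => t2ab Fmin.
have F20 : F (x2, t2) < 0.
  apply: (le_lt_trans (Fmin (x1, t1) (mem_set A1))); rewrite /F/=.
  have : e * (t1 - a) <= e * (b - a) by rewrite ler_pM2l//; lra.
  lra.
rewrite /F/= in F20.
have t2a : a < t2.
  rewrite lt_neqAle; apply/andP; split; last lra.
  by apply: contraTneq F20 => <-; rewrite subrr mulr0 addr0 -leNgt Da.
have e2 : 0 <= e * (t2 - a) by apply: mulr_ge0; lra.
have x2lt : `|x2 - x0| < r.
  rewrite lt_neqAle x2r andbT; apply: contraTneq F20 => h; rewrite -leNgt.
  by apply: addr_ge0 => //; exact: Dr.
have [|c c0 [d [l [h1 h2 E]]]] := Dh x2 t2 x2lt; first lra.
have de : 0 <= -1 * (d + e).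
  have pp := peano1Z (-1) (peano1D h1 (peano1_affine (e * (t2 - a)) e)).
  apply: (peano1_left_max pp (r := t2 - a)); first lra.
  move=> s s0 /=.
  have : F (x2, t2) <= F (x2, t2 + s).
    by apply: Fmin; rewrite inE; split => //=; rewrite in_itv/=; lra.
  rewrite /F/= addr0 mulr0 addr0; nra.
have l0 i : 0 <= l i.
  have pp := peano2Z (-1) (h2 i).
  suff : -1 * l i <= 0 by lra.
  apply: (peano2_max pp (r := r - `|x2 - x0|)); first by rewrite subr_gt0.
  move=> s s0 /=; rewrite scale0r addr0.
  have : F (x2, t2) <= F (x2 + s *: evec R i, t2).
    apply: Fmin; rewrite inE; split => /=; last by rewrite in_itv/=; lra.
    rewrite addrAC (le_trans (ler_normD _ _))//.
    by have := norm_scale_evec s i; lra.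
  rewrite /F/=; lra.
have : 0 <= \sum_i l i by apply: sumr_ge0.
lra.
Qed.

End HeatOperator.

(** * Interior gradient estimate *)

(** Shifting the midpoint by s/2 and the half distance by s/2 moves x + h e by s e and fixes x - h
    e; decreasing the half distance instead moves only the other point. *)
Lemma half_step_points (R : realType) (V : lmodType R) (x e : V) (s h : R) :
   [/\ x + (s / 2) *: e + (h + s / 2) *: e = x + h *: e + s *: e,
    x + (s / 2) *: e + (h + s / 2) *: - e = x + h *: - e,
    x + (s / 2) *: e + (h - s / 2) *: e = x + h *: e &
    x + (s / 2) *: e + (h - s / 2) *: - e = x + h *: - e + s *: e].
Proof.
split; rewrite ?scalerN -?(scaleNr _ e) -!addrA; congr (x + _); rewrite -?(scalerDl e); congr (_ *: _).
- by field.
- by field.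
- by field.
- by field.
Qed.

Section Brandt.
Variables (R : realType) (n : nat).
Implicit Types (u : 'rV[R]_n -> R -> R) (x y : 'rV[R]_n).

Lemma jcont_shift u x (t h : R) (v : 'rV[R]_n) : jcont u (x + h *: v) t ->
  {for ((x, t), h), continuous
     (fun p : 'rV[R]_n * R * R => u (p.1.1 + p.2 *: v) p.1.2)}.
Proof.
move=> cu.
pose g (p : 'rV[R]_n * R * R) : 'rV[R]_n * R := (p.1.1 + p.2 *: v, p.1.2).
have c1 : {for ((x, t), h), continuous (fun p : 'rV[R]_n * R * R => p.1)} by exact: cvg_fst.
have c2 : {for ((x, t), h), continuous (fun p : 'rV[R]_n * R * R => p.1.1)}.
  by apply: continuous_comp; [exact: c1|exact: cvg_fst].
have c3 : {for ((x, t), h), continuous (fun p : 'rV[R]_n * R * R => p.1.2)}.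
  by apply: continuous_comp; [exact: c1|exact: cvg_snd].
have c4 : {for ((x, t), h), continuous (fun p : 'rV[R]_n * R * R => p.2)} by exact: cvg_snd.
have c5 : {for ((x, t), h), continuous (fun p : 'rV[R]_n * R * R => p.2 *: v)}.
  exact: (cvgZr_tmp c4).
have c6 : {for ((x, t), h), continuous (fun p : 'rV[R]_n * R * R => p.1.1 + p.2 *: v)}.
  exact: (cvgD c2 c5).
have cg : {for ((x, t), h), continuous g} by exact: (cvg_pair c6 c3).
exact: (continuous_comp cg cu).
Qed.

(* Brandt's method: as a function of [(x, h, t)], the difference
   [u (x + h e_i) t - u (x - h e_i) t] is compared with an explicit barrier, using
   the lines along which only one of the two points moves. *)
Lemma brandt u x1 (t1 rho B : R) (i : 'I_n) : 0 < rho -> 0 < B ->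
  (forall x (t : R), `|x - x1| <= rho -> t1 - rho ^+ 2 <= t <= t1 -> jcont u x t) ->
  (forall x (t : R), `|x - x1| <= rho -> t1 - rho ^+ 2 <= t <= t1 -> `|u x t| <= B) ->
  (forall x (t : R), `|x - x1| <= rho -> t1 - rho ^+ 2 <= t <= t1 ->
    exists2 c, `|c| <= B / rho ^+ 2 & heat_at u x t c) ->
  forall h : R, 0 <= h <= rho / 2 ->
  u (x1 + h *: evec R i) t1 - u (x1 - h *: evec R i) t1 <=
    (16 * n%:R + 20) * B * h / rho.
Proof.
move=> r0 B0 cu uB uh h0 h0r.
set K := B / rho ^+ 2; pose e := @evec R n i; pose L := (16 * n%:R + 20) * K.
have r20 : 0 < rho ^+ 2 by rewrite exprn_gt0.
have K0 : 0 < K by rewrite divr_gt0.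
have KB : K * rho ^+ 2 = B by rewrite /K divfK// gt_eqF.
have n0 : 0 <= n%:R :> R by rewrite ler0n.
have L0 : 20 * K <= L by rewrite /L; nra.
(* For |x - x1| = rho/2, for t = t1 - rho^2 and for h = rho/2, the three terms in turn reach 2 B,
   which dominates every difference of values of [u]. The last one vanishes at h = 0, and its
   concavity in [h] must outweigh the heat operator of the other two and the bounds [K] at both
   points; this fixes [L]. *)
pose beta (x : 'rV[R]_n) (t h : R) : R :=
  K * (8 * sqnorm (x - x1) + 2 * (t1 - t)) + L * (h * rho - h ^+ 2).
pose F (p : 'rV[R]_n * R * R) : R :=
  u (p.1.1 + p.2 *: e) p.1.2 - u (p.1.1 + p.2 *: (- e)) p.1.2 - beta p.1.1 p.1.2 p.2.
pose A : set ('rV[R]_n * R * R) :=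
  ([set y : 'rV[R]_n | `|y - x1| <= rho / 2] `*` `[t1 - rho ^+ 2, t1]) `*` `[0, rho / 2].
have ne (s : R) : `|s *: e| <= `|s| by exact: norm_scale_evec.
have inr (x : 'rV[R]_n) (h : R) : `|x - x1| <= rho / 2 -> 0 <= h <= rho / 2 ->
    `|x + h *: e - x1| <= rho /\ `|x + h *: (- e) - x1| <= rho.
  move=> xr hr; have hh : `|h *: e| <= rho / 2.
    by rewrite (le_trans (ne h))// ger0_norm; lra.
  split; rewrite addrAC (le_trans (ler_normD _ _))//; first lra.
  by rewrite scalerN normrN; lra.
have AP (y : 'rV[R]_n) (s k : R) : `|y - x1| <= rho / 2 ->
    t1 - rho ^+ 2 <= s <= t1 -> 0 <= k <= rho / 2 -> A ((y, s), k).
  by move=> *; split => /=; [split => //=|]; rewrite in_itv.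
have A1 : A ((x1, t1), h0).
  split => /=; last by rewrite in_itv/=.
  by split => /=; [rewrite subrr normr0; lra | rewrite in_itv/=; lra].
have cF0 (y : 'rV[R]_n) (s h : R) : `|y - x1| <= rho / 2 -> t1 - rho ^+ 2 <= s <= t1 ->
    0 <= h <= rho / 2 -> {for ((y, s), h), continuous F}.
  move=> yr sab hr; have [yr1 yr2] := inr y h yr hr.
  have c1 : {for ((y, s), h), continuous (fun p : 'rV[R]_n * R * R => p.1)} by exact: cvg_fst.
  have c2 : {for ((y, s), h), continuous (fun p : 'rV[R]_n * R * R => p.2)} by exact: cvg_snd.
  have c3 : {for ((y, s), h), continuous (fun p : 'rV[R]_n * R * R => p.1.2)}.
    by apply: continuous_comp; [exact: c1|exact: cvg_snd].
  have c4 : {for ((y, s), h), continuous (fun p : 'rV[R]_n * R * R => p.1.1)}.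
    by apply: continuous_comp; [exact: c1|exact: cvg_fst].
  have c5 : {for ((y, s), h), continuous (fun p : 'rV[R]_n * R * R => sqnorm (p.1.1 - x1))}.
    exact: (continuous_comp c4 (@continuous_sqnorm_sub _ _ x1 _)).
  apply: contAtB.
    by apply: contAtB; [exact: (jcont_shift (cu _ _ yr1 sab))|exact: (jcont_shift (cu _ _ yr2 sab))].
  apply: contAtD; apply: contAtM; try exact: contAtC.
    apply: contAtD; apply: contAtM; try exact: contAtC; first exact: c5.
    by apply: contAtB; [exact: contAtC|exact: c3].
  apply: contAtB; first by apply: contAtM; [exact: c2|exact: contAtC].
  exact: contAtM.
have cF : {within A, continuous F}.
  apply: continuous_in_subspaceT => -[[y s] h]; rewrite inE => -[[/= yr]].
  by rewrite !in_itv/= => sab hr; exact: cF0.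
have [x [t [h [xr tr hr Fmax]]]] : exists (x : 'rV[R]_n) (t h : R),
    [/\ `|x - x1| <= rho / 2, t1 - rho ^+ 2 <= t <= t1, 0 <= h <= rho / 2 &
        forall p, A p -> F p <= F (x, t, h)].
  have [[[x t] h]] := compact_EVT_max (ex_intro _ _ A1)
    (compact_setX (@cylinder_compact _ _ _ _ _ _) (@segment_compact _ _ _)) cF.
  rewrite inE => -[[/= xr]]; rewrite !in_itv/= => tr hr Fmax.
  by exists x, t, h; split => // p Ap; apply: Fmax; exact: mem_set.
have F1 : F (x, t, h) <= 0.
  rewrite leNgt; apply/negP => F0.
  have [p1r q1r] := inr x h xr hr.
  have sq0 := sqnorm_ge0 (x - x1).
  have uB1 : `|u (x + h *: e) t| <= B by exact: uB.
  have uB2 : `|u (x + h *: - e) t| <= B by exact: uB.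
  move: uB1 uB2; rewrite !ler_norml => uB1 uB2.
  have hrho : 0 <= h * rho - h ^+ 2 by nra.
  have Lh : 0 <= L * (h * rho - h ^+ 2) by rewrite mulr_ge0//; lra.
  have Kt : 0 <= K * (2 * (t1 - t)) by rewrite mulr_ge0//; lra.
  have Ks : 0 <= K * (8 * sqnorm (x - x1)) by rewrite mulr_ge0//; lra.
  have betaE : beta x t h = K * (8 * sqnorm (x - x1)) + K * (2 * (t1 - t)) + L * (h * rho - h ^+ 2).
    by rewrite /beta mulrDr.
  have FE : 0 < u (x + h *: e) t - u (x + h *: - e) t - beta x t h by [].
  have hgt0 : 0 < h.
    rewrite lt_neqAle; apply/andP; split; last lra.
    by apply: contraTneq FE => h00; move: Lh; rewrite -leNgt betaE -h00 !scale0r; lra.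
  have hlt : h < rho / 2.
    rewrite lt_neqAle; apply/andP; split; last lra.
    apply: contraTneq FE => hh; rewrite -leNgt.
    have : 2 * B <= L * (h * rho - h ^+ 2) by rewrite hh -KB; move: L0 r20 K0; clear; nra.
    move: uB1 uB2 Kt Ks; rewrite betaE; clear; lra.
  have xlt : `|x - x1| < rho / 2.
    rewrite lt_neqAle xr andbT; apply: contraTneq FE => hh; rewrite -leNgt.
    have := norm_sqr_le_sqnorm (x - x1); rewrite hh => h4.
    have : 2 * B <= K * (8 * sqnorm (x - x1)) by rewrite -KB; move: h4 K0; clear; nra.
    move: uB1 uB2 Kt Lh; rewrite betaE; clear; lra.
  have tgt : t1 - rho ^+ 2 < t.
    rewrite lt_neqAle; apply/andP; split; last lra.
    apply: contraTneq FE => hh; rewrite -leNgt.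
    have : 2 * B <= K * (2 * (t1 - t)) by rewrite -hh -KB; clear; lra.
    move: uB1 uB2 Ks Lh; rewrite betaE; clear; lra.
  have [cp cpB [dp [ap [dp1 ap1 cpE]]]] := uh _ t p1r tr.
  have [cq cqB [dq [aq [dq1 aq1 cqE]]]] := uh _ t q1r tr.
  have dpq : 0 <= dp - dq + 2 * K.
    have pp := peano1D (peano1D dp1 (peano1Z (-1) dq1)) (peano1_affine 0 (2 * K)).
    have -> : dp - dq + 2 * K = dp + -1 * dq + 2 * K by ring.
    apply: (peano1_left_max pp (r := t - (t1 - rho ^+ 2))); first lra.
    move=> s s0 /=.
    have : F (x, t + s, h) <= F (x, t, h).
      by apply: Fmax; apply: AP => //; lra.
    rewrite /F/= /beta addr0; clear; lra.
  pose del := Num.min (rho / 2 - `|x - x1|) (Num.min h (rho / 2 - h)).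
  have del0 : 0 < del by rewrite !lt_min hgt0 !subr_gt0 xlt hlt.
  have dele (s : R) : `|s| <= del ->
    [/\ `|s| <= rho / 2 - `|x - x1|, `|s| <= h & `|s| <= rho / 2 - h].
    by rewrite /del !le_min => /and3P.
  have Aline (s s' : R) (j : 'I_n) : `|s| <= del -> `|s'| <= del ->
      A (x + s *: evec R j, t, h + s').
    move=> /dele[s1 s2 s3] /dele[s4 s5 s6]; apply: AP => //.
      rewrite addrAC (le_trans (ler_normD _ _))//.
      by have := norm_scale_evec s j; move: s1; clear; lra.
    by move: s5 s6; rewrite !ler_norml; clear; lra.
  (* For [j] other than [i] both points move together and only the difference of second derivatives
     is controlled. Along [e] each point is moved alone by half steps, which changes [h], so each
     bound gains L/2. *)
  have apj j : j != i -> ap j - aq j <= 16 * K.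
    move=> ji.
    have pp := peano2D (peano2D (ap1 j) (peano2Z (-1) (aq1 j)))
      (peano2_quadratic 0 (- (K * 8 * (2 * (x - x1) 0 j))) (- (K * 8))).
    suff : ap j + -1 * aq j + 2 * - (K * 8) <= 0 by clear; lra.
    apply: (peano2_max pp del0) => s sd /=.
    have := Fmax _ (Aline s 0 j sd ltac:(by rewrite normr0 ltW)).
    rewrite /F/= /beta addr0 !(addrAC x (s *: _)) (sqnorm_add_evec (x - x1)) !scale0r !addr0.
    clear; lra.
  have api : ap i <= 4 * K - L / 2.
    have pp := peano2D (ap1 i)
      (peano2_quadratic 0 (- (K * 8 * (x - x1) 0 i) - L * (rho / 2 - h)) (- (2 * K - L / 4))).
    suff : ap i + 2 * - (2 * K - L / 4) <= 0 by clear; lra.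
    apply: (peano2_max pp del0) => s sd /=.
    have sd2 : `|s / 2| <= del.
      by rewrite normrM [`|2^-1|]gtr0_norm ?invr_gt0//; have := normr_ge0 s; move: sd; clear; lra.
    have := Fmax _ (Aline (s / 2) (s / 2) i sd2 sd2).
    have -> : F (x + (s / 2) *: evec R i, t, h + s / 2) =
      u (x + h *: e + s *: e) t - u (x + h *: - e) t -
      (beta x t h + (K * 8 * (x - x1) 0 i + L * (rho / 2 - h)) * s + (2 * K - L / 4) * s ^+ 2).
      rewrite /F/= /beta (addrAC x ((s / 2) *: _) (- x1)) (sqnorm_add_evec (x - x1)).
      have [E1 E2 _ _] := half_step_points x e s h; rewrite -/e E1 E2.
      by field.
    rewrite /F/= scale0r !addr0; clear; lra.
  have aqi : - aq i <= 4 * K - L / 2.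
    have pp := peano2D (peano2Z (-1) (aq1 i))
      (peano2_quadratic 0 (- (K * 8 * (x - x1) 0 i) + L * (rho / 2 - h)) (- (2 * K - L / 4))).
    suff : -1 * aq i + 2 * - (2 * K - L / 4) <= 0 by clear; lra.
    apply: (peano2_max pp del0) => s sd /=.
    have sd2 : `|s / 2| <= del.
      by rewrite normrM [`|2^-1|]gtr0_norm ?invr_gt0//; have := normr_ge0 s; move: sd; clear; lra.
    have sd3 : `|- (s / 2)| <= del by rewrite normrN.
    have := Fmax _ (Aline (s / 2) (- (s / 2)) i sd2 sd3).
    have -> : F (x + (s / 2) *: evec R i, t, h - s / 2) =
      u (x + h *: e) t - u (x + h *: - e + s *: e) t -
      (beta x t h + (K * 8 * (x - x1) 0 i - L * (rho / 2 - h)) * s + (2 * K - L / 4) * s ^+ 2).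
      rewrite /F/= /beta (addrAC x ((s / 2) *: _) (- x1)) (sqnorm_add_evec (x - x1)).
      have [_ _ E1 E2] := half_step_points x e s h; rewrite -/e E1 E2.
      by field.
    rewrite /F/= scale0r !addr0; clear; lra.
  have sumle : \sum_j ap j - \sum_j aq j <= 16 * K * n%:R + 8 * K - L.
    rewrite -sumrB (bigD1 i)//=.
    have : \sum_(j < n | j != i) (ap j - aq j) <= \sum_(j < n | j != i) 16 * K.
      by apply: ler_sum => j ji; exact: apj.
    have : \sum_(j < n | j != i) 16 * K <= \sum_(j < n) 16 * K.
      by rewrite [leRHS](bigD1 i)//= lerDr mulr_ge0// ltW.
    rewrite [X in _ <= X]sumr_const card_ord -[_ *+ n]mulr_natr.
    move: api aqi; clear; lra.
  move: cpB cqB; rewrite !ler_norml -/K cpE cqE.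
  move: sumle dpq K0; rewrite /L; clear; lra.
have := Fmax _ A1.
rewrite /F/= -/e scalerN.
have b1 : beta x1 t1 h0 <= (16 * n%:R + 20) * B * h0 / rho.
  rewrite /beta !subrr /sqnorm big1 ?mulr0 ?add0r ?mulr0; last first.
    by move=> j _; rewrite mxE expr0n.
  rewrite add0r /L ler_pdivlMr// -KB.
  have : 0 <= L * h0 ^+ 2 by rewrite mulr_ge0 ?sqr_ge0//; lra.
  rewrite /L; nra.
move: b1 F1; rewrite /F/=; clear; lra.
Qed.

End Brandt.

(** * From the gradient bound to a lower bound on a box *)

Section Lipschitz.
Variables (R : realType) (n : nat).
Implicit Types (u : 'rV[R]_n -> R -> R) (x y : 'rV[R]_n).

Lemma jcontN u x (t : R) : jcont u x t -> jcont (fun x t => -1 * u x t) x t.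
Proof. by move=> cu; apply: contAtM; [exact: contAtC|exact: cu]. Qed.

Lemma brandt_norm u x1 (t1 rho B : R) (i : 'I_n) : 0 < rho -> 0 < B ->
  (forall x (t : R), `|x - x1| <= rho -> t1 - rho ^+ 2 <= t <= t1 -> jcont u x t) ->
  (forall x (t : R), `|x - x1| <= rho -> t1 - rho ^+ 2 <= t <= t1 -> `|u x t| <= B) ->
  (forall x (t : R), `|x - x1| <= rho -> t1 - rho ^+ 2 <= t <= t1 ->
    exists2 c, `|c| <= B / rho ^+ 2 & heat_at u x t c) ->
  forall h : R, 0 <= h <= rho / 2 ->
  `|u (x1 + h *: evec R i) t1 - u (x1 - h *: evec R i) t1| <=
    (16 * n%:R + 20) * B * h / rho.
Proof.
move=> r0 B0 cu uB uh h hr; rewrite ler_norml; apply/andP; split; last exact: brandt.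
have := @brandt _ _ (fun x t => -1 * u x t) x1 t1 rho B i r0 B0 _ _ _ h hr.
set a := u _ t1; set b := u _ t1.
have <- : - (a - b) = -1 * a - -1 * b by ring.
rewrite lerNl; apply.
- by move=> x t xr tr; apply: jcontN; exact: cu.
- by move=> x t xr tr; rewrite mulN1r normrN; exact: uB.
- move=> x t xr tr; have [c cB hc] := uh x t xr tr.
  by exists (-1 * c); [rewrite mulN1r normrN|exact: heat_atZ].
Qed.

Definition tame u x1 (t1 rho B : R) := forall x (t : R), `|x - x1| <= rho ->
  t1 - rho ^+ 2 <= t <= t1 ->
  [/\ jcont u x t, `|u x t| <= B &
      exists2 c, `|c| <= B / rho ^+ 2 & heat_at u x t c].

(** The symmetric difference of [brandt_norm] is taken about the midpoint of the segment, in a box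
    of radius rho/4, which stays inside the box where [u] is tame. *)
Lemma lipschitz_coord u x1 (t1 rho B : R) y (t s : R) (i : 'I_n) :
  0 < rho -> 0 < B -> tame u x1 t1 rho B -> `|y - x1| <= rho / 2 ->
  t1 - rho ^+ 2 / 2 <= t <= t1 -> `|s| <= rho / 4 ->
  `|u (y + s *: evec R i) t - u y t| <= 2 * (16 * n%:R + 20) * B * `|s| / rho.
Proof.
move=> r0 B0 ut yr tr sr; set e := evec R i.
have r20 : 0 < rho ^+ 2 by rewrite exprn_gt0.
pose z := y + (s / 2) *: e.
have zr : `|z - x1| <= rho / 2 + rho / 8.
  rewrite /z addrAC (le_trans (ler_normD _ _))// lerD//.
  rewrite (le_trans (norm_scale_evec _ _))// normrM [`|2^-1|]gtr0_norm ?invr_gt0//.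
  by move: sr; clear; lra.
have inQ x (t' : R) : `|x - z| <= rho / 4 -> t - (rho / 4) ^+ 2 <= t' <= t ->
    `|x - x1| <= rho /\ t1 - rho ^+ 2 <= t' <= t1.
  move=> xz tt; split.
    rewrite -(subrK z x) -addrA (le_trans (ler_normD _ _))//.
    by move: xz zr r0; clear; lra.
  move: tt tr r20; rewrite expr_div_n; have -> : 4 ^+ 2 = 16 :> R by ring.
  by clear; lra.
have hb : 0 <= `|s| / 2 <= rho / 4 / 2 by move: sr (normr_ge0 s); clear; lra.
have r40 : 0 < rho / 4 by rewrite divr_gt0.
have := @brandt_norm u z t (rho / 4) B i r40 B0 _ _ _ (`|s| / 2) hb.
have -> : `|u (z + (`|s| / 2) *: evec R i) t - u (z - (`|s| / 2) *: evec R i) t| =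
   `|u (y + s *: e) t - u y t|.
  rewrite -/e -(scalerN _ e); have [s0|s0] := leP 0 s.
    have [E1 E2 _ _] := half_step_points y e s 0.
    rewrite (ger0_norm s0) /z.
    by move: E1 E2; rewrite !add0r !scale0r !addr0 => -> ->.
  have [_ _ E1 E2] := half_step_points y e s 0.
  rewrite (ltr0_norm s0) /z distrC mulNr.
  by move: E1 E2; rewrite !sub0r !scale0r !addr0 => -> ->.
have -> : (16 * n%:R + 20) * B * (`|s| / 2) / (rho / 4) =
  2 * (16 * n%:R + 20) * B * `|s| / rho by field; rewrite gt_eqF.
apply.
- by move=> x t' xz tt; have [h1 h2] := inQ _ _ xz tt; have [] := ut _ _ h1 h2.
- by move=> x t' xz tt; have [h1 h2] := inQ _ _ xz tt; have [] := ut _ _ h1 h2.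
- move=> x t' xz tt; have [h1 h2] := inQ _ _ xz tt; have [_ _ [c cB hc]] := ut _ _ h1 h2.
  exists c => //; rewrite (le_trans cB)// expr_div_n invf_div.
  rewrite ler_pM2l// ler_peMl ?invr_ge0 ?ltW//.
  by clear; lra.
Qed.

Lemma lipschitz_path u x1 (t1 rho B : R) y (t : R) :
  0 < rho -> 0 < B -> tame u x1 t1 rho B -> `|y - x1| <= rho / 4 ->
  t1 - rho ^+ 2 / 2 <= t <= t1 ->
  `|u y t - u x1 t| <= n%:R * (2 * (16 * n%:R + 20) * B * `|y - x1| / rho).
Proof.
move=> r0 B0 ut yr tr; set C := 2 * _ * _ * _ / _.
(* Coordinates are replaced one at a time; in the max norm no intermediate point is farther from
   [x1] than [y]. *)
pose p k : 'rV[R]_n := \row_(j < n) (if (j < k)%N then y 0 j else x1 0 j).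
have pd k : `|p k - x1| <= `|y - x1|.
  apply: norm_rV_le => // j; rewrite !mxE; case: ifPn => _; last by rewrite subrr normr0.
  by have := coord_le_norm (y - x1) j; rewrite !mxE.
suff H k : (k <= n)%N -> `|u (p k) t - u x1 t| <= k%:R * C.
  have -> : y = p n by apply/rowP => j; rewrite mxE ltn_ord.
  exact: H.
elim: k => [_|k IH kn].
  have -> : p 0%N = x1 by apply/rowP => j; rewrite mxE.
  by rewrite subrr normr0 mul0r.
pose i := Ordinal kn.
have -> : p k.+1 = p k + (y - x1) 0 i *: evec R i.
  apply/rowP => j; rewrite add_scale_evecE mxE [p k 0 j]mxE.
  have [->|ji] := eqVneq j i; first by rewrite /= ltnSn ltnn mulr1 !mxE; ring.
  rewrite mulr0 addr0 ltnS leq_eqVlt.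
  by have /negbTE -> : (j != k :> nat) by apply: contra ji => /eqP jk; apply/eqP/val_inj.
have st : `|u (p k + (y - x1) 0 i *: evec R i) t - u (p k) t| <= C.
  rewrite (le_trans (lipschitz_coord _ r0 B0 ut _ _ _))//.
  - by rewrite (le_trans (pd k))//; move: yr r0; clear; lra.
  - by rewrite (le_trans (coord_le_norm _ _)).
  - rewrite /C ler_pM2r ?invr_gt0// ler_wpM2l ?coord_le_norm//.
    by rewrite mulr_ge0 ?(ltW B0)// mulr_ge0// addr_ge0// mulr_ge0.
rewrite -(subrKA (u (p k) t)) (le_trans (ler_normD _ _))//.
rewrite -natr1 mulrDl mul1r [leRHS]addrC lerD//; exact: IH (ltnW kn).
Qed.

(** The gradient bound gives no control in time. For that, a paraboloid above the Lipschitz cone of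
    [u] at an earlier time t, raised at constant speed, stays above [u] until [t1]: since u(x1, t1)
    = M, u(x1, t) cannot be small. The losses are M/8 and M/8 for time and M/4 for space. *)
Lemma bump_lower_bound (L : R) : 0 < L -> exists2 c : R, 0 < c <= 1 / 4 &
  forall u x1 (t1 rho M : R), 0 < rho -> 0 < M ->
  tame u x1 t1 rho (L * M) ->
  (forall x (t : R), `|x - x1| <= rho -> t1 - rho ^+ 2 <= t <= t1 -> 0 <= u x t) ->
  u x1 t1 = M ->
  forall x (t : R), `|x - x1| <= c * rho -> t1 - c * rho ^+ 2 <= t <= t1 ->
    M / 2 <= u x t.
Proof.
move=> L0.
have n0 : 0 <= n%:R :> R by [].
pose C1 : R := n%:R * (2 * (16 * n%:R + 20)) + 1.
have C11 : 1 <= C1 by rewrite /C1; move: n0; clear; nra.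
have C10 : 0 < C1 by move: C11; clear; lra.
have CL0 : 0 < C1 * L by rewrite mulr_gt0.
(* The term 8 C1 L limits the height C1 B e of the paraboloid to M/8; the term 16 makes it exceed B
   at distance rho/4. *)
pose e := (8 * (C1 * L) + 16)^-1.
have e0 : 0 < e by rewrite invr_gt0; move: CL0; clear; lra.
have eE : e * (8 * (C1 * L) + 16) = 1 by rewrite mulVf// gt_eqF//; move: CL0; clear; lra.
have eCL : C1 * L * e <= 1 / 8 by move: eE e0 CL0; clear; nra.
have e16 : e <= 1 / 16 by move: eE e0 CL0; clear; nra.
(* Speed of the barrier in units of B / rho^2: 1 pays for the heat operator of [u], the rest for the
   Laplacian of the paraboloid. *)
pose G := 1 + 2 * n%:R * C1 / e.
have G0 : 0 < G by rewrite ltr_pwDl// divr_ge0 ?mulr_ge0// ltW.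
have LG0 : 0 < L * G by rewrite mulr_gt0.
pose c := (4 + 4 * (C1 * L) + 8 * (L * G))^-1.
have c0 : 0 < c by rewrite invr_gt0; move: CL0 LG0; clear; lra.
have cE : c * (4 + 4 * (C1 * L) + 8 * (L * G)) = 1.
  by rewrite mulVf// gt_eqF//; move: CL0 LG0; clear; lra.
have c4 : c <= 1 / 4 by move: cE c0 CL0 LG0; clear; nra.
have cCL : C1 * L * c <= 1 / 4 by move: cE c0 CL0 LG0; clear; nra.
have cLG : L * G * c <= 1 / 8 by move: cE c0 CL0 LG0; clear; nra.
exists c; first by rewrite c0.
move=> u x1 t1 rho M r0 M0 + u_ge0 u1 x t xr tr.
have r20 : 0 < rho ^+ 2 by rewrite exprn_gt0.
set B := L * M => ut; have B0 : 0 < B by rewrite mulr_gt0.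
have trr : t1 - rho ^+ 2 / 4 <= t <= t1 by move: tr c4 r20; clear; nra.
have lip y (s : R) : `|y - x1| <= rho / 4 -> t1 - rho ^+ 2 / 4 <= s <= t1 ->
    `|u y s - u x1 s| <= C1 * B * (`|y - x1| / rho).
  move=> yr sr; have sr' : t1 - rho ^+ 2 / 2 <= s <= t1 by move: sr r20; clear; lra.
  rewrite (le_trans (lipschitz_path r0 B0 ut yr sr'))//.
  have : 0 <= B * (`|y - x1| / rho) by rewrite mulr_ge0 ?divr_ge0// ltW.
  have -> : n%:R * (2 * (16 * n%:R + 20) * B * `|y - x1| / rho) =
    n%:R * (2 * (16 * n%:R + 20)) * (B * (`|y - x1| / rho)) by ring.
  rewrite -(mulrA C1) /C1; move: (B * _) => z z0.
  by rewrite [leRHS]mulrDl mul1r lerDl.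
pose K := B / rho ^+ 2 * G.
have time : M <= u x1 t + C1 * B * e + K * (t1 - t).
  pose k1 := C1 * B / (e * rho ^+ 2).
  pose D y s := (u x1 t + C1 * B * e - K * t + K * s) + k1 * sqnorm (y - x1) + -1 * u y s.
  have k10 : 0 < k1 by rewrite divr_gt0 ?mulr_gt0.
  have CB0 : 0 < C1 * B by rewrite mulr_gt0.
  have u10 : 0 <= u x1 t.
    by have := u_ge0 x1 t ltac:(rewrite subrr normr0; exact: ltW) ltac:(move: trr r20; clear; lra); exact.
  have inQ y (s : R) : `|y - x1| <= rho / 4 -> t <= s <= t1 ->
    `|y - x1| <= rho /\ t1 - rho ^+ 2 <= s <= t1.
    by move=> yr sr; split; [move: yr r0|move: sr trr r20]; clear; lra.
  have K0 : 0 <= K by rewrite mulr_ge0 ?divr_ge0// ltW.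
  have : 0 <= D x1 t1.
    apply: (@comparison _ _ D x1 (rho / 4) t t1).
    - move=> y s yr sr; have [h1 h2] := inQ _ _ yr sr.
      have c1 : {for (y, s), continuous (fun p : 'rV[R]_n * R => p.1)} by exact: cvg_fst.
      have c2 : {for (y, s), continuous (fun p : 'rV[R]_n * R => p.2)} by exact: cvg_snd.
      apply: contAtD; last by apply: jcontN; have [] := ut _ _ h1 h2.
      apply: contAtD.
        by apply: contAtD; [exact: contAtC|apply: contAtM; [exact: contAtC|exact: c2]].
      apply: contAtM; first exact: contAtC.
      exact: (continuous_comp c1 (@continuous_sqnorm_sub _ _ x1 _)).
    - move=> y yr; have := lip y t yr trr; rewrite ler_norml => /andP[_ h1].
      set a := `|y - x1| / rho in h1.
      have a2 : a ^+ 2 * rho ^+ 2 <= sqnorm (y - x1).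
        by rewrite -exprMn divfK ?gt_eqF// norm_sqr_le_sqnorm.
      have h2 : C1 * B * (a ^+ 2 / e) <= k1 * sqnorm (y - x1).
        have -> : C1 * B * (a ^+ 2 / e) = k1 * (a ^+ 2 * rho ^+ 2).
          by rewrite /k1; field; rewrite !gt_eqF.
        by rewrite ler_pM2l.
      (* Arithmetic-geometric mean: the cone lies below a paraboloid of height [e]. *)
      have h3 : a <= e + a ^+ 2 / e.
        rewrite -(ler_pM2r e0) mulrDl divfK ?gt_eqF//.
        by clear; nra.
      have h4 : C1 * B * a <= C1 * B * e + C1 * B * (a ^+ 2 / e) by rewrite -mulrDr ler_pM2l.
      by rewrite /D; move: h1 h2 h4; clear; lra.
    - move=> y s yr sr; have [|h1 h2] := inQ y s _ sr; first by rewrite yr.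
      have [_ + _] := ut _ _ h1 h2; rewrite ler_norml => /andP[_ h3].
      have a2 := norm_sqr_le_sqnorm (y - x1); rewrite yr in a2.
      have h4 : B <= k1 * sqnorm (y - x1).
        apply: (@le_trans _ _ (k1 * (rho / 4) ^+ 2)); last by rewrite ler_pM2l.
        have -> : k1 * (rho / 4) ^+ 2 = C1 * B / (16 * e).
          by rewrite /k1; field; rewrite !gt_eqF.
        rewrite ler_pdivlMr ?mulr_gt0// mulrC ler_pM2r//.
        by move: e16 C11; clear; lra.
      have h5 : 0 <= K * (s - t) by rewrite mulr_ge0//; move: sr; clear; lra.
      have h6 : 0 <= C1 * B * e by rewrite mulr_ge0// ltW.
      by rewrite /D; move: h3 h4 h5 h6 u10; clear; lra.
    - move=> y s yr sr.
      have [||h1 h2] := inQ y s; [exact: ltW|move: sr; clear; lra|].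
      have [_ _ [d dB hd]] := ut y s h1 h2.
      exists (K + k1 * (- (2 * n%:R)) + -1 * d); last first.
        apply: heat_atD; last exact: heat_atZ.
        by apply: heat_atD; [exact: heat_at_affine|apply: heat_atZ; exact: heat_at_sqnorm].
      move: dB; rewrite ler_norml => /andP[_ dB].
      have -> : K + k1 * - (2 * n%:R) = B / rho ^+ 2.
        by rewrite /K /k1 /G; field; rewrite !gt_eqF.
      by move: dB; clear; lra.
    - by rewrite subrr normr0 divr_ge0// ltW.
    - by move: trr r20; clear; lra.
  rewrite /D subrr u1 /sqnorm big1; last by move=> i _; rewrite mxE expr0n.
  by clear; lra.
have h1 : C1 * B * e <= M / 8.
  by rewrite /B; move: eCL M0; clear; nra.
have h2 : K * (t1 - t) <= M / 8.
  apply: (@le_trans _ _ (K * (c * rho ^+ 2))).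
    rewrite ler_wpM2l//; last by move: tr; clear; lra.
    by rewrite mulr_ge0 ?divr_ge0// ltW.
  have -> : K * (c * rho ^+ 2) = M * (L * G * c) by rewrite /K /B; field; rewrite gt_eqF.
  by move: cLG M0; clear; nra.
have xr4 : `|x - x1| <= rho / 4 by move: xr c4 r0; clear; nra.
have := lip x t xr4 trr; rewrite ler_norml => /andP[h3 _].
have h4 : C1 * B * (`|x - x1| / rho) <= M / 4.
  apply: (@le_trans _ _ (C1 * B * c)).
    by rewrite ler_pM2l ?mulr_gt0// ler_pdivrMr.
  by rewrite /B; move: cCL M0; clear; nra.
by move: time h1 h2 h3 h4; clear; lra.
Qed.

End Lipschitz.

(** * Capacity estimate *)

Section Gaussian.
Variables (R : realType) (n : nat).
Implicit Types (x y z : 'rV[R]_n) (s t k : R).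

(** Up to the factor pi^(-n/2), the heat kernel in the variable s = 4 t for s > 0, kept as one
    exponential so that derivatives and comparisons reduce to its exponent. *)
Definition gauss z s : R := expR (- (n%:R / 2) * ln s - sqnorm z / s).

Lemma gauss_gt0 z s : 0 < gauss z s.
Proof. exact: expR_gt0. Qed.

Lemma gaussE z s : 0 < s -> gauss z s = s `^ (- (n%:R / 2)) * expR (- (sqnorm z / s)).
Proof. by move=> s0; rewrite /gauss expRD /powR gt_eqF. Qed.

Lemma gauss_le z s : 0 < s -> gauss z s <= s `^ (- (n%:R / 2)).
Proof.
move=> s0; rewrite gaussE// ger_pMr ?powR_gt0//.
by rewrite -expR0 ler_expR oppr_le0 divr_ge0 ?sqnorm_ge0// ltW.
Qed.

Lemma is_derive_gauss_time z (s0 t : R) : 0 < s0 + 4 * t ->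
  is_derive t 1 (fun t => gauss z (s0 + 4 * t))
    (gauss z (s0 + 4 * t) * (4 * sqnorm z / (s0 + 4 * t) ^+ 2 - 2 * n%:R / (s0 + 4 * t))).
Proof.
move=> st0; rewrite /gauss.
have st : s0 + 4 * t != 0 by rewrite gt_eqF.
have d1 : is_derive t 1 (fun t : R => s0 + 4 * t) 4.
  by apply: is_derive_eq; rewrite /GRing.scale/=; ring.
have d2 : is_derive t 1 (fun t : R => ln (s0 + 4 * t)) ((s0 + 4 * t)^-1 * 4).
  by apply: (@is_derive1_comp _ (@ln R)); exact: is_derive1_ln.
have d3 : is_derive t 1 (fun t : R => (s0 + 4 * t)^-1) (- (s0 + 4 * t) ^- 2 * 4).
  exact: (@is_deriveV _ (fun t : R => s0 + 4 * t)) st d1.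
have d4 : is_derive t 1 (fun t : R => - (n%:R / 2) * ln (s0 + 4 * t) - sqnorm z / (s0 + 4 * t))
   (4 * sqnorm z / (s0 + 4 * t) ^+ 2 - 2 * n%:R / (s0 + 4 * t)).
  by apply: is_derive_eq; rewrite /GRing.scale/=; field.
by apply: (@is_derive1_comp _ (@expR R)); exact: is_derive_expR.
Qed.

Lemma is_derive_exp_quadratic (a b c r : R) :
  is_derive r 1 (fun r : R => expR (a + b * r + c * r ^+ 2))
    (expR (a + b * r + c * r ^+ 2) * (b + 2 * c * r)).
Proof.
have d1 : is_derive r 1 (fun r : R => a + b * r + c * r ^+ 2) (b + 2 * c * r).
  by apply: is_derive_eq; rewrite /GRing.scale/=; ring.
by apply: (@is_derive1_comp _ (@expR R)); exact: is_derive_expR.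
Qed.

Lemma peano2_exp_quadratic (a b c : R) :
  peano2 (fun r : R => expR (a + b * r + c * r ^+ 2)) (expR a * (b ^+ 2 + 2 * c)).
Proof.
pose f (r : R) := expR (a + b * r + c * r ^+ 2).
apply: (@peano2_ext _ (fun r => f (0 + r))); first by move=> r; rewrite add0r.
apply: (@is_derive_peano2 _ f (fun r => f r * (b + 2 * c * r)) 0 _ 1) => //.
  by move=> r _; exact: is_derive_exp_quadratic.
have d1 := is_derive_exp_quadratic a b c 0.
have d2 : is_derive (0 : R) 1 (fun r : R => b + 2 * c * r) (2 * c).
  by apply: is_derive_eq; rewrite /GRing.scale/=; ring.
have d3 := @is_deriveM _ _ f (fun r => b + 2 * c * r) 0 1 _ _ d1 d2.
apply: is_derive_eq.
rewrite /f /GRing.scale/= expr0n/= !mulr0 !addr0; ring.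
Qed.

Lemma heat_at_gauss y s0 x t : 0 < s0 + 4 * t ->
  heat_at (fun x t => gauss (x - y) (s0 + 4 * t)) x t 0.
Proof.
move=> st0; have st : s0 + 4 * t != 0 by rewrite gt_eqF.
set s := s0 + 4 * t in st0 st *; set z := x - y.
exists (gauss z s * (4 * sqnorm z / s ^+ 2 - 2 * n%:R / s)).
exists (fun i => gauss z s * ((- (2 * z 0 i / s)) ^+ 2 + 2 * (- s^-1))); split.
- exact: is_derive_peano1 (is_derive_gauss_time _ _).
- move=> i; apply: peano2_ext; last exact: peano2_exp_quadratic.
  move=> r /=; rewrite /gauss (addrAC x) sqnorm_add_evec -/z -/s; congr expR.
  by field.
- rewrite -mulr_sumr big_split/= sumr_const card_ord.
  have -> : \sum_(i < n) (- (2 * z 0 i / s)) ^+ 2 = 4 * sqnorm z / s ^+ 2.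
    rewrite /sqnorm mulr_sumr mulr_suml; apply: eq_bigr => i _; by field.
  by rewrite -[_ *+ n]mulr_natr; field.
Qed.

Lemma jcont_gauss y s0 x t : 0 < s0 + 4 * t ->
  jcont (fun x t => gauss (x - y) (s0 + 4 * t)) x t.
Proof.
move=> st0; rewrite /jcont.
have c1 : {for (x, t), continuous (fun p : 'rV[R]_n * R => p.1)} by exact: cvg_fst.
have c2 : {for (x, t), continuous (fun p : 'rV[R]_n * R => p.2)} by exact: cvg_snd.
have c3 : {for (x, t), continuous (fun p : 'rV[R]_n * R => s0 + 4 * p.2)}.
  by apply: contAtD; [exact: contAtC|apply: contAtM; [exact: contAtC|exact: c2]].
have c4 : {for (x, t), continuous (fun p : 'rV[R]_n * R => sqnorm (p.1 - y))}.
  exact: (continuous_comp c1 (@continuous_sqnorm_sub _ _ y _)).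
apply: (@contAt_comp _ _ _ (@expR R)); last exact: continuous_expR.
apply: contAtB; first apply: contAtM; first exact: contAtC.
  by apply: (@contAt_comp _ _ _ (@ln R)); [exact: c3|exact: continuous_ln].
by apply: contAtM; [exact: c4|apply: contAtV; [rewrite gt_eqF|exact: c3]].
Qed.

(** At a fixed point the Gaussian increases until s = 2 |z|^2 / n; the inequality ln y <= y - 1
    replaces a derivative. *)
Lemma gauss_mono_time z s s' : 0 < s -> s <= s' -> n%:R / 2 * s' <= sqnorm z ->
  gauss z s <= gauss z s'.
Proof.
move=> s0 ss' hq; have s'0 : 0 < s' by exact: lt_le_trans ss'.
rewrite ler_expR.
have h1 : ln (s' / s) <= s' / s - 1.
  by have := @le_ln1Dx R (s' / s - 1); rewrite (addrC 1) subrK; apply; rewrite ltrBrDl subrr divr_gt0.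
rewrite ln_div ?posrE// in h1.
have h2 : n%:R / 2 * (ln s' - ln s) <= n%:R / 2 * (s' / s - 1) by rewrite ler_wpM2l// divr_ge0.
have h3 : n%:R / 2 * (s' / s - 1) = (n%:R / 2 * s') * (s^-1 - s'^-1).
  by field; rewrite !gt_eqF.
have h4 : (n%:R / 2 * s') * (s^-1 - s'^-1) <= sqnorm z * (s^-1 - s'^-1).
  by rewrite ler_wpM2r// subr_ge0 lef_pV2.
by move: h2 h3 h4; clear; lra.
Qed.

(* A solution that is at most 1, and at time 0 is nonpositive outside a ball of
   radius of order [sqrt k]. *)
Definition gbump (k : R) y x t : R :=
  k `^ (n%:R / 2) * (gauss (x - y) (k + 4 * t) - 1 / 2 * gauss (x - y) (2 * k + 4 * t)).

Lemma gbump_le_gauss k y x t : 0 < k -> 0 <= t ->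
  gbump k y x t <= k `^ (n%:R / 2) * gauss (x - y) (k + 4 * t).
Proof.
move=> k0 t0; rewrite ler_pM2l ?powR_gt0// gerBl mulr_ge0// ltW//; exact: gauss_gt0.
Qed.

Lemma gbump_le k y x t (j : R) : 0 < k -> 0 <= t -> 0 < j -> k * j <= k + 4 * t ->
  gbump k y x t <= j `^ (- (n%:R / 2)).
Proof.
move=> k0 t0 j0 kj; have kt0 : 0 < k + 4 * t by rewrite ltr_pwDl// mulr_ge0.
rewrite (le_trans (gbump_le_gauss _ _ k0 t0))//.
rewrite (le_trans (ler_wpM2l (powR_ge0 _ _) (gauss_le _ kt0)))//.
rewrite !powRN ler_pdivrMr ?powR_gt0// [leRHS]mulrC ler_pdivlMr ?powR_gt0//.
rewrite -powRM ?(ltW k0) ?(ltW j0)// ge0_ler_powR ?nnegrE// ?divr_ge0//.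
- by rewrite mulr_ge0// ltW.
- exact: ltW.
Qed.

(** The sign depends on whether |x - y|^2 / (2 k) exceeds (n/2 + 1) ln 2, and ln 2 <= 1. *)
Lemma gbump_init_le0 k y x : 0 < k -> (n%:R + 2) * k <= sqnorm (x - y) ->
  gbump k y x 0 <= 0.
Proof.
move=> k0 hq; rewrite mulr_ge0_le0 ?powR_ge0// subr_le0 mulr0 !addr0.
have -> : 1 / 2 = expR (- ln 2) :> R by rewrite expRN lnK ?posrE// div1r.
rewrite /gauss -expRD ler_expR lnM ?posrE//.
have l2 : ln 2 <= 1 :> R.
  by have -> : 2 = 1 + 1 :> R by []; apply: le_ln1Dx; lra.
have l20 : 0 <= ln 2 :> R by rewrite ln_ge0//; lra.
have hq' : n%:R + 2 <= sqnorm (x - y) / k by rewrite ler_pdivlMr.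
have -> : sqnorm (x - y) / (2 * k) = sqnorm (x - y) / k / 2 by field; rewrite gt_eqF.
have n0 : 0 <= n%:R :> R by [].
move: (sqnorm _ / k) hq' => a; move: (ln k) (ln 2) l2 l20 n0 => b c.
by clear; nra.
Qed.

Lemma heat_at_gbump k y x t t0 : 0 < k -> t0 <= t ->
  heat_at (fun x t => gbump k y x (t - t0)) x t 0.
Proof.
move=> k0 tt0.
have h1 : heat_at (fun x t => gauss (x - y) ((k - 4 * t0) + 4 * t)) x t 0.
  by apply: heat_at_gauss; lra.
have h2 : heat_at (fun x t => gauss (x - y) ((2 * k - 4 * t0) + 4 * t)) x t 0.
  by apply: heat_at_gauss; lra.
have := heat_atZ (k `^ (n%:R / 2)) (heat_atD h1 (heat_atZ (- (1 / 2)) h2)).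
rewrite !mulr0 addr0 mulr0.
set f := fun (x : 'rV[R]_n) (t : R) => _.
have -> // : f = (fun x t => gbump k y x (t - t0)).
apply/funext => x'; apply/funext => t'; rewrite /f /gbump mulNr.
by congr (_ * (gauss _ _ - _ * gauss _ _)); ring.
Qed.

Lemma jcont_gbump k y x t t0 : 0 < k -> t0 <= t ->
  jcont (fun x t => gbump k y x (t - t0)) x t.
Proof.
move=> k0 tt0.
have h1 : jcont (fun x t => gauss (x - y) ((k - 4 * t0) + 4 * t)) x t.
  by apply: jcont_gauss; lra.
have h2 : jcont (fun x t => gauss (x - y) ((2 * k - 4 * t0) + 4 * t)) x t.
  by apply: jcont_gauss; lra.
rewrite /jcont.
have -> : (fun p : 'rV[R]_n * R => gbump k y p.1 (p.2 - t0)) =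
  (fun p => k `^ (n%:R / 2) * (gauss (p.1 - y) ((k - 4 * t0) + 4 * p.2) -
     1 / 2 * gauss (p.1 - y) ((2 * k - 4 * t0) + 4 * p.2))).
  apply/funext => p; rewrite /gbump.
  by congr (_ * (gauss _ _ - _ * gauss _ _)); ring.
apply: contAtM; first exact: contAtC.
by apply: contAtB; [exact: h1|apply: contAtM; [exact: contAtC|exact: h2]].
Qed.

(** At times of order [ts] both Gaussians have nearly the same width: passing from s to s + k
    changes the exponent by at most 1/4. As e^(1/4) <= 3/2, the subtracted half costs at most 3/4,
    and a quarter survives. *)
Lemma gbump_lower k y x t (ts r : R) : 0 < k -> 0 < ts -> k <= ts ->
  r ^+ 2 * k <= ts ^+ 2 -> ts / 2 <= t <= ts -> sqnorm (x - y) <= r ^+ 2 ->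
  k `^ (n%:R / 2) * ((5 * ts) `^ (- (n%:R / 2)) * (expR (- (r ^+ 2 / (2 * ts))) / 4)) <=
  gbump k y x t.
Proof.
move=> k0 ts0 kts rk tr qr; rewrite ler_pM2l ?powR_gt0//.
set q := sqnorm (x - y) in qr *; have q0 : 0 <= q by exact: sqnorm_ge0.
pose s := k + 4 * t; have s0 : 2 * ts <= s by rewrite /s; lra.
have s5 : s <= 5 * ts by rewrite /s; lra.
have sp : 0 < s by lra.
have sk : 0 < s + k by lra.
have -> : 2 * k + 4 * t = s + k by rewrite /s; ring.
rewrite -/s (gaussE _ sk).
have e14 : expR (1 / 4) <= 3 / 2 :> R.
  have := @expR_ge1Dx R (- (1 / 4)); rewrite expRN => h.
  have h0 := expR_gt0 (1 / 4 : R).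
  have : expR (1 / 4) * (expR (1 / 4))^-1 = 1 :> R by rewrite mulfV// gt_eqF.
  move: h h0; move: (expR (1 / 4)) => a; move: (a^-1) => b; clear; nra.
have h1 : expR (- (q / (s + k))) <= expR (- (q / s)) * (3 / 2).
  apply: (@le_trans _ _ (expR (- (q / s)) * expR (1 / 4))); last first.
    by rewrite ler_pM2l ?expR_gt0.
  rewrite -expRD ler_expR.
  have -> : - (q / (s + k)) = - (q / s) + q * k / (s * (s + k)).
    by field; rewrite !gt_eqF.
  rewrite lerD2l ler_pdivrMr ?mulr_gt0//.
  have : q * k <= ts ^+ 2 by rewrite (le_trans _ rk)// ler_pM2r.
  by move: s0 k0 ts0; clear; nra.
have h2 : (s + k) `^ (- (n%:R / 2)) <= s `^ (- (n%:R / 2)).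
  rewrite !powRN lef_pV2 ?posrE ?powR_gt0// ge0_ler_powR ?nnegrE ?divr_ge0//; lra.
have h3 : 1 / 2 * ((s + k) `^ (- (n%:R / 2)) * expR (- (q / (s + k)))) <=
   3 / 4 * gauss (x - y) s.
  rewrite gaussE// -/q.
  have := ler_pM (powR_ge0 _ _) (expR_ge0 _) h2 h1.
  by move: (_ `^ _ * expR (- (q / (s + k)))) => a; clear; lra.
have h4 : (5 * ts) `^ (- (n%:R / 2)) * expR (- (r ^+ 2 / (2 * ts))) <= gauss (x - y) s.
  rewrite gaussE// -/q ler_pM ?powR_ge0 ?expR_ge0//.
    by rewrite !powRN lef_pV2 ?posrE ?powR_gt0 ?mulr_gt0// ge0_ler_powR ?nnegrE ?divr_ge0//; lra.
  rewrite ler_expR lerN2 ler_pdivlMr ?mulr_gt0// mulrAC ler_pdivrMr//.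
  by rewrite ler_pM// ?mulr_ge0// ltW.
by rewrite mulrA; move: h3 h4; clear; lra.
Qed.

End Gaussian.

(** * Stacks of bumps below a supersolution *)

Section Capacity.
Variables (R : realType) (n : nat).
Implicit Types (x y xc : 'rV[R]_n) (ys : nat -> seq 'rV[R]_n) (r ts h sb t m : R) (u : 'rV[R]_n -> R -> R).

Definition level sb h (l : nat) : R := sb + l%:R * h ^+ 2.

(** The value for which [gbump_init_le0] gives a nonpositive bump at distance at least [h] from its
    centre. *)
Definition bump_size h : R := h ^+ 2 / (n%:R + 2).

(* Bounds the Gaussians on the lateral boundary; subtracting it makes each layer
   nonpositive there. *)
Definition lateral_sup r ts : R :=
  (5 * ts) `^ (- (n%:R / 2)) * expR (- (4 * r ^+ 2 / (5 * ts))).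

Definition layer r ts h sb ys (l : nat) x t : R := \sum_(y <- ys l)
  (gbump (bump_size h) y x (t - level sb h l) -
   bump_size h `^ (n%:R / 2) * lateral_sup r ts).

Definition stack r ts h sb ys (l0 m : nat) x t : R :=
  \sum_(l0 <= l < m) layer r ts h sb ys l x t.

(** The first pair makes the Gaussians at distance 2 r increase up to s = 5 ts, and keeps their
    value there below half of the lower bound that [gbump_lower] gives at the centre. The second
    pair makes the bumps narrow enough for that lemma. *)
Definition admissible r ts h :=
  [/\ 0 < r, 0 < ts, 0 < h, n%:R / 2 * (5 * ts) <= 4 * r ^+ 2 /\ 10 * ts <= r ^+ 2 &
      h ^+ 2 <= ts /\ r ^+ 2 * h ^+ 2 <= ts ^+ 2].

Definition separated_family xc r h (L : nat) ys := forall l, (l < L)%N ->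
  [/\ uniq (ys l), forall y, y \in ys l -> sqnorm (xc - y) <= r ^+ 2 &
      forall y y', y \in ys l -> y' \in ys l -> y != y' -> 2 * h <= `|y - y'|].

Definition supersolution u xc r ts := forall x t, `|x - xc| <= r -> 0 < t <= ts ->
  [/\ 0 <= u x t, jcont u x t & exists2 c, 0 <= c & heat_at u x t c].

Lemma bump_size_gt0 h : 0 < h -> 0 < bump_size h.
Proof. by move=> h0; rewrite divr_gt0 ?exprn_gt0// ltr_wpDl. Qed.

Lemma bump_size_le h : 0 < h -> bump_size h <= h ^+ 2.
Proof.
move=> h0; rewrite ler_pdivrMr ?ltr_wpDl// ler_peMr ?sqr_ge0//.
by have : 0 <= n%:R :> R by []; lra.
Qed.

Lemma level_mono sb h (l m : nat) : (l <= m)%N -> level sb h l <= level sb h m.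
Proof. by move=> lm; rewrite lerD2l ler_wpM2r ?sqr_ge0// ler_nat. Qed.

Lemma lateral_sup_ge0 r ts : 0 <= lateral_sup r ts.
Proof. by rewrite mulr_ge0 ?powR_ge0 ?expR_ge0. Qed.

(** For positive [m] the hypothesis on [level] says that layer m - 1 has started by time [t]; stated
    with [m], it serves the inductions on the number of layers. *)
Lemma heat_at_stack r ts h sb ys (l0 m : nat) x t : 0 < h ->
  level sb h m <= t + h ^+ 2 -> heat_at (stack r ts h sb ys l0 m) x t 0.
Proof.
move=> h0 mt; rewrite -[0](@big1 _ 0 +%R _ (index_iota l0 m) xpredT (fun=> 0))//.
apply: (@heat_at_sum _ _ nat _ (layer r ts h sb ys) (fun=> 0)) => l.
rewrite mem_index_iota => /andP[_ lm].
rewrite -[0](@big1 _ 0 +%R _ (ys l) xpredT (fun=> 0))//.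
apply: (@heat_at_sum _ _ _ _ (fun y x t => gbump (bump_size h) y x (t - level sb h l) -
   bump_size h `^ (n%:R / 2) * lateral_sup r ts) (fun=> 0)) => y _.
have lt : level sb h l <= t.
  apply: (le_trans (level_mono sb h (l := l) (m := m.-1) _)); first by rewrite -ltnS (ltn_predK lm).
  by move: mt; rewrite -{1}(ltn_predK lm) /level -natr1 mulrDl mul1r addrA lerD2r.
have := heat_atD (heat_at_gbump y x (bump_size_gt0 h0) lt)
  (heat_at_affine x t (- (bump_size h `^ (n%:R / 2) * lateral_sup r ts)) 0).
rewrite addr0.
have -> // : (fun x t => gbump (bump_size h) y x (t - level sb h l) +
    (- (bump_size h `^ (n%:R / 2) * lateral_sup r ts) + 0 * t)) =
  (fun x t => gbump (bump_size h) y x (t - level sb h l) -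
    bump_size h `^ (n%:R / 2) * lateral_sup r ts).
by apply/funext => ?; apply/funext => ?; rewrite mul0r addr0.
Qed.

Lemma jcont_stack r ts h sb ys (l0 m : nat) x t : 0 < h ->
  level sb h m <= t + h ^+ 2 -> jcont (stack r ts h sb ys l0 m) x t.
Proof.
move=> h0 mt.
apply: contAt_sum => l; rewrite mem_index_iota => /andP[_ lm].
apply: contAt_sum => y _; apply: contAtB; last exact: contAtC.
apply: jcont_gbump; first exact: bump_size_gt0.
apply: (le_trans (level_mono sb h (l := l) (m := m.-1) _)); first by rewrite -ltnS (ltn_predK lm).
by move: mt; rewrite -{1}(ltn_predK lm) /level -natr1 mulrDl mul1r addrA lerD2r.
Qed.

Lemma gbump_lateral r ts h y x t : admissible r ts h -> 2 * r <= `|x - y| ->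
  0 <= t <= ts ->
  gbump (bump_size h) y x t <= bump_size h `^ (n%:R / 2) * lateral_sup r ts.
Proof.
move=> [r0 ts0 h0 [nr tr] [ht rh]] xy /andP[t0 tts].
have k0 := bump_size_gt0 h0; have kh := bump_size_le h0.
rewrite (le_trans (gbump_le_gauss _ _ k0 t0))// ler_pM2l ?powR_gt0//.
have q4 : 4 * r ^+ 2 <= sqnorm (x - y).
  apply: le_trans (norm_sqr_le_sqnorm _).
  have -> : 4 * r ^+ 2 = (2 * r) ^+ 2 by ring.
  by rewrite lerXn2r ?nnegrE// mulr_ge0// ltW.
have ts50 : 0 < 5 * ts by rewrite mulr_gt0.
apply: (@le_trans _ _ (gauss (x - y) (5 * ts))).
  apply: gauss_mono_time.
  - by move: k0 t0; clear; lra.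
  - by move: kh ht tts; clear; lra.
  - by rewrite (le_trans nr).
rewrite gaussE// ler_pM2l ?powR_gt0// ler_expR lerN2 ler_pM2r ?invr_gt0//.
Qed.

Lemma stack_lateral xc r ts h sb ys (L l0 m : nat) x t : admissible r ts h ->
  separated_family xc r h L ys -> 0 < sb -> (m <= L)%N -> `|x - xc| = 3 * r ->
  level sb h m <= t + h ^+ 2 -> t <= ts -> stack r ts h sb ys l0 m x t <= 0.
Proof.
move=> adm sep sb0 mL xr mt tts; have [r0 ts0 h0 _ _] := adm.
rewrite /stack big_nat_cond; apply: sumr_le0 => l; rewrite andbT => /andP[_ lm].
have [_ ysr _] := sep l (leq_trans lm mL).
rewrite /layer big_seq; apply: sumr_le0 => y yl; rewrite subr_le0.
have lt : level sb h l <= t.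
  apply: (le_trans (level_mono sb h (l := l) (m := m.-1) _)); first by rewrite -ltnS (ltn_predK lm).
  by move: mt; rewrite -{1}(ltn_predK lm) /level -natr1 mulrDl mul1r addrA lerD2r.
have l0' : 0 <= level sb h l by rewrite addr_ge0 ?(ltW sb0)// mulr_ge0 ?sqr_ge0.
apply: gbump_lateral => //; last by move: lt l0' tts; clear; lra.
have yr : `|xc - y| <= r.
  rewrite -(@ler_pXn2r _ 2%N)// ?nnegrE ?(ltW r0)//.
  exact: le_trans (norm_sqr_le_sqnorm _) (ysr y yl).
have : `|x - xc| <= `|x - y| + `|xc - y|.
  by rewrite [`|xc - y|]distrC (le_trans _ (ler_normD _ _))// addrA subrK.
by rewrite xr; move: yr; clear; lra.
Qed.

Lemma layer_init_le0 r ts h sb ys (l : nat) x : 0 < h ->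
  (forall y, y \in ys l -> h <= `|x - y|) ->
  layer r ts h sb ys l x (level sb h l) <= 0.
Proof.
move=> h0 hx; rewrite /layer big_seq; apply: sumr_le0 => y yl; rewrite subrr.
rewrite subr_le0 (@le_trans _ _ 0)// ?mulr_ge0 ?powR_ge0 ?lateral_sup_ge0//.
apply: gbump_init_le0; first exact: bump_size_gt0.
rewrite /bump_size mulrCA divff ?mulr1 ?gt_eqF ?ltr_wpDl//.
apply: le_trans (norm_sqr_le_sqnorm _).
by rewrite lerXn2r ?nnegrE// ?(ltW h0)// hx.
Qed.

(** Centres are 2 h apart, so at most one lies within [h] of [x]; its bump is at most 1 and all
    others are nonpositive. *)
Lemma layer_init_le1 xc r ts h sb ys (L l : nat) x : 0 < h -> (l < L)%N ->
  separated_family xc r h L ys -> layer r ts h sb ys l x (level sb h l) <= 1.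
Proof.
move=> h0 lL sep; have [uys _ sepl] := sep l lL.
have [[y [yl xy]]|nex] := pselect (exists y, y \in ys l /\ `|x - y| < h); last first.
  apply: (@le_trans _ _ 0) => //; apply: layer_init_le0 => // y yl.
  by rewrite leNgt; apply/negP => xy; apply: nex; exists y.
rewrite /layer (bigD1_seq y)//= subrr.
have b1 : gbump (bump_size h) y x 0 <= 1.
  have := @gbump_le _ _ _ y x 0 1 (bump_size_gt0 h0) (lexx _) ltr01.
  by rewrite powR1 mulr0 addr0 mulr1 lexx; apply.
have g0 : 0 <= bump_size h `^ (n%:R / 2) * lateral_sup r ts.
  by rewrite mulr_ge0 ?powR_ge0 ?lateral_sup_ge0.
suff : \sum_(i <- ys l | i != y) (gbump (bump_size h) i x 0 -
    bump_size h `^ (n%:R / 2) * lateral_sup r ts) <= 0.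
  by move: b1 g0; clear; lra.
rewrite big_seq_cond; apply: sumr_le0 => y' /andP[y'l yy'].
rewrite subr_le0 (@le_trans _ _ 0)//.
apply: gbump_init_le0; first exact: bump_size_gt0.
rewrite /bump_size mulrCA divff ?mulr1 ?gt_eqF ?ltr_wpDl//.
apply: le_trans (norm_sqr_le_sqnorm _).
rewrite lerXn2r ?nnegrE// ?(ltW h0)//.
have h2 := sepl _ _ y'l yl yy'.
have : `|y' - y| <= `|x - y'| + `|x - y|.
  by rewrite [`|x - y'|]distrC (le_trans _ (ler_normD _ _))// addrA subrK.
by move: h2 xy; clear; lra.
Qed.

Lemma stack_recr r ts h sb ys (l0 m : nat) x t : (l0 <= m)%N ->
  stack r ts h sb ys l0 m.+1 x t = stack r ts h sb ys l0 m x t + layer r ts h sb ys m x t.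
Proof. by move=> lm; rewrite /stack big_nat_recr. Qed.

(** A layer adds at most 1 when it is switched on, and from then on the maximum principle preserves
    the bound. *)
Lemma stack_le_count xc r ts h sb ys (L l0 m : nat) x t : admissible r ts h ->
  separated_family xc r h L ys -> 0 < sb -> (l0 <= m)%N -> (m <= L)%N ->
  `|x - xc| <= 3 * r -> level sb h m <= t + h ^+ 2 -> t <= ts ->
  stack r ts h sb ys l0 m x t <= (m - l0)%:R.
Proof.
move=> adm sep sb0 + + xr; have [r0 ts0 h0 _ _] := adm.
elim: m x t xr => [|m IH] x t xr lm mL mt tts; first by rewrite /stack big_geq.
have [lm'|ml] := leqP l0 m; last first.
  by rewrite /stack big_geq// ler0n.
pose D (x : 'rV[R]_n) (t : R) := ((m.+1 - l0)%:R + 0 * t) + -1 * stack r ts h sb ys l0 m.+1 x t.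
have lS : level sb h m.+1 = level sb h m + h ^+ 2.
  by rewrite /level -natr1 mulrDl mul1r addrA.
suff : 0 <= D x t by rewrite /D; clear; lra.
apply: (@comparison _ _ D xc (3 * r) (level sb h m) ts) => //.
- move=> y s yr sr.
  apply: contAtD.
    apply: contAtD; first exact: contAtC.
    by apply: contAtM; [exact: contAtC|exact: cvg_snd].
  apply: contAtM; first exact: contAtC.
  by apply: jcont_stack => //; rewrite lS lerD2r; case/andP: sr.
- move=> y yr; rewrite /D stack_recr//.
  have h1 := @layer_init_le1 xc r ts h sb ys L m y h0 mL sep.
  have h2 : stack r ts h sb ys l0 m y (level sb h m) <= (m - l0)%:R.
    apply: IH => //; first exact: ltnW.
      by rewrite lerDl sqr_ge0.
    by move: mt tts; rewrite lS; clear; lra.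
  rewrite subSn// -natr1; move: h1 h2; clear; lra.
- move=> y s yr sr.
  have : stack r ts h sb ys l0 m.+1 y s <= 0.
    by apply: stack_lateral sep _ _ _ _ _ => //; rewrite ?lS ?lerD2r; case/andP: sr.
  have : 0 <= (m.+1 - l0)%:R :> R by [].
  by rewrite /D; clear; lra.
- move=> y s yr sr; exists 0 => //.
  have -> : 0 = 0 + -1 * 0 :> R by ring.
  apply: heat_atD; first exact: heat_at_affine.
  apply: heat_atZ; apply: heat_at_stack => //.
  by rewrite lS lerD2r; case/andP: sr => /ltW.
- by move: mt tts; rewrite lS; clear; lra.
Qed.

(** The last [d] layers are bounded by their number. Every bump of an older layer has spread for a
    time at least d h^2, hence is at most d^(-n/2). The choice of [d] is left open, to be optimized
    in [capacity]. *)
Lemma stack_le xc r ts h sb ys (L m d : nat) x t : admissible r ts h ->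
  separated_family xc r h L ys -> 0 < sb -> (m <= L)%N -> (0 < d)%N ->
  `|x - xc| <= 3 * r -> level sb h m <= t + h ^+ 2 -> t <= ts ->
  stack r ts h sb ys 0 m x t <=
    d%:R + (\sum_(0 <= l < L) size (ys l))%:R * d%:R `^ (- (n%:R / 2)).
Proof.
move=> adm sep sb0 mL d0 xr mt tts; have [r0 ts0 h0 _ _] := adm.
have N0 : 0 <= (\sum_(0 <= l < L) size (ys l))%:R * d%:R `^ (- (n%:R / 2)) :> R.
  by rewrite mulr_ge0 ?powR_ge0.
have [md|dm] := leqP m d.
  have := stack_le_count adm sep sb0 (leq0n m) mL xr mt tts.
  have : (m - 0)%:R <= d%:R :> R by rewrite ler_nat subn0.
  by move: N0; clear; lra.
pose l0 := (m - d)%N.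
have l0m : (l0 <= m)%N by rewrite leq_subr.
have -> : stack r ts h sb ys 0 m x t =
    stack r ts h sb ys 0 l0 x t + stack r ts h sb ys l0 m x t.
  by rewrite /stack (@big_cat_nat _ _ _ l0).
rewrite addrC lerD//.
  by have := stack_le_count adm sep sb0 l0m mL xr mt tts; rewrite /l0 subKn// ltnW.
rewrite /stack (@le_trans _ _ (\sum_(0 <= l < l0) (size (ys l))%:R * d%:R `^ (- (n%:R / 2))))//; last first.
  rewrite -mulr_suml ler_wpM2r ?powR_ge0// -natr_sum ler_nat.
  rewrite [leqRHS](@big_cat_nat _ _ _ l0)//= ?leq_addr//.
  exact: leq_trans l0m mL.
rewrite big_nat_cond [leRHS]big_nat_cond; apply: ler_sum => l; rewrite andbT => /andP[_ ll].
have -> : (size (ys l))%:R * d%:R `^ (- (n%:R / 2)) =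
    \sum_(y <- ys l) d%:R `^ (- (n%:R / 2)) :> R.
  by rewrite big_const_seq count_predT iter_addr_0 mulr_natl.
rewrite /layer big_seq [leRHS]big_seq; apply: ler_sum => y yl.
have k0 := bump_size_gt0 h0.
have ll0 : level sb h l <= level sb h l0.-1.
  by apply: level_mono; rewrite -ltnS (ltn_predK ll).
(* As l + d + 1 <= m, the spare h^2 cancels the one in the hypothesis on [level]. *)
have lt : d%:R * h ^+ 2 <= t - level sb h l.
  suff : level sb h l + d%:R * h ^+ 2 + h ^+ 2 <= level sb h m by move: mt; clear; lra.
  have -> : level sb h l + d%:R * h ^+ 2 + h ^+ 2 = level sb h (l + d).+1.
    by rewrite /level -natr1 natrD; ring.
  by apply: level_mono; move: ll; rewrite /l0 ltn_subRL addnC.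
rewrite (@le_trans _ _ (gbump (bump_size h) y x (t - level sb h l)))//.
  by rewrite gerBl mulr_ge0 ?powR_ge0 ?lateral_sup_ge0.
have h20 : 0 < h ^+ 2 by rewrite exprn_gt0.
have dd : 0 < d%:R :> R by rewrite ltr0n.
apply: gbump_le => //.
- by rewrite (le_trans _ lt)// mulr_ge0// ltW.
- have := bump_size_le h0; move: lt k0 dd h20; move: (bump_size h) (t - level sb h l) => k z.
  by clear; nra.
Qed.

(** Normalized by the bound [Q] of [stack_le], m times the stack stays below [u], by comparison from
    one level to the next; at [(xc, ts)] the stack is bounded below by a multiple of the number of
    bumps. The lower bound on [u] enters only at the instants when layers are switched on. *)
Lemma capacity_stack u xc r ts h sb ys (L d : nat) m : admissible r ts h ->
  separated_family xc r h L ys -> 0 < sb -> 0 < m -> (0 < d)%N ->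
  (forall l, (l < L)%N -> level sb h l <= ts / 2) ->
  (forall l x y, (l < L)%N -> y \in ys l -> `|x - y| < h -> m <= u x (level sb h l)) ->
  supersolution u xc (3 * r) ts ->
  m * (\sum_(0 <= l < L) size (ys l))%:R * bump_size h `^ (n%:R / 2) *
    ((5 * ts) `^ (- (n%:R / 2)) * (expR (- (r ^+ 2 / (2 * ts))) / 8)) <=
  (d%:R + (\sum_(0 <= l < L) size (ys l))%:R * d%:R `^ (- (n%:R / 2))) * u xc ts.
Proof.
move=> adm sep sb0 m0 d0 lts um uh; have [r0 ts0 h0 [nr tr] [ht rh]] := adm.
set N := (\sum_(0 <= l < L) size (ys l))%N.
set Q := d%:R + _.
have dd : 0 < d%:R :> R by rewrite ltr0n.
have Q0 : 0 < Q by rewrite ltr_wpDr// mulr_ge0 ?powR_ge0.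
pose th := m / Q; have th0 : 0 < th by rewrite divr_gt0.
have lev0 l : 0 < level sb h l by rewrite ltr_wpDr// mulr_ge0 ?sqr_ge0.
have main k : (k <= L)%N -> forall x t, `|x - xc| <= 3 * r -> 0 < t ->
    level sb h k <= t + h ^+ 2 -> t <= ts -> th * stack r ts h sb ys 0 k x t <= u x t.
  elim: k => [|k IH] kL x t xr t0 kt tts.
    rewrite /stack big_geq// mulr0; have [||//] := uh x t => //; exact/andP.
  have lS : level sb h k.+1 = level sb h k + h ^+ 2.
    by rewrite /level -natr1 mulrDl mul1r addrA.
  pose D (x : 'rV[R]_n) (t : R) := u x t + (- th) * stack r ts h sb ys 0 k.+1 x t.
  suff : 0 <= D x t by rewrite /D mulNr subr_ge0.
  apply: (@comparison _ _ D xc (3 * r) (level sb h k) ts) => //.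
  - move=> y s yr sr; have s0 : 0 < s <= ts by move: sr (lev0 k); clear; lra.
    have [_ cu _] := uh y s yr s0.
    apply: contAtD => //; apply: contAtM; first exact: contAtC.
    by apply: jcont_stack => //; rewrite lS lerD2r; case/andP: sr.
  - move=> y yr; rewrite /D mulNr subr_ge0.
    have kts : level sb h k <= ts by have := lts k kL; move: ts0; clear; lra.
    (* Near a centre [u] is at least [m], which dominates the whole normalized stack; elsewhere the
       new layer starts nonpositive and the previous inequality is kept. *)
    have [[z [zl yz]]|nex] := pselect (exists z, z \in ys k /\ `|y - z| < h).
      apply: (@le_trans _ _ m); last exact: um yz.
      rewrite /th mulrAC ler_pdivrMr// ler_pM2l//.
      apply: (stack_le adm sep) => //.
      by rewrite lS lerD2r.
    rewrite stack_recr// mulrDr.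
    have h1 : layer r ts h sb ys k y (level sb h k) <= 0.
      apply: layer_init_le0 => // z zl; rewrite leNgt; apply/negP => yz.
      by apply: nex; exists z.
    have h2 : th * stack r ts h sb ys 0 k y (level sb h k) <= u y (level sb h k).
      by apply: IH => //; [exact: ltnW|rewrite lerDl sqr_ge0].
    have h3 : th * layer r ts h sb ys k y (level sb h k) <= 0 by rewrite pmulr_rle0.
    by move: h2 h3; clear; lra.
  - move=> y s yr sr; have s0 : 0 < s <= ts by move: sr (lev0 k); clear; lra.
    have [|u0 _ _] := uh y s _ s0; first by rewrite yr.
    have st0 : stack r ts h sb ys 0 k.+1 y s <= 0.
      apply: (@stack_lateral xc r ts h sb ys L 0 k.+1 y s adm sep) => //.
        by rewrite lS lerD2r; case/andP: sr.
      by case/andP: sr.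
    have : th * stack r ts h sb ys 0 k.+1 y s <= 0 by rewrite pmulr_rle0.
    by rewrite /D mulNr; move: u0; clear; lra.
  - move=> y s yr sr; have s0 : 0 < s <= ts by move: sr (lev0 k); clear; lra.
    have [_ _ [c c0 hc]] := uh y s (ltW yr) s0.
    exists (c + (- th) * 0); first by rewrite mulr0 addr0.
    apply: heat_atD => //; apply: heat_atZ; apply: heat_at_stack => //.
    by rewrite lS lerD2r; case/andP: sr => /ltW.
  - by move: kt tts; rewrite lS; clear; lra.
have [L0|L0] := posnP L.
  rewrite /N L0 big_geq// mulr0 !mul0r mulr_ge0 ?(ltW Q0)//.
  by have [||//] := uh xc ts; rewrite ?subrr ?normr0 ?mulr_ge0 ?(ltW r0) ?ts0 ?lexx.
have Lts : level sb h L <= ts + h ^+ 2.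
  have := lts L.-1; rewrite (ltn_predK L0) => /(_ (leqnn _)).
  have -> : level sb h L = level sb h L.-1 + h ^+ 2.
    by rewrite -{1}(ltn_predK L0) /level -natr1 mulrDl mul1r addrA.
  by move: ts0; clear; lra.
have xc3 : `|xc - xc| <= 3 * r by rewrite subrr normr0 mulr_ge0// ltW.
have := main L (leqnn _) xc ts xc3 ts0 Lts (lexx _).
set P := stack _ _ _ _ _ _ _ _ _; set c0 := _ * (expR _ / 8).
have k0 := bump_size_gt0 h0; have kh := bump_size_le h0.
suff PN : N%:R * (bump_size h `^ (n%:R / 2) * c0) <= P.
  rewrite -(ler_pdivlMl _ _ th0) /th invf_div => h1.
  have h2 := le_trans PN h1.
  have := ler_wpM2l (ltW m0) h2.
  have -> : m * (Q / m * u xc ts) = Q * u xc ts by field; rewrite gt_eqF.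
  by rewrite !mulrA.
have -> : N%:R * (bump_size h `^ (n%:R / 2) * c0) =
    \sum_(0 <= l < L) \sum_(y <- ys l) (bump_size h `^ (n%:R / 2) * c0).
  rewrite /N natr_sum mulr_suml; apply: eq_bigr => l _.
  by rewrite big_const_seq count_predT iter_addr_0 mulr_natl.
rewrite /P /stack big_nat_cond [leRHS]big_nat_cond; apply: ler_sum => l; rewrite andbT => /andP[_ lL].
have [_ ysr _] := sep l lL.
rewrite /layer big_seq [leRHS]big_seq; apply: ler_sum => y yl.
have tl : ts / 2 <= ts - level sb h l <= ts by move: (lts l lL) (lev0 l); clear; lra.
have := @gbump_lower _ n (bump_size h) y xc _ ts r k0 ts0 (le_trans kh ht) _ tl (ysr y yl).
set e1 := expR (- (r ^+ 2 / (2 * ts))) in c0 *.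
(* The quotient of the two exponentials is exp(-(3/10) r^2/ts), at most e^(-3) <= 1/8, so
   subtracting the lateral bound costs half of the 1/4 in [gbump_lower]. *)
have e13 : expR (- (4 * r ^+ 2 / (5 * ts))) <= e1 / 8.
  have h1 : expR 1 >= 2 :> R by have := @expR_ge1Dx R 1; clear; lra.
  have h3 : expR (- 3) <= 1 / 8 :> R.
    rewrite expRN div1r lef_pV2 ?posrE ?expR_gt0//.
    have -> : 3 = 1 + 1 + 1 :> R by ring.
    rewrite !expRD; move: h1; move: (expR 1) => a; clear; nra.
  apply: (@le_trans _ _ (e1 * expR (-3))); last first.
    by have := expR_gt0 (- (r ^+ 2 / (2 * ts))); rewrite -/e1; move: h3; clear; nra.
  rewrite -expRD ler_expR.
  have -> : - (4 * r ^+ 2 / (5 * ts)) = - (r ^+ 2 / (2 * ts)) - 3 / 10 * (r ^+ 2 / ts).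
    by field; rewrite gt_eqF.
  have : 10 <= r ^+ 2 / ts by rewrite ler_pdivlMr.
  by clear; lra.
rewrite /lateral_sup => h4.
have p0 : 0 < bump_size h `^ (n%:R / 2) by rewrite powR_gt0.
have p1 : 0 < (5 * ts) `^ (- (n%:R / 2)) by rewrite powR_gt0 ?mulr_gt0.
have h5 : bump_size h `^ (n%:R / 2) * ((5 * ts) `^ (- (n%:R / 2)) * expR (- (4 * r ^+ 2 / (5 * ts)))) <=
    bump_size h `^ (n%:R / 2) * ((5 * ts) `^ (- (n%:R / 2)) * (e1 / 8)).
  by rewrite ler_pM2l// ler_pM2l.
have h6 : bump_size h `^ (n%:R / 2) * ((5 * ts) `^ (- (n%:R / 2)) * (e1 / 4)) <=
   gbump (bump_size h) y xc (ts - level sb h l).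
  apply: h4; apply: le_trans rh.
  by rewrite ler_wpM2l ?sqr_ge0.
by rewrite /c0; move: h5 h6; clear; lra.
Qed.

End Capacity.
Lemma powRD_gt0 (R : realType) (x r s : R) : 0 < x -> x `^ (r + s) = x `^ r * x `^ s.
Proof. by move=> x0; apply: powRD; apply/implyP => _; rewrite gt_eqF. Qed.

Lemma capacity (R : realType) (n : nat) (u : 'rV[R]_n -> R -> R) (xc : 'rV[R]_n)
    (r ts : R) : (0 < n)%N -> 0 < r -> 0 < ts ->
  n%:R / 2 * (5 * ts) <= 4 * r ^+ 2 -> 10 * ts <= r ^+ 2 ->
  supersolution u xc (3 * r) ts ->
  exists2 C : R, 0 < C & forall (h sb m : R) (ys : nat -> seq 'rV[R]_n) (L : nat),
    0 < h -> h ^+ 2 <= ts -> r ^+ 2 * h ^+ 2 <= ts ^+ 2 ->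
    separated_family xc r h L ys -> 0 < sb -> 0 < m ->
    (forall l, (l < L)%N -> level sb h l <= ts / 2) ->
    (forall (l : nat) (x y : 'rV[R]_n), (l < L)%N -> y \in ys l -> `|x - y| < h -> m <= u x (level sb h l)) ->
    m * (\sum_(0 <= l < L) size (ys l))%:R `^ (n%:R / (n%:R + 2)) * h ^+ n <= C.
Proof.
move=> n_gt0 r0 ts0 nr tr uh.
pose c0 := (5 * ts) `^ (- (n%:R / 2)) * (expR (- (r ^+ 2 / (2 * ts))) / 8).
have c00 : 0 < c0 by rewrite !mulr_gt0 ?powR_gt0 ?mulr_gt0 ?expR_gt0 ?invr_gt0.
have n0 : 0 < n%:R :> R by rewrite ltr0n.
have n20 : 0 < n%:R + 2 :> R by rewrite ltr_wpDl.
(* The added 1 keeps the constant positive even if [u] vanishes at [(xc, ts)]. *)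
pose U := u xc ts + 1.
have U0 : 0 <= u xc ts.
  by have [||//] := uh xc ts; rewrite ?subrr ?normr0 ?mulr_ge0 ?(ltW r0) ?ts0 ?lexx.
have Up : 0 < U by rewrite ltr_wpDl.
have q0 : 0 < (n%:R + 2) `^ (n%:R / 2) :> R by rewrite powR_gt0.
exists (3 * U * (n%:R + 2) `^ (n%:R / 2) / c0); first by rewrite divr_gt0// !mulr_gt0.
move=> h sb m ys L h0 hts rh sep sb0 m0 lts um.
set N := (\sum_(0 <= l < L) size (ys l))%N.
have [->|N0] := posnP N.
  by rewrite powR0 ?gt_eqF ?divr_gt0// mulr0 mul0r ltW// divr_gt0// !mulr_gt0.
have NR : 1 <= N%:R :> R by rewrite ler1n.
have NR0 : 0 < N%:R :> R by rewrite ltr0n.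
(* Balances the two terms of [stack_le]: N a^(-n/2) = a. The quotient N / a is then the power of N
   in the estimate; [d] is an integer between a and 2 a. *)
pose a := N%:R `^ (2 / (n%:R + 2)) : R.
have a1 : 1 <= a.
  by rewrite -[1](@powRr0 _ N%:R) ler_powR// divr_ge0// ltW.
have a0 : 0 < a by exact: lt_le_trans a1.
pose d := (Num.truncn a).+1.
have da : a <= d%:R by rewrite ltW// truncnS_gt.
have d2a : d%:R <= 2 * a.
  have : (Num.truncn a)%:R <= a by rewrite truncn_le// ltW.
  by rewrite /d -natr1; move: a1; clear; lra.
have adm : admissible n r ts h by split.
have := capacity_stack adm sep sb0 m0 (ltn0Sn _ : (0 < d)%N) lts um uh.
rewrite -/N -/c0 => H.
have aN : N%:R * a `^ (- (n%:R / 2)) = a.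
  rewrite /a -powRrM -{1}(@powRr1 _ N%:R) ?(ltW NR0)// -powRD_gt0//.
  by congr (_ `^ _); field; rewrite gt_eqF.
have Q3 : d%:R + N%:R * d%:R `^ (- (n%:R / 2)) <= 3 * a.
  have : N%:R * d%:R `^ (- (n%:R / 2)) <= a.
    rewrite -[leRHS]aN ler_pM2l// !powRN lef_pV2 ?posrE ?powR_gt0 ?ltr0n//.
    by rewrite ge0_ler_powR ?nnegrE ?divr_ge0// ltW.
  by move: d2a; clear; lra.
have Na : N%:R = a * N%:R `^ (n%:R / (n%:R + 2)).
  rewrite /a -powRD_gt0//.
  by rewrite -mulrDl (addrC 2) divff ?gt_eqF// powRr1// ltW.
have bh : h ^+ n = bump_size n h `^ (n%:R / 2) * (n%:R + 2) `^ (n%:R / 2).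
  rewrite -powRM ?(ltW n20)//; last by rewrite ltW// bump_size_gt0.
  rewrite /bump_size divfK ?gt_eqF//.
  rewrite -powR_mulrn ?(ltW h0)// -(@powR_mulrn _ h 2) ?(ltW h0)// -powRrM.
  by congr (_ `^ _); field.
rewrite ler_pdivlMr// bh.
set z := N%:R `^ (n%:R / (n%:R + 2)) in Na *; set k := bump_size n h `^ (n%:R / 2) in H *.
have H1 : a * (m * z * k * c0) <= a * (3 * U).
  apply: (@le_trans _ _ ((d%:R + N%:R * d%:R `^ (- (n%:R / 2))) * u xc ts)).
    apply: le_trans H; rewrite [in leRHS]Na.
    by have -> : a * (m * z * k * c0) = m * (a * z) * k * c0 by ring.
  have uU : u xc ts <= U by rewrite /U lerDl.
  by rewrite mulrA (mulrC a) ler_pM// addr_ge0// mulr_ge0// powR_ge0.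
rewrite ler_pM2l// in H1.
have := ler_wpM2r (ltW q0) H1.
by rewrite -/k; have -> : m * z * k * c0 * (n%:R + 2) `^ (n%:R / 2) =
  m * z * (k * (n%:R + 2) `^ (n%:R / 2)) * c0 by ring.
Qed.

(** * Iterated integrals of lower semicontinuous functions *)

Lemma pairl_continuous (S T : topologicalType) (r : S) : continuous (fun z : T => (r, z)).
Proof. by move=> z; exact: (cvg_pair (cvg_cst r) cvg_id). Qed.

Lemma pairr_continuous (S T : topologicalType) (r : T) : continuous (fun z : S => (z, r)).
Proof. by move=> z; exact: (cvg_pair cvg_id (cvg_cst r)). Qed.

Lemma snd_continuous (S T : topologicalType) : continuous (fun p : S * T => p.2).
Proof. by case=> a b; exact: cvg_snd. Qed.

Section LowerSemicontinuous.
Context {R : realType}.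
Local Open Scope ereal_scope.

(* No measurability: the integral is a supremum over simple functions below. *)
Lemma integral_mono (D : set R) (f g : R -> \bar R) :
  (forall x, D x -> 0 <= f x) -> (forall x, D x -> f x <= g x) ->
  \int[@lebesgue_measure R]_(x in D) f x <= \int[@lebesgue_measure R]_(x in D) g x.
Proof.
move=> f0 fg; rewrite !ge0_integralE//; last first.
  by move=> x Dx; exact: le_trans (f0 x Dx) (fg x Dx).
apply: ge_ereal_sup => _ [h /= hf <-]; apply: ereal_sup_ubound; exists h => //= x.
by rewrite (le_trans (hf x))//; exact: lee_restrict.
Qed.

Lemma lee_dense (l L : \bar R) :
  (forall b : R, b%:E < l -> b%:E <= L) -> l <= L.
Proof.
move=> h; rewrite leNgt; apply/negP => Ll.
have [b /andP[Lb bl]] : exists b : R, L < b%:E < l.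
  case: L l Ll {h} => [r| |] [s| |]//= h.
  - exists ((r + s) / 2)%R; rewrite !lte_fin in h *; lra.
  - by exists (r + 1)%R; rewrite ltry lte_fin; lra.
  - by exists (s - 1)%R; rewrite ltNyr lte_fin; lra.
  - by exists 0%R; rewrite ltNyr ltry.
by have := h b bl; rewrite leNgt Lb.
Qed.

Lemma le_limn_einf (u : nat -> \bar R) (l : \bar R) :
  (forall b : R, b%:E < l -> \forall k \near \oo, b%:E <= u k) -> l <= limn_einf u.
Proof.
move=> h; apply: lee_dense => b /h[N _ hN].
rewrite limn_einf_lim.
apply: (@le_trans _ _ (einfs u N)).
  by apply: le_ereal_inf_tmp => _ [k /= Nk <-]; exact: hN.
rewrite (cvg_lim _ (@cvg_einfs_sup _ u))//.
by apply: ereal_sup_ubound; exists N.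
Qed.

Lemma limn_einf_le (u : nat -> \bar R) (a : \bar R) :
  (forall k, u k <= a) -> limn_einf u <= a.
Proof.
move=> h; rewrite limn_einf_lim; apply: lime_le; first exact: is_cvg_einfs.
apply: nearW => k; apply: (@le_trans _ _ (u k)) => //.
by apply: ereal_inf_lbound; exists k => /=.
Qed.

Lemma lsc_comp (S T : topologicalType) (g : S -> T) (f : T -> \bar R) :
  continuous g -> lower_semicontinuous f -> lower_semicontinuous (fun x => f (g x)).
Proof.
move=> cg lf x a /lf[V nV hV]; exists (g @^-1` V); first exact: cg.
by move=> y; exact: hV.
Qed.

(** A failure at [p] would produce points [q k] tending to [p] with integrals at most [a], contrary
    to Fatou's lemma. *)
Lemma lsc_integral (P : pseudoMetricType R) (f : P * R -> \bar R) :
  (forall q, 0 <= f q) -> lower_semicontinuous f ->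
  lower_semicontinuous (fun p => \int[@lebesgue_measure R]_z f (p, z)).
Proof.
move=> f0 lf p a ap; apply: contrapT => hno.
have hk (k : nat) : exists q, ball p (k.+1%:R^-1)%R q /\ \int[@lebesgue_measure R]_z f (q, z) <= a%:E.
  apply: contrapT => hq; apply: hno; exists (ball p (k.+1%:R^-1)%R).
    exact: nbhsx_ballx.
  move=> y yb; rewrite ltNge; apply/negP => h; apply: hq; by exists y.
have [q hq] := choice hk.
have mf (r : P) : measurable_fun setT ((fun z => f (r, z)) : R -> \bar R).
  apply: lower_semicontinuous_measurable.
  apply: (@lsc_comp _ _ (fun z : R => (r, z)) f) => //.
  exact: pairl_continuous.
have qp : q @ \oo --> p.
  apply/cvg_ballP => e e0; near=> k.
  have [+ _] := hq k; apply: le_ball.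
  by apply: ltW; near: k; exact: near_infty_natSinv_lt (PosNum e0).
suff : \int[@lebesgue_measure R]_z f (p, z) <= a%:E by rewrite leNgt ap.
apply: (@le_trans _ _ (\int[@lebesgue_measure R]_z limn_einf (fun k => f (q k, z)))).
  apply: integral_mono => // z _; apply: le_limn_einf => b /lf[V nV hV].
  have : \forall k \near \oo, V (q k, z).
    exact: (cvg_pair qp (cvg_cst z)) nV.
  by apply: filterS => k /hV /ltW.
apply: (le_trans (@fatou _ _ _ (@lebesgue_measure R) _ measurableT (fun k z => f (q k, z)) _ _)) => //.
  by move=> k; exact: mf.
by apply: limn_einf_le => k; have [] := hq k.
Unshelve. all: by end_near. Qed.

End LowerSemicontinuous.

(** * The iterated integral over R^n *)

Section IntRn.
Context {R : realType}.
Local Open Scope ereal_scope.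

Definition rowcons (m : nat) (z : R) (y : 'rV[R]_m) : 'rV[R]_m.+1 :=
  \row_(k < m.+1) match unlift ord0 k with Some j => y ord0 j | None => z end.

Lemma rowcons0 m z (y : 'rV[R]_m) : rowcons z y ord0 ord0 = z.
Proof. by rewrite mxE unlift_none. Qed.

Lemma rowconsS m z (y : 'rV[R]_m) j : rowcons z y ord0 (lift ord0 j) = y ord0 j.
Proof. by rewrite mxE liftK. Qed.

Lemma intRnS m (f : 'rV[R]_m.+1 -> \bar R) :
  intRn f = \int[@lebesgue_measure R]_z intRn (fun y => f (rowcons z y)).
Proof. by []. Qed.

Lemma intRn_ge0 m (f : 'rV[R]_m -> \bar R) : (forall y, 0 <= f y) -> 0 <= intRn f.
Proof.
elim: m f => [|m IH] f f0; first exact: f0.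
by rewrite intRnS; apply: integral_ge0 => z _; apply: IH.
Qed.

Lemma intRn_mono m (f g : 'rV[R]_m -> \bar R) : (forall y, 0 <= f y) ->
  (forall y, f y <= g y) -> intRn f <= intRn g.
Proof.
elim: m f g => [|m IH] f g f0 fg; first exact: fg.
rewrite !intRnS; apply: integral_mono => z _; first by apply: intRn_ge0.
exact: IH.
Qed.

Lemma rowcons_continuous (P : topologicalType) m :
  continuous (fun q : (P * R) * 'rV[R]_m => (q.1.1, rowcons q.1.2 q.2)).
Proof.
move=> [[p z] y].
have c1 : {for ((p, z), y), continuous (fun q : (P * R) * 'rV[R]_m => q.1)} by exact: cvg_fst.
have c2 : {for ((p, z), y), continuous (fun q : (P * R) * 'rV[R]_m => q.1.1)}.
  by apply: continuous_comp; [exact: c1|exact: cvg_fst].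
have c3 : {for ((p, z), y), continuous (fun q : (P * R) * 'rV[R]_m => q.1.2)}.
  by apply: continuous_comp; [exact: c1|exact: cvg_snd].
have c4 : {for ((p, z), y), continuous (fun q : (P * R) * 'rV[R]_m => q.2)} by exact: cvg_snd.
have c5 : {for ((p, z), y), continuous (fun q : (P * R) * 'rV[R]_m => rowcons q.1.2 q.2)}.
  apply/cvgrPdist_lt => e e0.
  have h3 := (@cvgrPdist_lt _ _ _ _ _ _ _).1 c3 e e0.
  have h4 := (@cvgrPdist_lt _ _ _ _ _ _ _).1 c4 e e0.
  near=> q.
  have q3 : (`|z - q.1.2| < e)%R by near: q; exact: h3.
  have q4 : (`|y - q.2| < e)%R by near: q; exact: h4.
  rewrite [ltLHS]/Num.Def.normr/= mx_normrE; apply/bigmax_ltP; split => //.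
  case=> [j k] _ /=; rewrite ord1 !mxE; case: unliftP => [j' _|_] //.
  apply: le_lt_trans q4; rewrite [leRHS]/Num.Def.normr/= mx_normrE.
  by apply/bigmax_geP; right => /=; exists (ord0, j') => //=; rewrite !mxE.
exact: (cvg_pair c2 c5).
Unshelve. all: by end_near. Qed.

(** The parameter space is arbitrary so that the induction can move a coordinate into it, replacing
    [P] by [P * R]. *)
Lemma lsc_intRn m (P : pseudoMetricType R) (f : P * 'rV[R]_m -> \bar R) :
  (forall q, 0 <= f q) -> lower_semicontinuous f ->
  lower_semicontinuous (fun p => intRn (fun y => f (p, y))).
Proof.
elim: m P f => [|m IH] P f f0 lf.
  apply: (@lsc_comp _ _ _ (fun p : P => (p, 0%R : 'rV[R]_0)) f) => //.
  exact: pairr_continuous.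
apply: (@lsc_integral _ _ (fun q : P * R => intRn (fun y => f (q.1, rowcons q.2 y)))).
  by move=> q; exact: intRn_ge0.
apply: (IH _ (fun q : (P * R) * 'rV[R]_m => f (q.1.1, rowcons q.1.2 q.2))) => //.
by apply: (@lsc_comp _ _ _ _ f) => //; exact: rowcons_continuous.
Qed.

Lemma rowcons_continuous1 m (z : R) : continuous (fun y : 'rV[R]_m => rowcons z y).
Proof.
move=> y.
have c1 : {for y, continuous (fun y : 'rV[R]_m => ((z, z), y))}.
  exact: pairl_continuous.
have := continuous_comp c1 (@rowcons_continuous R m _).
move=> c2; exact: (continuous_comp c2 (@snd_continuous _ _ _)).
Qed.

Lemma lsc_slice m (f : 'rV[R]_m.+1 -> \bar R) (z : R) : lower_semicontinuous f ->
  lower_semicontinuous (fun y => f (rowcons z y)).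
Proof. by move=> lf; apply: lsc_comp => //; exact: rowcons_continuous1. Qed.

Lemma measurable_intRn_slice m (f : 'rV[R]_m.+1 -> \bar R) :
  (forall y, 0 <= f y) -> lower_semicontinuous f ->
  measurable_fun setT ((fun z => intRn (fun y => f (rowcons z y))) : R -> \bar R).
Proof.
move=> f0 lf; apply: lower_semicontinuous_measurable.
apply: (@lsc_intRn _ _ (fun q : R * 'rV[R]_m => f (rowcons q.1 q.2))) => //.
apply: (@lsc_comp _ _ _ _ f) => // -[z y].
have c1 : {for (z, y), continuous (fun q : R * 'rV[R]_m => ((q.1, q.1), q.2))}.
  have c0 : {for (z, y), continuous (fun q : R * 'rV[R]_m => q.1)} by exact: cvg_fst.
  exact: (cvg_pair (cvg_pair c0 c0) (@snd_continuous R 'rV[R]_m (z, y))).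
have := continuous_comp c1 (@rowcons_continuous R m _).
move=> c2; exact: (continuous_comp c2 (@snd_continuous _ _ _)).
Qed.

Lemma intRnD m (f g : 'rV[R]_m -> \bar R) :
  (forall y, 0 <= f y) -> (forall y, 0 <= g y) ->
  lower_semicontinuous f -> lower_semicontinuous g ->
  intRn (fun y => f y + g y) = intRn f + intRn g.
Proof.
elim: m f g => [|m IH] f g f0 g0 lf lg //.
rewrite !intRnS -ge0_integralD//.
- by apply: eq_integral => z _; rewrite IH//; exact: lsc_slice.
- by move=> z _; exact: intRn_ge0.
- exact: measurable_intRn_slice.
- by move=> z _; exact: intRn_ge0.
- exact: measurable_intRn_slice.
Qed.

Lemma intRnZ m (k : R) (f : 'rV[R]_m -> \bar R) : (0 <= k)%R ->
  (forall y, 0 <= f y) -> lower_semicontinuous f ->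
  intRn (fun y => k%:E * f y) = k%:E * intRn f.
Proof.
move=> k0; elim: m f => [|m IH] f f0 lf //.
rewrite !intRnS -ge0_integralZl_EFin//.
- by apply: eq_integral => z _; rewrite IH//; exact: lsc_slice.
- by move=> z _; exact: intRn_ge0.
- exact: measurable_intRn_slice.
Qed.

(** In the induction [c] collects the factors whose coordinates are already fixed. *)
Lemma intRn_prod m (c : R) (phi : 'I_m -> R -> R) (I : 'I_m -> R) : (0 <= c)%R ->
  (forall i z, 0 <= phi i z)%R -> (forall i, measurable_fun setT (phi i)) ->
  (forall i, \int[@lebesgue_measure R]_z (phi i z)%:E = (I i)%:E) ->
  intRn (fun y : 'rV[R]_m => (c * \prod_i phi i (y ord0 i))%:E) = (c * \prod_i I i)%:E.
Proof.
elim: m c phi I => [|m IH] c phi I c0 phi0 mphi iphi.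
  by rewrite /= !big_ord0.
rewrite intRnS.
transitivity (\int[@lebesgue_measure R]_z ((c * \prod_(i < m) I (lift ord0 i))%:E * (phi ord0 z)%:E)).
  apply: eq_integral => z _.
  rewrite -EFinM mulrAC -(IH (c * phi ord0 z)%R (fun i => phi (lift ord0 i)))// ?mulr_ge0//.
  congr intRn; apply/funext => y; rewrite big_ord_recl rowcons0 mulrA.
  by congr (_ * _)%:E; apply: eq_bigr => i _; rewrite rowconsS.
rewrite ge0_integralZl_EFin//.
- by rewrite iphi -EFinM big_ord_recl mulrCA mulrC.
- by move=> z _; rewrite lee_fin.
- by apply/measurable_EFinP; exact: mphi.
- rewrite mulr_ge0// prodr_ge0// => i _.
  by rewrite -lee_fin -iphi integral_ge0// => z _; rewrite lee_fin.
Qed.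

End IntRn.

(** * Integrals of Gaussians, cubes and powers *)

Section ExplicitIntegrals.
Context {R : realType}.
Local Notation mu := (@lebesgue_measure R).

(** Normalization of the normal density with variance 1/(2 c). *)
Lemma integral_exp_sqr (a c : R) : 0 < c ->
  (\int[mu]_z (expR (- (c * (z - a) ^+ 2)))%:E = (Num.sqrt (pi / c))%:E)%E.
Proof.
move=> c0; pose s : R := Num.sqrt ((2 * c)^-1).
have s2 : s ^+ 2 = (2 * c)^-1 by rewrite sqr_sqrtr// invr_ge0 mulr_ge0// ltW.
have s0 : s != 0 by rewrite gt_eqF// sqrtr_gt0 invr_gt0 mulr_gt0.
have := integral_normal_pdf a s; rewrite (normal_pdfE _ s0).
have -> : (fun z : R => (normal_peak s * normal_fun a s z)%:E) =
    (fun z => (normal_peak s)%:E * (expR (- (c * (z - a) ^+ 2)))%:E)%E.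
  apply/funext => z; rewrite -EFinM; congr (_ * expR _)%:E.
  by rewrite -mulr_natr s2; field; rewrite gt_eqF.
have mexp : measurable_fun setT (fun z : R => expR (- (c * (z - a) ^+ 2))).
  apply: measurableT_comp => //.
  apply: measurableT_comp => //; apply: measurable_funM => //.
  by apply: measurable_funX; apply: measurable_funB.
rewrite ge0_integralZl_EFin ?normal_peak_ge0//; last first.
  by apply/measurable_EFinP.
have p0 := normal_peak_gt0 s0.
move=> h.
have -> : Num.sqrt (pi / c) = (normal_peak s)^-1.
  by rewrite /normal_peak invrK s2 -mulr_natr; congr Num.sqrt; field; rewrite gt_eqF.
set I := integral _ _ _ in h *.
have : ((normal_peak s)^-1%:E * ((normal_peak s)%:E * I) = (normal_peak s)^-1%:E)%E.
  by rewrite h mule1.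
by rewrite muleA -EFinM mulVf ?gt_eqF// mul1e.
Qed.

Lemma intRn_exp_sqnorm m (x : 'rV[R]_m) (k c : R) : 0 <= k -> 0 < c ->
  intRn (fun y : 'rV[R]_m => (k * expR (- (c * sqnorm (x - y))))%:E) =
  (k * Num.sqrt (pi / c) ^+ m)%:E.
Proof.
move=> k0 c0.
have -> : Num.sqrt (pi / c) ^+ m = \prod_(i < m) Num.sqrt (pi / c).
  by rewrite prodr_const card_ord.
rewrite -(@intRn_prod _ m k (fun i z => expR (- (c * (z - x 0 i) ^+ 2))))//.
- congr intRn; apply/funext => y; congr (_ * _)%:E.
  rewrite -expR_sum /sqnorm mulr_sumr -sumrN; congr expR; apply: eq_bigr => i _.
  by rewrite !mxE -sqrrN opprB.
- move=> i; apply: measurableT_comp => //.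
  apply: measurableT_comp => //; apply: measurable_funM => //.
  by apply: measurable_funX; apply: measurable_funB.
- by move=> i; exact: integral_exp_sqr.
Qed.

Lemma norm_lt_coord m (x : 'rV[R]_m) (h : R) : 0 < h ->
  (`|x| < h) = [forall i, `|x 0 i| < h].
Proof.
move=> h0; apply/idP/forallP => [xh i|xh].
  apply: le_lt_trans xh; rewrite [leRHS]/Num.Def.normr/= mx_normrE.
  by apply/bigmax_geP; right => /=; exists (0, i).
rewrite [ltLHS]/Num.Def.normr/= mx_normrE; apply/bigmax_ltP; split => //.
by case=> [j k] _ /=; rewrite ord1.
Qed.

Lemma intRn_cube m (x : 'rV[R]_m) (k h : R) : 0 <= k -> 0 < h ->
  intRn (fun y : 'rV[R]_m => (k * (`|y - x| < h)%R%:R)%:E) = (k * (2 * h) ^+ m)%:E.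
Proof.
move=> k0 h0.
have -> : (2 * h) ^+ m = \prod_(i < m) (2 * h) by rewrite prodr_const card_ord.
rewrite -(@intRn_prod _ m k (fun i => \1_(`]x 0 i - h, x 0 i + h[%classic)))//.
- congr intRn; apply/funext => y; congr (_ * _)%:E.
  rewrite norm_lt_coord//.
  have E i : \1_(`]x 0 i - h, x 0 i + h[%classic) (y 0 i) = (`|(y - x) 0 i| < h)%R%:R :> R.
    rewrite indicE; congr ((nat_of_bool _)%:R); rewrite !mxE; apply/idP/idP.
      by rewrite inE/= in_itv/= ltr_norml => ?; lra.
    by rewrite ltr_norml inE/= in_itv/= => ?; lra.
  case: (boolP [forall i, _]) => [/forallP H|].
    by rewrite big1// => i _; rewrite E H.
  rewrite negb_forall => /existsP[i ni].
  by rewrite (bigD1 i)//= E (negbTE ni) mul0r.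
- move=> i; rewrite integral_indic//= setIT lebesgue_measure_itv/= lte_fin ifT; last lra.
  by rewrite -EFinD; congr (_%:E); ring.
Qed.

(** For negative [e] the integrand is singular at [t], so the fundamental theorem is applied on
    intervals exhausting the domain, followed by monotone convergence. *)
Lemma integral_powR_le (t a e : R) : 0 < a -> -1 < e ->
  (\int[mu]_(s in `](t - a)%R, t[%classic) ((t - s) `^ e)%:E <= (a `^ (e + 1) / (e + 1))%:E)%E.
Proof.
move=> a0 e1; have e10 : 0 < e + 1 by lra.
(* With [k.+2] the interval is nondegenerate already for k = 0. *)
pose F (k : nat) : set R := `[t - a, t - a / k.+2%:R]%classic.
have Fk k : t - a < t - a / k.+2%:R.
  rewrite ltrD2l ltrN2 ltr_pdivrMr// ltr_pMr//.
  by rewrite ltr1n.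
have ak k : 0 < a / k.+2%:R by rewrite divr_gt0.
have Hk k : (\int[mu]_(s in F k) ((t - s) `^ e)%:E <= (a `^ (e + 1) / (e + 1))%:E)%E.
  have dF (s : R) : s < t ->
    is_derive s 1 (fun s : R => - ((t - s) `^ (e + 1) / (e + 1))) ((t - s) `^ e).
    move=> st.
    have d1 : is_derive s 1 (fun s : R => t - s) (-1).
      by apply: is_derive_eq; rewrite /GRing.scale/=; ring.
    have ts0 : 0 < t - s by lra.
    have d2 : is_derive s 1 (fun s : R => (t - s) `^ (e + 1)) ((e + 1) * (t - s) `^ (e + 1 - 1) * -1).
      exact: (@is_derive1_comp _ (fun z : R => z `^ (e + 1)) (fun s : R => t - s)
        s _ _ (@is_derive1_powR R (e + 1) _ ts0) d1).
    apply: is_derive_eq; rewrite /GRing.scale/= addrK; field.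
    by rewrite gt_eqF.
  have cf (s : R) : s < t -> {for s, continuous (fun s : R => (t - s) `^ e)}.
    move=> st; have st0 : 0 < t - s by lra.
    have d1 : {for s, continuous (fun s : R => t - s)}.
      by apply: contAtB; [exact: contAtC|exact: cvg_id].
    apply: (@contAt_comp _ _ _ (fun z : R => z `^ e) _ d1).
    apply: differentiable_continuous; apply/derivable1_diffP.
    by have [] := @is_derive1_powR R e (t - s) st0.
  have cF (s : R) : s < t -> {for s, continuous (fun s : R => - ((t - s) `^ (e + 1) / (e + 1)))}.
    by move=> st; apply: differentiable_continuous; apply/derivable1_diffP; have [] := dF s st.
  rewrite (@continuous_FTC2 _ _ (fun s : R => - ((t - s) `^ (e + 1) / (e + 1))))//.
  - rewrite -EFinB lee_fin opprK !opprB ?opprK.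
    have -> : t + (a - t) = a by ring.
    have : 0 <= (t + (a / k.+2%:R - t)) `^ (e + 1) / (e + 1) by rewrite divr_ge0 ?powR_ge0// ltW.
    by clear; lra.
  - apply: continuous_in_subspaceT => s; rewrite inE/= in_itv/= => /andP[_ sk].
    by apply: cf; rewrite (le_lt_trans sk)// ltrBlDr ltrDl.
  - split.
    + move=> s; rewrite in_itv/= => /andP[_ sk].
      by have [] := dF s ltac:(rewrite (lt_trans sk)// ltrBlDr ltrDl).
    + by apply: cvg_at_right_filter; apply: cF; rewrite ltrBlDr ltrDl.
    + by apply: cvg_at_left_filter; apply: cF; rewrite ltrBlDr ltrDl.
  - move=> s; rewrite in_itv/= => /andP[_ sk].
    rewrite derive1E; by have [] := dF s ltac:(rewrite (lt_trans sk)// ltrBlDr ltrDl).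
have mf k : measurable_fun (F k) (fun s : R => ((t - s) `^ e)%:E).
  apply/measurable_EFinP; apply: measurable_funTS.
  apply: (@measurableT_comp _ _ _ _ _ _ (fun z : R => z `^ e)) => //.
  exact: measurable_funB.
have U : `]t - a, t[%classic `<=` \bigcup_k F k.
  move=> s /=; rewrite in_itv/= => /andP[s1 s2].
  have [k hk] : exists k : nat, a / k.+2%:R <= t - s.
    have ts0 : 0 < t - s by lra.
    exists (Num.truncn (a / (t - s))).
    rewrite ler_pdivrMr// mulrC -ler_pdivrMr//.
    have := truncnS_gt (a / (t - s)); move=> /ltW h; apply: (le_trans h).
    by rewrite ler_nat.
  exists k => //; rewrite /F /= in_itv/= (ltW s1)/= lerBrDr -lerBrDl; exact: hk.
have mF k : measurable (F k) by exact: measurable_itv.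
apply: (@le_trans _ _ (\int[mu]_(s in \bigcup_k F k) ((t - s) `^ e)%:E)%E).
  apply: ge0_subset_integral => //.
  - exact: bigcupT_measurable.
  - by apply/measurable_fun_bigcup.
  - by move=> s _; rewrite lee_fin powR_ge0.
have C : (\int[mu]_(s in F k) ((t - s) `^ e)%:E @[k --> \oo] -->
    \int[mu]_(s in \bigcup_k F k) ((t - s) `^ e)%:E)%E.
  apply: ge0_nondecreasing_set_cvg_integral => //; last by move=> k s _; rewrite lee_fin powR_ge0.
  apply/nondecreasing_seqP => k; rewrite subsetEset => s; rewrite /F /= !in_itv/= => /andP[-> h] /=.
  by rewrite (le_trans h)// lerD2l lerN2 ler_pM2l// lef_pV2 ?posrE// ler_nat.
rewrite -(cvg_lim _ C)//; apply: lime_le; first by apply/cvg_ex; eexists; exact: C.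
by apply: nearW => k; exact: Hk.
Qed.

End ExplicitIntegrals.

(** * Iterated integrals over space-time *)

Section StripIntegral.
Context {R : realType}.
Local Notation mu := (@lebesgue_measure R).

(** A nonnegative function exceeds every negative threshold, so continuity matters only where [f] is
    positive. This admits arbitrary positive powers of [u] at its zeros. *)
Lemma lsc_patch (T : topologicalType) (B : T -> bool) (f : T -> R) :
  open [set x | B x] -> (forall x, B x -> 0 <= f x) ->
  (forall x, B x -> 0 < f x -> {for x, continuous f}) ->
  lower_semicontinuous (fun x => ((B x)%:R * f x)%:E).
Proof.
move=> oB f0 cf x a; rewrite lte_fin => ax.
have g0 y : 0 <= (B y)%:R * f y.
  by case: (boolP (B y)) => By; [rewrite mul1r f0|rewrite mul0r].
have [a0|a0] := ltP a 0.
  by exists setT; [exact: filterT|move=> y _; rewrite lte_fin; exact: lt_le_trans (g0 y)].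
have Bx : B x by apply: contraTT ax => /negbTE ->; rewrite mul0r -leNgt.
rewrite Bx mul1r in ax.
have fx0 : 0 < f x by exact: le_lt_trans ax.
exists ([set y | B y] `&` [set y | a < f y]).
  apply: filterI; first exact: open_nbhs_nbhs.
  by have := cf x Bx fx0; rewrite /continuous_at => /cvgr_gt; exact.
by move=> y [/= By afy]; rewrite By mul1r lte_fin.
Qed.

Variable n : nat.
Implicit Types (F G : R * 'rV[R]_n -> \bar R).

Definition sint F : \bar R := (\int[mu]_s intRn (fun y => F (s, y)))%E.

Lemma sint_ge0 F : (forall q, 0 <= F q)%E -> (0 <= sint F)%E.
Proof. by move=> F0; apply: integral_ge0 => s _; exact: intRn_ge0. Qed.

Lemma measurable_intRn F : (forall q, 0 <= F q)%E -> lower_semicontinuous F ->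
  measurable_fun setT (fun s : R => intRn (fun y => F (s, y))).
Proof.
by move=> F0 lF; apply: lower_semicontinuous_measurable; exact: lsc_intRn.
Qed.

Lemma lsc_section F s : lower_semicontinuous F ->
  lower_semicontinuous (fun y => F (s, y)).
Proof. by move=> lF; apply: lsc_comp => //; exact: pairl_continuous. Qed.

Lemma sintD F G : (forall q, 0 <= F q)%E -> (forall q, 0 <= G q)%E ->
  lower_semicontinuous F -> lower_semicontinuous G ->
  sint (fun q => F q + G q)%E = (sint F + sint G)%E.
Proof.
move=> F0 G0 lF lG; rewrite /sint -ge0_integralD//.
- by apply: eq_integral => s _; rewrite intRnD//; exact: lsc_section.
- by move=> s _; exact: intRn_ge0.
- exact: measurable_intRn.
- by move=> s _; exact: intRn_ge0.
- exact: measurable_intRn.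
Qed.

Lemma sintZ (k : R) F : 0 <= k -> (forall q, 0 <= F q)%E ->
  lower_semicontinuous F -> sint (fun q => k%:E * F q)%E = (k%:E * sint F)%E.
Proof.
move=> k0 F0 lF; rewrite /sint -ge0_integralZl_EFin//.
- by apply: eq_integral => s _; rewrite intRnZ//; exact: lsc_section.
- by move=> s _; exact: intRn_ge0.
- exact: measurable_intRn.
Qed.

Lemma lscD (T : topologicalType) (f g : T -> \bar R) : (forall x, 0 <= f x)%E ->
  (forall x, 0 <= g x)%E -> lower_semicontinuous f -> lower_semicontinuous g ->
  lower_semicontinuous (fun x => f x + g x)%E.
Proof.
move=> f0 g0 lf lg x a afg.
have [a0|a0] := ltP a 0.
  exists setT; first exact: filterT.
  by move=> y _; apply: (@lt_le_trans _ _ 0%E); rewrite ?lte_fin// adde_ge0.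
have [b [c [bf cg bc]]] : exists b c : R, [/\ (b%:E < f x)%E, (c%:E < g x)%E & a <= b + c].
  move: (f0 x) (g0 x) afg; case: (f x) (g x) => [r| |] [s| |]//=; rewrite ?lee_fin.
  - move=> r0 s0; rewrite lte_fin => h.
    exists (r - (r + s - a) / 2), (s - (r + s - a) / 2); rewrite !lte_fin; split; lra.
  - by move=> r0 _ _; exists (r - 1), (a - r + 1); rewrite lte_fin ltry; split => //; lra.
  - by move=> _ s0 _; exists (a - s + 1), (s - 1); rewrite lte_fin ltry; split => //; lra.
  - by move=> _ _ _; exists a, 0; rewrite !ltry; split => //; lra.
have [V nV hV] := lf x b bf; have [W nW hW] := lg x c cg.
exists (V `&` W); first exact: filterI.
move=> y [Vy Wy]; apply: (@le_lt_trans _ _ (b%:E + c%:E)%E); first by rewrite -EFinD lee_fin.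
by apply: lteD; [exact: hV|exact: hW].
Qed.

Lemma lscZ (T : topologicalType) (k : R) (f : T -> \bar R) : 0 <= k ->
  (forall x, 0 <= f x)%E -> lower_semicontinuous f ->
  lower_semicontinuous (fun x => k%:E * f x)%E.
Proof.
rewrite le_eqVlt => /predU1P[<-|k0] f0 lf x a.
  rewrite mul0e => a0; exists setT; first exact: filterT.
  by move=> y _; rewrite mul0e.
rewrite -lte_pdivrMl// -EFinM => /lf[V nV hV]; exists V => // y /hV.
by rewrite EFinM lte_pdivrMl.
Qed.

Lemma intRn_0 m : intRn (fun _ : 'rV[R]_m => 0%E) = 0%E.
Proof.
by elim: m => [//|m IH]; rewrite intRnS; under eq_integral do rewrite IH; rewrite integral0.
Qed.

Lemma int_strip_le (T : R) (f : 'rV[R]_n -> R -> \bar R) F :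
  (forall q, 0 <= F q)%E ->
  (forall (y : 'rV[R]_n) (s : R), (0 < s < T)%R -> (0 <= f y s <= F (s, y))%E) ->
  (int_strip T f <= sint F)%E.
Proof.
move=> F0 fF; rewrite /int_strip integral_mkcond /sint; apply: integral_mono.
  move=> s _; rewrite patchE; case: ifPn => // /set_mem; rewrite /= in_itv/= => sT.
  by apply: intRn_ge0 => y; have /andP[] := fF y s sT.
move=> s _; rewrite patchE; case: ifPn => [/set_mem|_]; last exact: intRn_ge0.
rewrite /= in_itv/= => sT; apply: intRn_mono => y; by have /andP[] := fF y s sT.
Qed.

Lemma sint_patch_strip (T : R) (f : R * 'rV[R]_n -> R) :
  sint (fun q => ((0 < q.1 < T)%R%:R * f q)%:E) = int_strip T (fun y s => (f (s, y))%:E).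
Proof.
rewrite /int_strip integral_mkcond; apply: eq_integral => s _; rewrite patchE.
case: ifPn => [/set_mem|].
  by rewrite /= in_itv/= => ->; congr intRn; apply/funext => y; rewrite mul1r.
rewrite notin_setE/= in_itv/= => /negP/negbTE ->.
by rewrite -[RHS](intRn_0 n); congr intRn; apply/funext => y; rewrite mul0r.
Qed.

Lemma open_strip (a b : R) : open [set q : R * 'rV[R]_n | a < q.1 < b].
Proof.
have -> : [set q : R * 'rV[R]_n | a < q.1 < b] =
  (fun q : R * 'rV[R]_n => q.1) @^-1` `]a, b[%classic.
  by apply/seteqP; split => q /=; rewrite in_itv.
apply: open_comp; last exact: interval_open.
by move=> [s y] _; exact: cvg_fst.
Qed.

Definition kernel_pow (q : R) (x : 'rV[R]_n) (t : R) (p : R * 'rV[R]_n) : R :=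
  (4 * pi * (t - p.1)) `^ (- (n%:R * q / 2)) *
  expR (- (q / (4 * (t - p.1)) * sqnorm (x - p.2))).

Lemma kernel_pow_ge0 q x t p : 0 <= kernel_pow q x t p.
Proof. by rewrite mulr_ge0 ?powR_ge0 ?expR_ge0. Qed.

Lemma heat_kernel_powR q (x y : 'rV[R]_n) (t s : R) : s < t ->
  heat_kernel (x - y) (t - s) `^ q = kernel_pow q x t (s, y).
Proof.
move=> st; rewrite /heat_kernel subr_gt0 st /kernel_pow/=.
have h : 0 < 4 * pi * (t - s) by rewrite !mulr_gt0 ?pi_gt0// subr_gt0.
rewrite powRM ?powR_ge0 ?expR_ge0// -powRrM -expRM; congr (_ * _).
  by congr (_ `^ _); field.
by congr expR; field; rewrite gt_eqF// subr_gt0.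
Qed.

Lemma kernel_pow_continuous q x t s y : s < t ->
  {for (s, y), continuous (kernel_pow q x t)}.
Proof.
move=> st.
have c1 : {for (s, y), continuous (fun p : R * 'rV[R]_n => p.1)} by exact: cvg_fst.
have c2 : {for (s, y), continuous (fun p : R * 'rV[R]_n => p.2)} by exact: cvg_snd.
have c3 : {for (s, y), continuous (fun p : R * 'rV[R]_n => t - p.1)}.
  by apply: contAtB; [exact: contAtC|exact: c1].
have c4 : {for (s, y), continuous (fun p : R * 'rV[R]_n => sqnorm (x - p.2))}.
  have -> : (fun p : R * 'rV[R]_n => sqnorm (x - p.2)) = (fun p => sqnorm (p.2 - x)).
    by apply/funext => p; rewrite /sqnorm; apply: eq_bigr => i _; rewrite !mxE -sqrrN opprB.
  exact: (continuous_comp c2 (@continuous_sqnorm_sub _ _ x _)).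
have ts : 0 < t - s by rewrite subr_gt0.
apply: contAtM.
  apply: (@contAt_powR _ _ _ (fun p : R * 'rV[R]_n => 4 * pi * (t - p.1))).
    by rewrite /= !mulr_gt0 ?pi_gt0.
  by apply: contAtM; [exact: contAtC|exact: c3].
apply: (@contAt_comp _ _ _ (@expR R)); last exact: continuous_expR.
have c5 : {for (s, y), continuous (fun p : R * 'rV[R]_n => (4 * (t - p.1))^-1)}.
  apply: contAtV; first by rewrite /= gt_eqF// mulr_gt0.
  by apply: contAtM; [exact: contAtC|exact: c3].
have c6 : {for (s, y), continuous (fun p : R * 'rV[R]_n => q / (4 * (t - p.1)) * sqnorm (x - p.2))}.
  by apply: contAtM => //; apply: contAtM; [exact: contAtC|exact: c5].
exact: (cvgN c6).
Qed.

Lemma lsc_kernel (q : R) (x : 'rV[R]_n) (t a : R) :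
  lower_semicontinuous (fun p : R * 'rV[R]_n => ((t - a < p.1 < t)%R%:R * kernel_pow q x t p)%:E).
Proof.
apply: (@lsc_patch _ (fun p : R * 'rV[R]_n => t - a < p.1 < t)).
- exact: open_strip.
- by move=> p _; exact: kernel_pow_ge0.
- by move=> [s y] /= /andP[_ st] _; exact: kernel_pow_continuous.
Qed.

(** The spatial Gaussian integral leaves a multiple of (t - s)^(n(1-q)/2), integrable in time
    because this exponent exceeds -1 when n q < n + 2. *)
Lemma sint_kernel_le (q : R) (x : 'rV[R]_n) (t a : R) : 0 < a -> 0 < q -> n%:R * q < n%:R + 2 ->
  (sint (fun p : R * 'rV[R]_n => ((t - a < p.1 < t)%R%:R * kernel_pow q x t p)%:E) <=
  (q `^ (- (n%:R / 2)) * (4 * pi) `^ (n%:R * (1 - q) / 2) *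
   (a `^ (n%:R * (1 - q) / 2 + 1) / (n%:R * (1 - q) / 2 + 1)))%:E)%E.
Proof.
move=> a0 q0 nq; set e := n%:R * (1 - q) / 2.
have e1 : -1 < e by rewrite /e; move: nq; clear; lra.
pose K := q `^ (- (n%:R / 2)) * (4 * pi) `^ e.
have K0 : 0 <= K by rewrite mulr_ge0 ?powR_ge0.
have pi0 : 0 < pi :> R by exact: pi_gt0.
have -> : sint (fun p : R * 'rV[R]_n => ((t - a < p.1 < t)%R%:R * kernel_pow q x t p)%:E) =
   (\int[mu]_(s in `](t - a)%R, t[%classic) (K%:E * ((t - s) `^ e)%:E))%E.
  rewrite [RHS]integral_mkcond; apply: eq_integral => s _; rewrite patchE.
  case: ifPn => [/set_mem|]; last first.
    rewrite notin_setE/= in_itv/= => /negP/negbTE ->.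
    by rewrite -[RHS](intRn_0 n); congr intRn; apply/funext => y; rewrite mul0r.
  rewrite /= in_itv/= => sab; rewrite sab; have ts : 0 < t - s by move: sab; clear; lra.
  under eq_fun do rewrite mul1r.
  rewrite /kernel_pow/= intRn_exp_sqnorm ?powR_ge0 ?divr_gt0 ?mulr_gt0//.
  rewrite -EFinM; congr (_%:E).
  have -> : pi / (q / (4 * (t - s))) = q^-1 * (4 * pi * (t - s)).
    by field; rewrite !gt_eqF.
  have qp : 0 <= q^-1 by rewrite invr_ge0 ltW.
  have pts : 0 < 4 * pi * (t - s) by rewrite !mulr_gt0.
  have -> : K * (t - s) `^ e = q `^ (- (n%:R / 2)) * (4 * pi * (t - s)) `^ e.
    by rewrite /K -mulrA -powRM ?mulr_ge0 ?(ltW ts) ?(ltW pi0).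
  move: (4 * pi * (t - s)) pts => w w0.
  rewrite -powR12_sqrt ?mulr_ge0 ?(ltW w0)//.
  rewrite -powR_mulrn ?powR_ge0// -powRrM (powRM _ qp (ltW w0)).
  rewrite mulrCA -powRD_gt0//; congr (_ * _).
    by rewrite -powR_inv1 ?(ltW q0)// -powRrM mulN1r mulrC.
  by congr (_ `^ _); rewrite /e; field.
rewrite ge0_integralZl_EFin//; last 2 first.
- by move=> s _; rewrite lee_fin powR_ge0.
- apply/measurable_EFinP; apply: measurable_funTS.
  apply: (@measurableT_comp _ _ _ _ _ _ (fun z : R => z `^ e)) => //.
  exact: measurable_funB.
rewrite -/K [leRHS]EFinM; apply: lee_wpmul2l; first by rewrite lee_fin.
exact: integral_powR_le.
Qed.

End StripIntegral.

(** * Local integrability of nonnegative supersolutions *)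

Section LocalIntegrability.
Context {R : realType}.

(** Here [p'] may lie outside [A]: the boxes centred in [A] stick out of it. *)
Lemma compact_oscillation (M : pseudoMetricType R) (A : set M) (f : M -> R) :
  compact A -> (forall p, A p -> {for p, continuous f}) ->
  exists2 eta : R, 0 < eta & forall p p', A p -> ball p eta p' -> `|f p - f p'| < 1.
Proof.
move=> /compact_near_coveringP cA cf.
have := cA R (0^'+) (fun eta p => forall p', ball p eta p' -> `|f p - f p'| < 1) _.
case.
  move=> p Ap.
  have h12 : 0 < 1 / 2 :> R by rewrite divr_gt0.
  have /cvgrPdist_lt/(_ (1 / 2) h12)/nbhs_ballP[e /= e0 he] := cf p Ap.
  exists (ball p (e / 2), [set d : R | d < e / 2]) => /=.
    split; first by apply: nbhsx_ballx; rewrite divr_gt0.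
    by apply: nbhs_right_lt; rewrite divr_gt0.
  move=> [p' d] /= [pp' de] p'' p'p''.
  have h1 : `|f p - f p'| < 1 / 2.
    by apply: he; apply: le_ball pp'; rewrite ler_pdivrMr// ler_peMr ?ltW// ltr1n.
  have h2 : `|f p - f p''| < 1 / 2.
    apply: he; apply: (@ball_split _ _ p') => //; exact: le_ball (ltW de) _ p'p''.
  by move: h1 h2; rewrite !ltr_norml; clear; lra.
move=> e /= e0 he; exists (e / 2); first by rewrite divr_gt0.
move=> p p' Ap; apply: he => //=; last by rewrite divr_gt0.
by rewrite sub0r normrN gtr0_norm ?divr_gt0// ltr_pdivrMr// ltr_pMr// ltr1n.
Qed.

(** If 2^j + 1 is the largest threshold below [v], then v + 1 <= 4 2^j. Thresholds carry the extra 1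
    because [u] oscillates by less than 1 on a box, so it stays above 2^j there. *)
Lemma powR_le_dyadic_sum (q v : R) (J : nat) : 0 < q -> 0 <= v -> v < 2 ^+ J + 1 ->
  (v + 1) `^ q <= 4 `^ q * (1 + \sum_(j < J) (2 ^+ j + 1 <= v)%R%:R * (2 ^+ j) `^ q).
Proof.
move=> q0 v0; elim: J => [|J IH] vJ.
  rewrite big_ord0 addr0 mulr1; apply: ge0_ler_powR; rewrite ?nnegrE ?ltW//.
  - by rewrite ltr_wpDl.
  - by rewrite expr0 in vJ; move: vJ; clear; lra.
rewrite big_ord_recr/=; have [vJ'|vJ'] := ltP v (2 ^+ J + 1).
  by rewrite mul0r addr0 IH.
rewrite mul1r.
have S0 : 0 <= \sum_(i < J) (2 ^+ i + 1 <= v)%R%:R * (2 ^+ i) `^ q.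
  by apply: sumr_ge0 => i _; rewrite mulr_ge0 ?ler0n ?powR_ge0.
apply: (@le_trans _ _ (4 `^ q * (2 ^+ J) `^ q)).
  rewrite -powRM ?exprn_ge0//; apply: ge0_ler_powR; rewrite ?nnegrE ?ltW//.
  - by rewrite ltr_wpDl.
  - have J1 : 1 <= 2 ^+ J :> R by rewrite exprn_ege1// ler1n.
    by rewrite exprS in vJ; move: vJ J1; clear; lra.
by rewrite ler_wpM2l ?powR_ge0// addrA ler_wpDl// addr_ge0.
Qed.

Section Lattice.
Variables (n K : nat) (xc : 'rV[R]_n) (h : R).

(** Centres of the K^n cubes of side 2 h that tile the cube of radius K h about [xc]. *)
Definition lattice_point (f : {ffun 'I_n -> 'I_K}) : 'rV[R]_n :=
  \row_i (xc 0 i - K%:R * h + (2 * (f i)%:R + 1) * h).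

Lemma lattice_cover (x : 'rV[R]_n) : 0 < h -> `|x - xc| < K%:R * h ->
  exists f, `|x - lattice_point f| <= h.
Proof.
move=> h0 xK.
pose z i := (x 0 i - xc 0 i + K%:R * h) / (2 * h).
have zx i : x 0 i - xc 0 i + K%:R * h = 2 * h * z i.
  by rewrite /z; field; rewrite gt_eqF.
have h20 : 0 < 2 * h by rewrite mulr_gt0.
have xi i : - (K%:R * h) < x 0 i - xc 0 i < K%:R * h.
  have := le_lt_trans (coord_le_norm (x - xc) i) xK.
  by rewrite !mxE ltr_norml.
have z0 i : 0 <= z i by rewrite divr_ge0 ?ltW//; move: (xi i); clear; lra.
have zK i : (Num.truncn (z i) < K)%N.
  rewrite -(ltr_nat R) (@le_lt_trans _ _ (z i)) ?truncn_le ?z0//.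
  rewrite /z ltr_pdivrMr//; move: (xi i); clear; lra.
exists [ffun i => Ordinal (zK i)].
apply: norm_rV_le; first exact: ltW.
move=> i; rewrite !mxE ffunE/=.
have := truncn_le (z i); have := truncnS_gt (z i); rewrite z0 -natr1 => a1 a2.
have -> : x 0 i - (xc 0 i - K%:R * h + (2 * (Num.truncn (z i))%:R + 1) * h) =
  h * (2 * (z i - (Num.truncn (z i))%:R) - 1)
  by have -> : x 0 i = xc 0 i - K%:R * h + 2 * h * z i; [rewrite -zx; ring|ring].
rewrite normrM gtr0_norm// ler_piMr ?(ltW h0)// ler_norml; move: a1 a2; clear; lra.
Qed.

Lemma lattice_norm f : 0 < h -> `|lattice_point f - xc| <= K%:R * h.
Proof.
move=> h0; apply: norm_rV_le; first by rewrite mulr_ge0 ?ler0n ?ltW.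
move=> i; rewrite !mxE.
have -> : xc 0 i - K%:R * h + (2 * (f i)%:R + 1) * h - xc 0 i =
  h * (2 * (f i)%:R + 1 - K%:R) by ring.
rewrite normrM gtr0_norm// mulrC ler_pM2r// ler_norml.
have f0 : 0 <= (f i)%:R :> R by exact: ler0n.
have fK : (f i)%:R + 1 <= K%:R :> R by rewrite natr1 ler_nat ltn_ord.
move: f0 fK; clear; lra.
Qed.

Lemma lattice_separated f g : 0 < h -> f != g ->
  2 * h <= `|lattice_point f - lattice_point g|.
Proof.
move=> h0 fg.
have [i fgi] : exists i, f i != g i.
  apply/existsP; apply: contraNT fg => /existsPn H; apply/eqP/ffunP => i.
  by have := H i; rewrite negbK => /eqP.
apply: le_trans (coord_le_norm _ i); rewrite !mxE.
have -> : xc 0 i - K%:R * h + (2 * (f i)%:R + 1) * h - (xc 0 i - K%:R * h + (2 * (g i)%:R + 1) * h) =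
  (2 * h) * ((f i)%:R - (g i)%:R) by ring.
rewrite normrM gtr0_norm ?mulr_gt0// ler_peMr ?mulr_ge0 ?(ltW h0)//.
have : (f i != g i :> nat) by [].
rewrite neq_ltn => /orP[] lt.
  rewrite distrC ler_normr; apply/orP; left; rewrite lerBrDl natr1 ler_nat//.
by rewrite ler_normr; apply/orP; left; rewrite lerBrDl natr1 ler_nat.
Qed.

Lemma lattice_inj : 0 < h -> injective lattice_point.
Proof.
move=> h0 f g E; apply/eqP; apply: contraTT isT => /(lattice_separated h0).
by rewrite E subrr normr0 leNgt mulr_gt0.
Qed.

End Lattice.

End LocalIntegrability.

(** * Indicators of parabolic boxes *)

Lemma open_lt_fun (R : realType) (T : topologicalType) (f g : T -> R) :
  continuous f -> continuous g -> open [set x | f x < g x].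
Proof.
move=> cf cg.
have -> : [set x | f x < g x] = (fun x => g x - f x) @^-1` [set z | 0 < z].
  by apply/seteqP; split => x /=; rewrite subr_gt0.
by apply: open_comp (@open_gt _ _) => x _; apply: contAtB; [exact: cg|exact: cf].
Qed.

Section Boxes.
Context {R : realType}.
Variable n : nat.
Local Notation mu := (@lebesgue_measure R).

Lemma open_box (y : 'rV[R]_n) (h a b : R) :
  open [set p : R * 'rV[R]_n | (`|p.2 - y| < h) && (a < p.1 < b)].
Proof.
have -> : [set p : R * 'rV[R]_n | (`|p.2 - y| < h) && (a < p.1 < b)] =
    [set p | `|p.2 - y| < h] `&` [set p | a < p.1 < b].
  by apply/seteqP; split => p /=; [move=> /andP|move=> ?; apply/andP].
apply: openI; last exact: open_strip.
apply: (@open_lt_fun _ _ (fun p : R * 'rV[R]_n => `|p.2 - y|)) => p; last exact: contAtC.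
have c2 : {for p, continuous (fun p : R * 'rV[R]_n => p.2)} by exact: snd_continuous.
exact: (continuous_comp c2 (@continuous_norm_sub _ _ y _)).
Qed.

Lemma lsc_box (y : 'rV[R]_n) (c h a b : R) : 0 <= c ->
  lower_semicontinuous (fun p : R * 'rV[R]_n => (c * ((`|p.2 - y| < h) && (a < p.1 < b))%R%:R)%:E).
Proof.
move=> c0.
have := @lsc_patch R _ (fun p : R * 'rV[R]_n => (`|p.2 - y| < h) && (a < p.1 < b))
  (fun=> c) (@open_box y h a b) (fun _ _ => c0) (fun p _ _ => @contAtC _ _ p c).
by congr lower_semicontinuous; apply/funext => p; rewrite mulrC.
Qed.

Lemma sint_box (y : 'rV[R]_n) (c h a w : R) : 0 <= c -> 0 < h -> 0 < w ->
  sint (fun p : R * 'rV[R]_n => (c * ((`|p.2 - y| < h) && (a < p.1 < a + w))%R%:R)%:E) =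
  (c * ((2 * h) ^+ n * w))%:E.
Proof.
move=> c0 h0 w0; rewrite /sint.
transitivity (\int[mu]_s ((c * (2 * h) ^+ n)%:E * (\1_(`]a, (a + w)[%classic) s)%:E))%E.
  apply: eq_integral => s _; rewrite -EFinM indicE.
  have -> : (s \in `]a, (a + w)[%classic) = (a < s < a + w).
    by apply/idP/idP; rewrite inE/= in_itv.
  rewrite mulrAC -(@intRn_cube _ _ y) ?mulr_ge0 ?ler0n//.
  congr intRn; apply/funext => z /=; congr (_%:E).
  by case: (`|z - y| < h); case: (a < s < a + w); rewrite /= ?mulr1 ?mulr0.
rewrite ge0_integralZl_EFin//; last 2 first.
  - by apply/measurable_EFinP; exact: measurable_indic.
  - by rewrite mulr_ge0// exprn_ge0// mulr_ge0// ltW.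
rewrite integral_indic//= setIT lebesgue_measure_itv/= lte_fin ltrDl w0 -EFinD -EFinM.
by congr (_%:E); ring.
Qed.

Lemma sint_box_sum (I : Type) (s : seq I) (c : I -> R) (y : I -> 'rV[R]_n) (a : I -> R) (h w : R) :
  (forall i, 0 <= c i) -> 0 < h -> 0 < w ->
  sint (fun p : R * 'rV[R]_n =>
    (\sum_(i <- s) c i * ((`|p.2 - y i| < h) && (a i < p.1 < a i + w))%R%:R)%:E) =
  ((\sum_(i <- s) c i) * ((2 * h) ^+ n * w))%:E.
Proof.
move=> c0 h0 w0.
pose F (s : seq I) (p : R * 'rV[R]_n) : \bar R :=
  (\sum_(i <- s) c i * ((`|p.2 - y i| < h) && (a i < p.1 < a i + w))%R%:R)%:E.
have F0 s' p : (0 <= F s' p)%E.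
  by rewrite lee_fin sumr_ge0// => i _; rewrite mulr_ge0.
suff [] : lower_semicontinuous (F s) /\ sint (F s) = ((\sum_(i <- s) c i) * ((2 * h) ^+ n * w))%:E by [].
elim: s => [|i s [lF iF]].
  have FE : F [::] = (fun=> 0%E) by apply/funext => p; rewrite /F big_nil.
  rewrite FE; split.
    by move=> p b b0; exists setT => //; exact: filterT.
  rewrite big_nil mul0r /sint; under eq_integral do rewrite intRn_0.
  exact: integral0.
pose G (p : R * 'rV[R]_n) : \bar R := (c i * ((`|p.2 - y i| < h) && (a i < p.1 < a i + w))%R%:R)%:E.
have FE : F (i :: s) = (fun p => G p + F s p)%E.
  by apply/funext => p; rewrite /F big_cons EFinD.
have G0 p : (0 <= G p)%E by rewrite lee_fin mulr_ge0.
have lG : lower_semicontinuous G by exact: lsc_box.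
rewrite FE; split; first exact: lscD.
have iG : sint G = (c i * ((2 * h) ^+ n * w))%:E by exact: sint_box.
by rewrite sintD// iF iG -EFinD -mulrDl big_cons.
Qed.

End Boxes.

Section DyadicSum.
Context {R : realType}.

Lemma geometric_sum_le (x : R) (J : nat) : 0 <= x -> x < 1 ->
  \sum_(j < J) x ^+ j <= (1 - x)^-1.
Proof.
move=> x0 x1; have x10 : 0 < 1 - x by rewrite subr_gt0.
rewrite -(ler_pM2l x10) mulfV ?gt_eqF//.
have := subrX1 x J; rewrite -[x - 1]opprB mulNr => /(canLR (@opprK _)) <-.
by rewrite opprB gerBl exprn_ge0.
Qed.

(** Weak type [pw] implies integrability of the power q < pw, in discrete form with [A] the volume
    unit of a box: the dyadic terms sum to a geometric series of ratio 2^(q - pw). *)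
Lemma dyadic_capacity_sum (I : finType) (v : I -> R) (q pw A C0 : R) : 0 < q -> q < pw ->
  0 <= A -> 0 < C0 -> (forall b, 0 <= v b) ->
  (forall j : nat, (\sum_b (2 ^+ j + 1 <= v b)%R%:R) * A <= (C0 / 2 ^+ j) `^ pw) ->
  (\sum_b (v b + 1) `^ q) * A <= 4 `^ q * (#|I|%:R * A + C0 `^ pw / (1 - 2 `^ (q - pw))).
Proof.
move=> q0 qpw A0 C00 v0 vA.
(* [J] depends on [v], but it only counts the terms of the geometric sum, whose bound is uniform. *)
pose J := (Num.truncn (\sum_b v b)).+1.
have vJ b : v b < 2 ^+ J + 1.
  have h1 : v b <= \sum_b v b.
    by rewrite (bigD1 b)//= lerDl sumr_ge0.
  have h2 := truncnS_gt (\sum_b v b).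
  have h3 : J%:R < 2 ^+ J :> R by rewrite -natrX ltr_nat ltn_expl.
  by move: h1 h2 h3; rewrite /J; clear; lra.
set x := 2 `^ (q - pw).
have x0 : 0 <= x by exact: powR_ge0.
have x1 : x < 1.
  rewrite /x /powR gt_eqF// -[ltRHS]expR0 ltr_expR nmulr_rlt0 ?subr_lt0//.
  by rewrite ln_gt0// ltr1n.
have term j : (2 ^+ j) `^ q * (C0 / 2 ^+ j) `^ pw = C0 `^ pw * x ^+ j.
  have y0 : 0 < 2 ^+ j :> R by rewrite exprn_gt0.
  rewrite powRM ?ltW ?invr_gt0// mulrCA; congr (_ * _).
  rewrite -powR_inv1 ?ltW// -powRrM mulN1r -powRD_gt0//.
  by rewrite -powR_mulrn// -powRrM mulrC powRrM powR_mulrn ?powR_ge0.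
apply: (@le_trans _ _ ((\sum_b 4 `^ q * (1 + \sum_(j < J) (2 ^+ j + 1 <= v b)%R%:R * (2 ^+ j) `^ q)) * A)).
  apply: ler_wpM2r => //; apply: ler_sum => b _; exact: powR_le_dyadic_sum.
rewrite -mulr_sumr -mulrA; apply: ler_wpM2l; first exact: powR_ge0.
rewrite big_split/= mulrDl sumr_const; apply: lerD; first by rewrite mulr_natl.
rewrite exchange_big/= mulr_suml.
apply: (@le_trans _ _ (\sum_(j < J) C0 `^ pw * x ^+ j)).
  apply: ler_sum => j _; rewrite -mulr_suml mulrAC -term mulrC.
  by apply: ler_wpM2l; [exact: powR_ge0|exact: vA].
rewrite -mulr_sumr; apply: ler_wpM2l; first exact: powR_ge0.
exact: geometric_sum_le.
Qed.

Lemma natr_count (T : Type) (s : seq T) (P : pred T) :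
  (count P s)%:R = \sum_(x <- s) (P x)%:R :> R.
Proof. by elim: s => [|x s IH]; rewrite ?big_nil ?big_cons//= natrD IH. Qed.

End DyadicSum.

(** * Integrability of powers below (n+2)/n *)

Lemma sint_mono (R : realType) (n : nat) (F G : R * 'rV[R]_n -> \bar R) :
  (forall p, 0 <= F p)%E -> (forall p, F p <= G p)%E -> (sint F <= sint G)%E.
Proof.
move=> F0 FG; apply: integral_mono => s _; first exact: intRn_ge0.
by apply: intRn_mono.
Qed.

(** Times before [d] are cut off to have uniform continuity of [u]; the grid may depend on [d],
    while [C] comes from the volume of the cylinder and the capacity constant alone. *)
Lemma sint_powR_truncated (R : realType) (n : nat) (u : 'rV[R]_n -> R -> R) (xc : 'rV[R]_n)
    (r ts r1 q : R) : (0 < n)%N -> 0 < r -> 0 < ts ->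
  n%:R / 2 * (5 * ts) <= 4 * r ^+ 2 -> 10 * ts <= r ^+ 2 ->
  supersolution u xc (3 * r) ts ->
  0 < r1 -> n%:R * r1 ^+ 2 <= r ^+ 2 -> 0 < q -> n%:R * q < n%:R + 2 ->
  exists2 C : R, 0 <= C & forall d : R, 0 < d < ts / 2 ->
    (sint (fun p : R * 'rV[R]_n =>
      (((`|p.2 - xc| < r1) && (d < p.1 < ts / 2))%R%:R * u p.2 p.1 `^ q)%:E) <= C%:E)%E.
Proof.
move=> n0 r0 ts0 h1 h2 uh r10 nr1 q0 nq.
have [C0 C00 cap] := capacity n0 r0 ts0 h1 h2 uh.
have nR : 0 < n%:R :> R by rewrite ltr0n.
have r1r : r1 <= r.
  rewrite -(@ler_pXn2r _ 2)// ?nnegrE ?(ltW r10) ?(ltW r0)//; apply: le_trans nr1.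
  by rewrite ler_peMl ?sqr_ge0// ler1n.
pose pw := (n%:R + 2) / n%:R : R.
have qpw : q < pw by rewrite ltr_pdivlMr// mulrC.
have pw0 : 0 < pw by exact: lt_trans qpw.
have x1 : 0 <= (1 - 2 `^ (q - pw))^-1.
  rewrite invr_ge0 subr_ge0 /powR gt_eqF// -[leRHS]expR0 ler_expR nmulr_rle0 ?subr_lt0//.
  by rewrite ln_ge0// ler1n.
pose B := 4 `^ q * (ts * r1 ^+ n + C0 `^ pw / (1 - 2 `^ (q - pw))).
have B0 : 0 <= B.
  rewrite mulr_ge0 ?powR_ge0// addr_ge0// mulr_ge0 ?powR_ge0 ?exprn_ge0//; exact: ltW.
exists (B * (4 ^+ n * 3)); first by rewrite mulr_ge0// mulr_ge0 ?exprn_ge0.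
move=> d /andP[d0 dts].
have uc (p : 'rV[R]_n * R) : ([set y : 'rV[R]_n | `|y - xc| <= r1] `*` `[d, ts / 2]) p ->
    {for p, continuous (fun p : 'rV[R]_n * R => u p.1 p.2)}.
  case: p => y s [/= yr]; rewrite in_itv/= => sd.
  have [||_ uj _] := uh y s; [|by move: d0 dts ts0 sd; clear; lra|exact: uj].
  by apply: le_trans yr _; move: r1r r0; clear; lra.
have [eta eta0 osc] := compact_oscillation (@cylinder_compact _ _ xc r1 d (ts / 2)) uc.
(* The four bounds serve h^2 <= h, the oscillation of [u], the size of the time grid and the
   capacity estimate. *)
pose e0 := Num.min (Num.min 1 (eta / 2)) (Num.min (ts / 2) (ts / r)).
have e00 : 0 < e0 by rewrite !lt_min ltr01 !divr_gt0.
(* An integer number of cubes, so that the lattice tiles the cube of radius [r1] exactly. *)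
pose K := (Num.truncn (r1 / e0)).+1.
pose h := r1 / K%:R.
have K0 : 0 < K%:R :> R by rewrite ltr0n.
have h0 : 0 < h by rewrite divr_gt0.
have Kh : K%:R * h = r1 by rewrite /h mulrCA mulfV ?mulr1// gt_eqF.
have he0 : h <= e0.
  by rewrite ler_pdivrMr// mulrC -ler_pdivrMr// ltW// truncnS_gt.
clearbody h.
have [ha hb hc hd] : [/\ h <= 1, h <= eta / 2, h <= ts / 2 & h <= ts / r].
  by move: he0; rewrite !le_min => /andP[/andP[-> ->] /andP[-> ->]].
have hh : h ^+ 2 <= h by rewrite expr2 ler_piMr// ltW.
have hh0 : 0 < h ^+ 2 by rewrite exprn_gt0.
have hts : r ^+ 2 * h ^+ 2 <= ts ^+ 2.
  rewrite -exprMn lerXn2r ?nnegrE ?mulr_ge0 ?(ltW r0) ?(ltW h0) ?(ltW ts0)//.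
  by rewrite mulrC -ler_pdivlMr.
pose k0 := Num.truncn ((ts / 2 - d) / h ^+ 2).
pose L := k0.+1.
have z0 : 0 <= (ts / 2 - d) / h ^+ 2 by rewrite divr_ge0 ?(ltW hh0)// subr_ge0 ltW.
have k0h : k0%:R * h ^+ 2 <= ts / 2 - d.
  by rewrite -ler_pdivlMr// truncn_le z0.
have lev_ge l : d <= level d h l by rewrite lerDl mulr_ge0 ?ler0n// ltW.
have lev_le l : (l < L)%N -> level d h l <= ts / 2.
  move=> lL; rewrite /level.
  have : l%:R * h ^+ 2 <= k0%:R * h ^+ 2 by rewrite ler_pM2r// ler_nat.
  by move: k0h; clear; lra.
pose I := ('I_L * {ffun 'I_n -> 'I_K})%type.
pose yb (b : I) : 'rV[R]_n := lattice_point xc h b.2.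
pose v (b : I) : R := u (yb b) (level d h b.1).
have ybn b : `|yb b - xc| <= r1 by rewrite -Kh; exact: lattice_norm.
have inA b : ([set y : 'rV[R]_n | `|y - xc| <= r1] `*` `[d, ts / 2]) (yb b, level d h b.1).
  by split => //=; rewrite in_itv/= lev_ge lev_le.
have v0 b : 0 <= v b.
  have [||] := uh (yb b) (level d h b.1) => //.
    by apply: le_trans (ybn b) _; move: r1r r0; clear; lra.
  have := lev_ge b.1; have := lev_le _ (ltn_ord b.1).
  by move: d0 dts ts0; clear; lra.
have oscb b (x : 'rV[R]_n) (s : R) : `|x - yb b| <= h -> `|s - level d h b.1| <= h ->
    `|v b - u x s| < 1.
  move=> xb sb; apply: (osc (yb b, level d h b.1) (x, s)) => //.
  have e2 : h < eta by move: hb eta0; clear; lra.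
  by split => /=; rewrite -ball_normE/= distrC; exact: le_lt_trans e2.
(* The boxes have radius 2 h and extend by h^2 before and after their tile in time: being open, they
   must still cover the tiles. The overlap costs the factor 3 4^n. *)
pose w := 3 * h ^+ 2.
have w0 : 0 < w by rewrite mulr_gt0.
have c0 b : 0 <= (v b + 1) `^ q by exact: powR_ge0.
have h20 : 0 < 2 * h by rewrite mulr_gt0.
apply: (@le_trans _ _ (sint (fun p : R * 'rV[R]_n => (\sum_(b : I) (v b + 1) `^ q *
    ((`|p.2 - yb b| < 2 * h) && (level d h b.1 - h ^+ 2 < p.1 < level d h b.1 - h ^+ 2 + w))%R%:R)%:E))).
  apply: sint_mono; first by move=> p; rewrite lee_fin mulr_ge0 ?powR_ge0.
  move=> [s x]; rewrite lee_fin.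
  have S0 (P : pred I) : 0 <= \sum_(b : I | P b) (v b + 1) `^ q *
      ((`|x - yb b| < 2 * h) && (level d h b.1 - h ^+ 2 < s < level d h b.1 - h ^+ 2 + w))%R%:R.
    by apply: sumr_ge0 => b _; rewrite mulr_ge0.
  have [/andP[/= xr /andP[ds st]]|_] := boolP ((`|(s, x).2 - xc| < r1) && _); last first.
    by rewrite mul0r S0.
  rewrite mul1r.
  have [f xf] : exists f : {ffun 'I_n -> 'I_K}, `|x - lattice_point xc h f| <= h.
    by apply: (@lattice_cover _ _ K); rewrite ?Kh.
  pose k := Num.truncn ((s - d) / h ^+ 2).
  have zz : 0 <= (s - d) / h ^+ 2 by rewrite divr_ge0 ?(ltW hh0)// subr_ge0 ltW.
  have kL : (k < L)%N.
    rewrite ltnS /k /k0; apply: le_truncn.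
    by rewrite ler_pM2r ?invr_gt0//; move: st; clear; lra.
  have ks : level d h k <= s < level d h k + h ^+ 2.
    have : k%:R * h ^+ 2 <= s - d by rewrite -ler_pdivlMr// truncn_le zz.
    have : s - d < k.+1%:R * h ^+ 2 by rewrite -ltr_pdivrMr// truncnS_gt.
    by rewrite /level -natr1 mulrDl mul1r; clear; lra.
  pose b : I := (Ordinal kL, f).
  rewrite (bigD1 b)//= ler_wpDr//.
  have -> : (`|x - yb b| < 2 * h) && (level d h k - h ^+ 2 < s < level d h k - h ^+ 2 + w) = true.
    rewrite (le_lt_trans xf); last by move: h0; clear; lra.
    by move: ks hh0; rewrite /w; clear; lra.
  rewrite mulr1.
  have sk : `|s - level d h k| <= h by rewrite ler_norml; move: ks hh h0; clear; lra.
  have := oscb b x s xf sk; rewrite ltr_norml => vb.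
  apply: ge0_ler_powR; rewrite ?nnegrE ?(ltW q0)//.
  - have [||//] := uh x s; first by move: xr r1r r0; clear; lra.
    by move: d0 ds st ts0; clear; lra.
  - by rewrite addr_ge0.
  - by move: vb; clear; lra.
rewrite sint_box_sum// lee_fin.
have -> : (2 * (2 * h)) ^+ n * w = h ^+ (n + 2) * (4 ^+ n * 3).
  have -> : 2 * (2 * h) = 4 * h by ring.
  by rewrite /w exprMn exprD; ring.
rewrite mulrA; apply: ler_wpM2r; first by rewrite mulr_ge0 ?exprn_ge0.
have A0 : 0 <= h ^+ (n + 2) by rewrite exprn_ge0// ltW.
apply: le_trans (dyadic_capacity_sum (pw := pw) (C0 := C0) q0 qpw A0 C00 v0 _) _.
  move=> j.
  pose ys (l : nat) := [seq lattice_point xc h f | f <- [seq f <- index_enum {ffun 'I_n -> 'I_K} |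
    2 ^+ j + 1 <= u (lattice_point xc h f) (level d h l)]].
  have j0 : 0 < 2 ^+ j :> R by rewrite exprn_gt0.
  have ysP l y : y \in ys l -> exists2 f : {ffun 'I_n -> 'I_K}, y = lattice_point xc h f &
      2 ^+ j + 1 <= u (lattice_point xc h f) (level d h l).
    by move=> /mapP[f]; rewrite mem_filter => /andP[fu _] ->; exists f.
  have Nys : \sum_(b : I) (2 ^+ j + 1 <= v b)%R%:R = (\sum_(0 <= l < L) size (ys l))%:R :> R.
    rewrite big_mkord natr_sum -(pair_bigA _ (fun (l : 'I_L) f => (2 ^+ j + 1 <= v (l, f))%R%:R))/=.
    apply: eq_bigr => l _; rewrite size_map size_filter natr_count.
    by apply: eq_bigr.
  rewrite Nys; set N := (\sum_(0 <= l < L) size (ys l))%:R : R.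
  have N0 : 0 <= N by exact: ler0n.
  have sep : separated_family xc r h L ys.
    move=> l lL; split.
    + rewrite map_inj_uniq; last exact: lattice_inj.
      by rewrite filter_uniq// index_enum_uniq.
    + move=> y /ysP[f -> _]; apply: le_trans (sqnorm_le_norm_sqr _) _.
      apply: le_trans nr1; rewrite ler_pM2l// distrC lerXn2r ?nnegrE ?(ltW r10)//.
      exact: (ybn (Ordinal lL, f)).
    + move=> y y' /ysP[f -> _] /ysP[g -> _] fg; apply: lattice_separated => //.
      by apply: contraNneq fg => ->.
  (* The centres where [u] is at least 2^j + 1 are those of cubes on which u > 2^j, by the choice of
     [eta]. *)
  have capN : 2 ^+ j * N `^ (n%:R / (n%:R + 2)) * h ^+ n <= C0.
    apply: (cap h d (2 ^+ j) ys L) => //; first by move: hh hc ts0; clear; lra.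
    move=> l x y lL /ysP[f -> fu] xf.
    have := oscb (Ordinal lL, f) x (level d h l) (ltW xf).
    rewrite subrr normr0 => /(_ (ltW h0)); rewrite ltr_norml /v/=.
    by move: fu; clear; lra.
  have n2 : n%:R + 2 != 0 :> R by rewrite gt_eqF// ltr_wpDl.
  have E : N * h ^+ (n + 2) = (N `^ (n%:R / (n%:R + 2)) * h ^+ n) `^ pw.
    rewrite powRM ?powR_ge0 ?exprn_ge0 ?(ltW h0)// -powRrM.
    have -> : n%:R / (n%:R + 2) * pw = 1 by rewrite /pw; field; rewrite n2 gt_eqF.
    rewrite powRr1//; congr (_ * _).
    rewrite -!powR_mulrn ?(ltW h0)// -powRrM; congr (_ `^ _).
    by rewrite /pw natrD; field; rewrite gt_eqF.
  rewrite E; apply: ge0_ler_powR; rewrite ?nnegrE ?(ltW pw0) ?mulr_ge0 ?powR_ge0 ?exprn_ge0 ?(ltW h0)//.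
  - exact: ltW.
  - by rewrite ler_pdivlMr// mulrC mulrA.
rewrite /B ler_wpM2l ?powR_ge0// lerD2r.
rewrite card_prod card_ord card_ffun !card_ord natrM natrX.
have -> : L%:R * K%:R ^+ n * h ^+ (n + 2) = (L%:R * h ^+ 2) * r1 ^+ n.
  by rewrite -Kh exprMn exprD; ring.
apply: ler_wpM2r; first by rewrite exprn_ge0 ?ltW.
rewrite /L -natr1 mulrDl mul1r; move: k0h hh hc d0; clear; lra.
Qed.

Lemma jcont_swap (R : realType) (n : nat) (u : 'rV[R]_n -> R -> R) (y : 'rV[R]_n) (s : R) :
  jcont u y s -> {for (s, y), continuous (fun p : R * 'rV[R]_n => u p.2 p.1)}.
Proof.
move=> uj.
have c1 : {for (s, y), continuous (fun p : R * 'rV[R]_n => p.1)} by exact: cvg_fst.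
have c2 : {for (s, y), continuous (fun p : R * 'rV[R]_n => p.2)} by exact: cvg_snd.
have c : {for (s, y), continuous (fun p : R * 'rV[R]_n => (p.2, p.1))} by exact: (cvg_pair c2 c1).
exact: (@continuous_comp _ _ _ (fun p : R * 'rV[R]_n => (p.2, p.1)) (fun p => u p.1 p.2) (s, y) c uj).
Qed.

Lemma lsc_powR_patch (R : realType) (n : nat) (u : 'rV[R]_n -> R -> R) (q : R)
    (B : R * 'rV[R]_n -> bool) : 0 < q -> open [set p | B p] ->
  (forall (s : R) (y : 'rV[R]_n), B (s, y) -> 0 <= u y s /\ jcont u y s) ->
  lower_semicontinuous (fun p : R * 'rV[R]_n => ((B p)%:R * u p.2 p.1 `^ q)%:E).
Proof.
move=> q0 oB uB; apply: lsc_patch => // [p _|[s y] Bp /= uq]; first exact: powR_ge0.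
have [u0 uj] := uB s y Bp.
apply: (@contAt_powR _ _ _ (fun p : R * 'rV[R]_n => u p.2 p.1)); last exact: jcont_swap.
exact: gt0_powR uq.
Qed.

Lemma lsc_indicM (R : realType) (T : topologicalType) (B : T -> bool) (F : T -> \bar R) :
  open [set x | B x] -> (forall x, 0 <= F x)%E -> lower_semicontinuous F ->
  lower_semicontinuous (fun x => ((B x)%:R)%:E * F x)%E.
Proof.
move=> oB F0 lF x a; have [Bx|Bx] := boolP (B x); last first.
  rewrite mul0e => a0; exists setT; first exact: filterT.
  move=> y _; apply: (lt_le_trans a0); exact: mule_ge0.
rewrite mul1e => /lF[V nV hV]; exists (V `&` [set x | B x]).
  by apply: filterI => //; exact: open_nbhs_nbhs.
by move=> y [/hV Vy /= ->]; rewrite mul1e.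
Qed.

(** This is lower semicontinuity at d = 0 of the integral over times after [d]: the indicator of d <
    s is lower semicontinuous jointly in (d, s). *)
Lemma sint_time_cut (R : realType) (n : nat) (F : R * 'rV[R]_n -> \bar R) (C : R) :
  (forall p, 0 <= F p)%E -> lower_semicontinuous F ->
  (C%:E < sint (fun p : R * 'rV[R]_n => ((0 < p.1)%R%:R)%:E * F p))%E ->
  exists2 e : R, 0 < e & forall d, 0 < d < e ->
    (C%:E < sint (fun p : R * 'rV[R]_n => ((d < p.1)%R%:R)%:E * F p))%E.
Proof.
move=> F0 lF CF.
pose f (z : (R * R) * 'rV[R]_n) : \bar R := (((z.1.1 < z.1.2)%R%:R)%:E * F (z.1.2, z.2))%E.
have f0 z : (0 <= f z)%E by exact: mule_ge0.
have cfst : continuous (fun z : (R * R) * 'rV[R]_n => z.1) by move=> [a b]; exact: cvg_fst.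
have c1 : continuous (fun z : (R * R) * 'rV[R]_n => z.1.1).
  by move=> z; apply: (continuous_comp (cfst z)); case: (z.1) => a b; exact: cvg_fst.
have c2 : continuous (fun z : (R * R) * 'rV[R]_n => z.1.2).
  by move=> z; exact: (continuous_comp (cfst z) (@snd_continuous _ _ _)).
have c3 : continuous (fun z : (R * R) * 'rV[R]_n => z.2) by exact: snd_continuous.
have lf : lower_semicontinuous f.
  apply: lsc_indicM => //; first exact: open_lt_fun.
  apply: (@lsc_comp _ _ _ (fun z : (R * R) * 'rV[R]_n => (z.1.2, z.2)) F) => // z.
  exact: (cvg_pair (c2 z) (c3 z)).
have lg : lower_semicontinuous (fun d : R => \int[@lebesgue_measure R]_s intRn (fun y => f ((d, s), y)))%E.
  apply: (@lsc_integral _ _ (fun w : R * R => intRn (fun y => f (w, y)))).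
    by move=> w; exact: intRn_ge0.
  exact: lsc_intRn.
have [V [e /= e0 eV] hV] := lg _ _ CF.
exists e => // d /andP[d0 de]; apply: hV; apply: eV.
by rewrite /= sub0r normrN gtr0_norm.
Qed.

(** The bound on times after [d] is uniform in [d], so [sint_time_cut] carries it to all positive
    times. *)
Lemma sint_powR_bound (R : realType) (n : nat) (u : 'rV[R]_n -> R -> R) (xc : 'rV[R]_n)
    (r ts r1 q : R) : (0 < n)%N -> 0 < r -> 0 < ts ->
  n%:R / 2 * (5 * ts) <= 4 * r ^+ 2 -> 10 * ts <= r ^+ 2 ->
  supersolution u xc (3 * r) ts ->
  0 < r1 -> n%:R * r1 ^+ 2 <= r ^+ 2 -> 0 < q -> n%:R * q < n%:R + 2 ->
  exists2 C : R, 0 <= C &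
    (sint (fun p : R * 'rV[R]_n =>
      (((`|p.2 - xc| < r1) && (0 < p.1 < ts / 2))%R%:R * u p.2 p.1 `^ q)%:E) <= C%:E)%E.
Proof.
move=> n0 r0 ts0 h1 h2 uh r10 nr1 q0 nq.
have [C C0 hC] := sint_powR_truncated n0 r0 ts0 h1 h2 uh r10 nr1 q0 nq.
exists C => //.
have r1r : r1 <= r.
  rewrite -(@ler_pXn2r _ 2)// ?nnegrE ?(ltW r10) ?(ltW r0)//; apply: le_trans nr1.
  by rewrite ler_peMl ?sqr_ge0// ler1n.
pose B (p : R * 'rV[R]_n) := (`|p.2 - xc| < r1) && (0 < p.1 < ts / 2).
pose F (p : R * 'rV[R]_n) : \bar R := ((B p)%:R * u p.2 p.1 `^ q)%:E.
have F0 p : (0 <= F p)%E by rewrite lee_fin mulr_ge0 ?powR_ge0.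
have lF : lower_semicontinuous F.
  apply: lsc_powR_patch => //; first exact: open_box.
  move=> s y /andP[/= yr sts].
  have [||u0 uj _] := uh y s; [|by move: sts ts0; clear; lra|by split].
  by move: yr r1r r0; clear; lra.
rewrite leNgt; apply/negP => CF.
have [|e e0 he] := sint_time_cut (C := C) F0 lF.
  apply: (lt_le_trans CF); apply: sint_mono => /= p; first exact: F0.
  by rewrite /F /B -EFinM lee_fin mulrA -natrM mulnb; case: (0 < p.1); rewrite ?andbF//= mul0r.
pose d := Num.min (e / 2) (ts / 4).
have d0 : 0 < d by rewrite lt_min !divr_gt0.
have dts : d < ts / 2.
  by apply: (@le_lt_trans _ _ (ts / 4)); [rewrite ge_min lexx orbT|move: ts0; clear; lra].
have de : d < e.
  by apply: (@le_lt_trans _ _ (e / 2)); [rewrite ge_min lexx|move: e0; clear; lra].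
have := hC d; rewrite d0 dts => /(_ isT); rewrite leNgt => /negP; apply.
have := he d; rewrite d0 de => /(_ isT) hd; apply: (lt_le_trans hd).
apply: sint_mono => /= p; first by exact: mule_ge0.
rewrite /F /B -EFinM lee_fin mulrA -natrM mulnb; apply: ler_wpM2r; first exact: powR_ge0.
by rewrite ler_nat; case: (_ < r1); case: (0 < p.1); case: (d < p.1); case: (p.1 < _).
Qed.

(** * The nonlocal term *)

Section KernelSplit.
Context {R : realType}.
Variable n : nat.

(** After extracting the power n/2, the case of large |x| is w e^(-w) <= 1 with w = |x|^2 / (2 n t);
    for large [t] the prefactor suffices. *)
Lemma heat_kernel_le (x : 'rV[R]_n) (t rho : R) : (0 < n)%N -> 0 < rho ->
  rho ^+ 2 <= sqnorm x \/ rho ^+ 2 <= t ->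
  heat_kernel x t <= (n%:R / rho ^+ 2) `^ (n%:R / 2).
Proof.
move=> n_gt0 rho0 far; rewrite /heat_kernel; case: ifPn => t0; last exact: powR_ge0.
have n0 : 0 < n%:R :> R by rewrite ltr0n.
have n1 : 1 <= n%:R :> R by rewrite ler1n.
have r20 : 0 < rho ^+ 2 by rewrite exprn_gt0.
have pi1 : 1 <= pi :> R by apply: le_trans (pi_ge2 R); rewrite ler1n.
have pt : 0 < 4 * pi * t by rewrite !mulr_gt0// pi_gt0.
pose E : R := expR (- (sqnorm x / (4 * t)) / (n%:R / 2)).
have a0 : 0 < n%:R / 2 :> R by rewrite divr_gt0.
have -> : expR (- (sqnorm x / (4 * t))) = E `^ (n%:R / 2).
  by rewrite /E -expRM; congr expR; field; rewrite !gt_eqF.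
have -> : (4 * pi * t) `^ (- (n%:R / 2)) = ((4 * pi * t)^-1) `^ (n%:R / 2).
  by rewrite -[(4 * pi * t)^-1]powR_inv1 ?(ltW pt)// -powRrM mulN1r.
have pt' : 0 < (4 * pi * t)^-1 by rewrite invr_gt0.
rewrite -powRM ?expR_ge0 ?(ltW pt')//.
apply: ge0_ler_powR; rewrite ?nnegrE ?(ltW a0)//.
- by rewrite mulr_ge0 ?expR_ge0// ltW.
- by rewrite divr_ge0 ?ltW.
rewrite mulrC ler_pdivrMr// mulrAC ler_pdivlMr//.
have tp : t <= pi * t by rewrite ler_peMl// ltW.
case: far => far; last first.
  have E1 : E <= 1.
    rewrite -[leRHS]expR0 ler_expR mulNr oppr_le0 !mulr_ge0 ?invr_ge0 ?sqnorm_ge0 ?mulr_ge0 ?ltW//.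
  apply: (@le_trans _ _ (1 * (4 * pi * t))).
    by apply: ler_pM; rewrite ?expR_ge0 ?(ltW r20)//; move: far tp; clear -t0; lra.
  by rewrite ler_wpM2r// ltW.
have sx : 0 < sqnorm x by apply: lt_le_trans far.
have E1 : E * sqnorm x <= 2 * n%:R * t.
  pose w := sqnorm x / (4 * t) / (n%:R / 2).
  have w0 : 0 < w by rewrite !divr_gt0 ?mulr_gt0.
  have -> : E = (expR w)^-1 by rewrite -expRN /E /w mulNr.
  have -> : sqnorm x = w * (2 * n%:R * t) by rewrite /w; field; rewrite !gt_eqF.
  rewrite mulrA ler_piMl ?mulr_ge0 ?(ltW n0) ?(ltW t0)// mulrC ler_pdivrMr ?expR_gt0// mul1r.
  by apply: le_trans (expR_ge1Dx _); rewrite lerDr.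
apply: (@le_trans _ _ (E * sqnorm x)); first by rewrite ler_wpM2l ?expR_ge0.
apply: (le_trans E1).
have -> : 2 * n%:R * t = n%:R * (2 * t) by ring.
by rewrite ler_wpM2l ?(ltW n0)//; move: tp t0; clear; lra.
Qed.

Lemma heat_kernel_ge0 (x : 'rV[R]_n) (t : R) : 0 <= heat_kernel x t.
Proof. by rewrite /heat_kernel; case: ifP => // _; rewrite mulr_ge0 ?powR_ge0 ?expR_ge0. Qed.

(** A crude Young inequality: both sides are compared with a power of the larger of [a] and [b]. It
    separates the kernel from [u] when neither is bounded. *)
Lemma powR_mulS_le (a b g l : R) : 0 <= a -> 0 <= b -> 0 <= g -> 0 < l ->
  a `^ g * b `^ l <= a `^ (l + g) + b `^ (l + g).
Proof.
move=> a0 b0 g0 l0.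
have lg0 : l + g != 0 by rewrite gt_eqF// ltr_pwDl.
have E (c : R) : c `^ (l + g) = c `^ g * c `^ l.
  rewrite powRD; first by rewrite mulrC.
  by rewrite (negbTE lg0).
have [ab|/ltW ba] := leP a b.
  apply: (@le_trans _ _ (b `^ (l + g))); last by rewrite lerDr powR_ge0.
  by rewrite E ler_wpM2r ?powR_ge0// ge0_ler_powR.
apply: (@le_trans _ _ (a `^ (l + g))); last by rewrite lerDl powR_ge0.
by rewrite E ler_wpM2l ?powR_ge0// ge0_ler_powR// ltW.
Qed.

(** Away from (x, t) only the power (alpha - gam)/n of the kernel is bounded by its size at distance
    [rho]; the remaining power gam/n stays under the integral. [Psi] is abstract because the two
    ranges of [lam] majorize that integrand differently, and it is lower semicontinuous so that the
    integral is additive. *)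
Lemma kernel_integral_split (u : 'rV[R]_n -> R -> R) (T alpha lam gam : R)
    (Psi : R * 'rV[R]_n -> \bar R) (x : 'rV[R]_n) (t rho B : R) :
  (0 < n)%N -> 0 < alpha < n%:R + 2 -> 0 < lam -> 0 <= gam <= alpha -> 0 < rho -> 0 <= B ->
  (forall (y : 'rV[R]_n) (s : R), 0 < s < T -> 0 <= u y s) ->
  (forall (y : 'rV[R]_n) (s : R), 0 < s < T -> `|y - x| <= rho -> t - rho ^+ 2 < s < t -> u y s <= B) ->
  (forall p, 0 <= Psi p)%E -> lower_semicontinuous Psi ->
  (forall (y : 'rV[R]_n) (s : R), 0 < s < T -> s < t ->
    ((heat_kernel (x - y) (t - s) `^ (gam / n%:R) * u y s `^ lam)%:E <= Psi (s, y))%E) ->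
  (int_strip T (fun y s => (heat_kernel (x - y) (t - s) `^ (alpha / n%:R) * u y s `^ lam)%:E) <=
   (B `^ lam * ((alpha / n%:R) `^ (- (n%:R / 2)) * (4 * pi) `^ ((n%:R - alpha) / 2) *
      ((rho ^+ 2) `^ ((n%:R + 2 - alpha) / 2) / ((n%:R + 2 - alpha) / 2))))%:E +
   ((n%:R / rho ^+ 2) `^ ((alpha - gam) / 2))%:E * sint Psi)%E.
Proof.
move=> n_gt0 /andP[al0 aln] lam0 /andP[g0 ga] rho0 B0 u0 uB Psi0 lPsi uPsi.
have n0 : 0 < n%:R :> R by rewrite ltr0n.
have r20 : 0 < rho ^+ 2 by rewrite exprn_gt0.
pose q := alpha / n%:R : R.
have q0 : 0 < q by rewrite divr_gt0.
have nq : n%:R * q = alpha by rewrite /q; field; rewrite gt_eqF.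
pose K : R := (n%:R / rho ^+ 2) `^ ((alpha - gam) / 2).
pose G (p : R * 'rV[R]_n) : \bar R := ((t - rho ^+ 2 < p.1 < t)%R%:R * kernel_pow q x t p)%:E.
have G0 p : (0 <= G p)%E by rewrite lee_fin mulr_ge0 ?kernel_pow_ge0.
have lG : lower_semicontinuous G by exact: lsc_kernel.
have Bl0 : 0 <= B `^ lam by exact: powR_ge0.
have K0 : 0 <= K by exact: powR_ge0.
have BG0 p : (0 <= (B `^ lam)%:E * G p)%E by rewrite mule_ge0.
have KP0 p : (0 <= K%:E * Psi p)%E by rewrite mule_ge0.
have lBG : lower_semicontinuous (fun p => (B `^ lam)%:E * G p)%E by exact: lscZ.
have lKP : lower_semicontinuous (fun p => K%:E * Psi p)%E by exact: lscZ.
apply: (@le_trans _ _ (sint (fun p => (B `^ lam)%:E * G p + K%:E * Psi p)%E)).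
  apply: int_strip_le => [p|y s sT]; first exact: adde_ge0.
  apply/andP; split; first by rewrite lee_fin mulr_ge0 ?powR_ge0.
  have [st|ts] := ltP s t; last first.
    (* At times after [t] the kernel is 0, and its power is 0 because the exponent is nonzero. *)
    rewrite /heat_kernel subr_gt0 ltNge ts/= powR0; last by rewrite gt_eqF.
    by rewrite mul0r adde_ge0.
  have [|far] := boolP ((`|y - x| <= rho) && (t - rho ^+ 2 < s)).
    move=> /andP[yx ts].
    apply: (@le_trans _ _ ((B `^ lam)%:E * G (s, y))%E); last by rewrite leeDl.
    rewrite /G/= ts st mul1r heat_kernel_powR// -EFinM lee_fin mulrC.
    rewrite ler_wpM2r ?kernel_pow_ge0// ge0_ler_powR ?nnegrE ?(ltW lam0) ?u0//.
    by apply: uB; rewrite ?ts ?st.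
  apply: (@le_trans _ _ (K%:E * Psi (s, y))%E); last by rewrite leeDr.
  have far' : heat_kernel (x - y) (t - s) <= (n%:R / rho ^+ 2) `^ (n%:R / 2).
    apply: heat_kernel_le => //.
    move: far; rewrite negb_and -!ltNge -leNgt => /orP[yx|ts]; [left|right].
      apply: le_trans (norm_sqr_le_sqnorm _); rewrite distrC.
      by rewrite lerXn2r ?nnegrE ?(ltW rho0)// ltW.
    by move: ts; clear; lra.
  have -> : alpha / n%:R = (alpha - gam) / n%:R + gam / n%:R by field; rewrite gt_eqF.
  have k0 := heat_kernel_ge0 (x - y) (t - s).
  rewrite powRD; last first.
    have -> : (alpha - gam) / n%:R + gam / n%:R = q by rewrite /q; field; rewrite gt_eqF.
    by rewrite gt_eqF.
  have Kk : heat_kernel (x - y) (t - s) `^ ((alpha - gam) / n%:R) <= K.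
    have -> : K = ((n%:R / rho ^+ 2) `^ (n%:R / 2)) `^ ((alpha - gam) / n%:R).
      by rewrite /K -powRrM; congr (_ `^ _); field; rewrite gt_eqF.
    rewrite ge0_ler_powR ?nnegrE ?powR_ge0//.
    by rewrite divr_ge0 ?(ltW n0)// subr_ge0.
  rewrite -mulrA EFinM.
  apply: (@le_trans _ _ (K%:E * (heat_kernel (x - y) (t - s) `^ (gam / n%:R) * u y s `^ lam)%:E)%E).
    by apply: lee_wpmul2r; rewrite lee_fin// mulr_ge0 ?powR_ge0.
  by apply: lee_wpmul2l; rewrite ?lee_fin// uPsi.
rewrite sintD// !sintZ//; apply: leeD2r.
rewrite EFinM; apply: lee_wpmul2l; first by rewrite lee_fin.
apply: le_trans (sint_kernel_le x t r20 q0 _) _; first by rewrite nq.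
have -> : n%:R * (1 - q) / 2 = (n%:R - alpha) / 2 by rewrite -nq; ring.
by have -> : (n%:R - alpha) / 2 + 1 = (n%:R + 2 - alpha) / 2 by field.
Qed.

End KernelSplit.

(** * Bounds of the nonlocal term at scale [rho] *)

Section NonlocalBound.
Context {R : realType}.

(* [gam] is the part of the kernel's singularity that is absorbed by the
   integrability of [u]. *)
Definition nonlocal_bound (n : nat) (u : 'rV[R]_n -> R -> R) (T alpha lam gam A : R) (X : 'rV[R]_n -> R -> Prop) :=
  forall (x : 'rV[R]_n) (t rho B : R), X x t -> 0 < rho -> 0 <= B ->
  (forall (y : 'rV[R]_n) (s : R), 0 < s < T -> `|y - x| <= rho -> t - rho ^+ 2 < s < t -> u y s <= B) ->
  (int_strip T (fun y s => (heat_kernel (x - y) (t - s) `^ (alpha / n%:R) * u y s `^ lam)%:E) <=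
   (A * (B `^ lam * (rho ^+ 2) `^ ((n%:R + 2 - alpha) / 2) + (rho ^+ 2) `^ (- ((alpha - gam) / 2))))%:E)%E.

Lemma nonlocal_bound_of_majorant (n : nat) (u : 'rV[R]_n -> R -> R) (T alpha lam gam D : R)
    (X : 'rV[R]_n -> R -> Prop) :
  (0 < n)%N -> 0 < alpha < n%:R + 2 -> 0 < lam -> 0 <= gam <= alpha -> 0 <= D ->
  (forall (y : 'rV[R]_n) (s : R), 0 < s < T -> 0 <= u y s) ->
  (forall (x : 'rV[R]_n) (t : R), X x t -> exists Psi : R * 'rV[R]_n -> \bar R,
    [/\ (forall p, 0 <= Psi p)%E, lower_semicontinuous Psi,
      (forall (y : 'rV[R]_n) (s : R), 0 < s < T -> s < t ->
       ((heat_kernel (x - y) (t - s) `^ (gam / n%:R) * u y s `^ lam)%:E <= Psi (s, y))%E) &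
      (sint Psi <= D%:E)%E]) ->
  exists2 A, 0 <= A & nonlocal_bound u T alpha lam gam A X.
Proof.
move=> n_gt0 al lam0 ga D0 u0 hX.
have n0 : 0 < n%:R :> R by rewrite ltr0n.
have e0 : 0 < (n%:R + 2 - alpha) / 2.
  by rewrite divr_gt0// subr_gt0; case/andP: al.
pose C1 : R := (alpha / n%:R) `^ (- (n%:R / 2)) * (4 * pi) `^ ((n%:R - alpha) / 2) / ((n%:R + 2 - alpha) / 2).
pose C2 : R := n%:R `^ ((alpha - gam) / 2) * D.
have C10 : 0 <= C1 by rewrite /C1 divr_ge0 ?(ltW e0)// mulr_ge0 ?powR_ge0.
have C20 : 0 <= C2 by rewrite /C2 mulr_ge0 ?powR_ge0.
exists (C1 + C2); first exact: addr_ge0.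
move=> x t rho B Xx rho0 B0 uB.
have [Psi [P0 lP uP PD]] := hX x t Xx.
apply: le_trans (kernel_integral_split n_gt0 al lam0 ga rho0 B0 u0 uB P0 lP uP) _.
have r20 : 0 < rho ^+ 2 by rewrite exprn_gt0.
set Y := (rho ^+ 2) `^ ((n%:R + 2 - alpha) / 2).
set Z := (rho ^+ 2) `^ (- ((alpha - gam) / 2)).
have Y0 : 0 <= Y by exact: powR_ge0.
have Z0 : 0 <= Z by exact: powR_ge0.
have -> : (n%:R / rho ^+ 2) `^ ((alpha - gam) / 2) = n%:R `^ ((alpha - gam) / 2) * Z.
  rewrite powRM ?(ltW n0) ?invr_ge0 ?(ltW r20)//; congr (_ * _).
  by rewrite -[(rho ^+ 2)^-1]powR_inv1 ?(ltW r20)// -powRrM mulN1r.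
apply: (@le_trans _ _ ((B `^ lam * ((alpha / n%:R) `^ (- (n%:R / 2)) * (4 * pi) `^ ((n%:R - alpha) / 2) *
     (Y / ((n%:R + 2 - alpha) / 2))))%:E + (n%:R `^ ((alpha - gam) / 2) * Z)%:E * D%:E)%E).
  by apply: leeD2l; apply: lee_wpmul2l => //; rewrite lee_fin mulr_ge0 ?powR_ge0.
rewrite -EFinM -EFinD lee_fin.
have -> : B `^ lam * ((alpha / n%:R) `^ (- (n%:R / 2)) * (4 * pi) `^ ((n%:R - alpha) / 2) *
     (Y / ((n%:R + 2 - alpha) / 2))) + n%:R `^ ((alpha - gam) / 2) * Z * D = C1 * (B `^ lam * Y) + C2 * Z.
  by rewrite /C1 /C2; ring.
rewrite mulrDr; apply: lerD; apply: ler_wpM2r; rewrite ?lerDl ?lerDr//.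
by rewrite mulr_ge0 ?powR_ge0.
Qed.

Lemma lsc_strip_powR (n : nat) (u : 'rV[R]_n -> R -> R) (T a b q : R) : 0 < q -> 0 <= a -> b <= T ->
  (forall (y : 'rV[R]_n) (s : R), 0 < s < T -> 0 <= u y s) ->
  (forall (y : 'rV[R]_n) (s : R), 0 < s < T -> jcont u y s) ->
  lower_semicontinuous (fun p : R * 'rV[R]_n => ((a < p.1 < b)%R%:R * u p.2 p.1 `^ q)%:E).
Proof.
move=> q0 a0 bT u0 uj.
apply: (@lsc_powR_patch _ _ u q (fun p : R * 'rV[R]_n => a < p.1 < b)) => //; first exact: open_strip.
move=> s y /= sab; have sT : 0 < s < T by move: sab a0 bT; clear; lra.
by split; [exact: u0|exact: uj].
Qed.

(** With gam = 0 the whole kernel is bounded far away, and [Psi] is u^lam on the strip. *)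
Lemma nonlocal_bound_integrable (n : nat) (u : 'rV[R]_n -> R -> R) (T alpha lam : R) :
  (0 < n)%N -> 0 < alpha < n%:R + 2 -> 0 < lam ->
  (forall (y : 'rV[R]_n) (s : R), 0 < s < T -> 0 <= u y s) ->
  (forall (y : 'rV[R]_n) (s : R), 0 < s < T -> jcont u y s) ->
  (int_strip T (fun y s => (u y s `^ lam)%:E) < +oo)%E ->
  exists2 A, 0 <= A & nonlocal_bound u T alpha lam 0 A (fun _ _ => True).
Proof.
move=> n_gt0 al lam0 u0 uj uI.
have I0 : (0 <= int_strip T (fun y s => (u y s `^ lam)%:E))%E.
  by apply: integral_ge0 => s _; apply: intRn_ge0 => y; rewrite lee_fin powR_ge0.
apply: (@nonlocal_bound_of_majorant _ _ _ _ _ 0 (fine (int_strip T (fun y s => (u y s `^ lam)%:E)))) => //.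
- by rewrite lexx/= ltW; case/andP: al.
- exact: fine_ge0.
move=> x t _.
exists (fun p : R * 'rV[R]_n => ((0 < p.1 < T)%R%:R * u p.2 p.1 `^ lam)%:E); split.
- by move=> p; rewrite lee_fin mulr_ge0 ?powR_ge0.
- exact: lsc_strip_powR.
- by move=> y s /= sT st; rewrite sT !mul0r powRr0.
rewrite (sint_patch_strip T (fun p : R * 'rV[R]_n => u p.2 p.1 `^ lam))/= fineK//.
by rewrite ge0_fin_numE.
Qed.

(** Where |y - xc| < r1, [powR_mulS_le] leaves the powers q = lam + gam/n of the kernel and of [u],
    both integrable since n q < n + 2. Elsewhere y is at distance at least r1/2 from x, so the
    kernel is bounded and u^lam is integrable. *)
Lemma nonlocal_bound_local (n : nat) (u : 'rV[R]_n -> R -> R) (T alpha lam : R)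
    (xc : 'rV[R]_n) (r1 tau gam C : R) : (0 < n)%N ->
  0 < alpha < n%:R + 2 -> 0 < lam -> 0 <= gam <= alpha -> lam * n%:R + gam < n%:R + 2 ->
  (forall (y : 'rV[R]_n) (s : R), 0 < s < T -> 0 <= u y s) ->
  (forall (y : 'rV[R]_n) (s : R), 0 < s < T -> jcont u y s) ->
  (int_strip T (fun y s => (u y s `^ lam)%:E) < +oo)%E ->
  0 < r1 -> 0 < tau <= T ->
  (sint (fun p : R * 'rV[R]_n =>
      (((`|p.2 - xc| < r1) && (0 < p.1 < tau))%R%:R * u p.2 p.1 `^ (lam + gam / n%:R))%:E) <= C%:E)%E ->
  exists2 A, 0 <= A & nonlocal_bound u T alpha lam gam A (fun x t => `|x - xc| <= r1 / 2 /\ 0 < t < tau).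
Proof.
move=> n_gt0 al lam0 ga lg u0 uj uI r10 /andP[tau0 tauT] uC.
have n0 : 0 < n%:R :> R by rewrite ltr0n.
have T0 : 0 < T by apply: lt_le_trans tauT.
have [al0 al1] := andP al; have [g0 ga1] := andP ga.
pose q := lam + gam / n%:R.
have q0 : 0 < q by rewrite ltr_pwDl// divr_ge0// ltW.
have nq : n%:R * q < n%:R + 2.
  by have -> : n%:R * q = lam * n%:R + gam by rewrite /q; field; rewrite gt_eqF.
have I0 : (0 <= int_strip T (fun y s => (u y s `^ lam)%:E))%E.
  by apply: integral_ge0 => s _; apply: intRn_ge0 => y; rewrite lee_fin powR_ge0.
set I1 := int_strip T (fun y s => (u y s `^ lam)%:E) in uI I0.
have I1f : (fine I1)%:E = I1 by rewrite fineK// ge0_fin_numE.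
pose D1 := q `^ (- (n%:R / 2)) * (4 * pi) `^ (n%:R * (1 - q) / 2) *
   (T `^ (n%:R * (1 - q) / 2 + 1) / (n%:R * (1 - q) / 2 + 1)).
pose C' := ((n%:R / (r1 / 2) ^+ 2) `^ (n%:R / 2)) `^ (gam / n%:R).
have C'0 : 0 <= C' by exact: powR_ge0.
pose G x t (p : R * 'rV[R]_n) : \bar R := ((t - T < p.1 < t)%R%:R * kernel_pow q x t p)%:E.
pose H (p : R * 'rV[R]_n) : \bar R :=
  (((`|p.2 - xc| < r1) && (0 < p.1 < tau))%R%:R * u p.2 p.1 `^ q)%:E.
pose W (p : R * 'rV[R]_n) : \bar R := ((0 < p.1 < T)%R%:R * u p.2 p.1 `^ lam)%:E.
have G0 x t p : (0 <= G x t p)%E by rewrite lee_fin mulr_ge0 ?kernel_pow_ge0.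
have H0 p : (0 <= H p)%E by rewrite lee_fin mulr_ge0 ?powR_ge0.
have W0 p : (0 <= W p)%E by rewrite lee_fin mulr_ge0 ?powR_ge0.
have lG x t : lower_semicontinuous (G x t) by exact: lsc_kernel.
have lH : lower_semicontinuous H.
  apply: lsc_powR_patch => //; first exact: open_box.
  move=> s y /andP[_ /= st]; have sT : 0 < s < T by move: st tauT; clear; lra.
  by split; [exact: u0|exact: uj].
have lW : lower_semicontinuous W by exact: lsc_strip_powR.
have CW0 p : (0 <= C'%:E * W p)%E by rewrite mule_ge0.
have lCW : lower_semicontinuous (fun p => C'%:E * W p)%E by exact: lscZ.
have GG0 x t p : (0 <= G x t p + H p)%E by rewrite adde_ge0.
have lGG x t : lower_semicontinuous (fun p => G x t p + H p)%E by exact: lscD.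
apply: (@nonlocal_bound_of_majorant _ _ _ _ _ gam (Num.max 0 (D1 + C + C' * fine I1))) => //.
  by rewrite le_max lexx.
move=> x t [xr /andP[t0 tt]].
exists (fun p => G x t p + H p + C'%:E * W p)%E; split.
- by move=> p; rewrite adde_ge0.
- exact: lscD.
- move=> y s sT st.
  have k0 := heat_kernel_ge0 (x - y) (t - s).
  have us := u0 y s sT.
  have [yr|yr] := ltP `|y - xc| r1.
    apply: (@le_trans _ _ (G x t (s, y) + H (s, y))%E); last by rewrite leeDl.
    have -> : H (s, y) = (u y s `^ q)%:E.
      rewrite /H/= yr; have -> : 0 < s < tau by move: sT st tt; clear; lra.
      by rewrite mul1r.
    have -> : G x t (s, y) = (heat_kernel (x - y) (t - s) `^ q)%:E.
      rewrite /G/= heat_kernel_powR//; have -> : t - T < s < t by move: sT st tt tauT; clear; lra.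
      by rewrite mul1r.
    rewrite -EFinD lee_fin; apply: powR_mulS_le => //.
    by rewrite divr_ge0// ltW.
  apply: (@le_trans _ _ (C'%:E * W (s, y))%E); last by rewrite leeDr.
  rewrite /W/= sT mul1r -EFinM lee_fin ler_wpM2r ?powR_ge0//.
  rewrite ge0_ler_powR ?nnegrE ?powR_ge0//; first by rewrite divr_ge0// ltW.
  apply: heat_kernel_le => //; first by rewrite divr_gt0.
  left; apply: le_trans (norm_sqr_le_sqnorm _).
  rewrite lerXn2r ?nnegrE ?divr_ge0 ?(ltW r10)//.
  have := ler_normB (x - xc) (x - y); rewrite opprB addrC subrKA => h.
  by move: h yr xr; clear; lra.
rewrite !sintD// sintZ//.
apply: (@le_trans _ _ (D1%:E + C%:E + C'%:E * I1)%E).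
  apply: leeD; last first.
    by rewrite /W (sint_patch_strip T (fun p : R * 'rV[R]_n => u p.2 p.1 `^ lam)).
  by apply: leeD => //; exact: sint_kernel_le.
by rewrite -I1f -EFinM -!EFinD lee_fin le_max lexx orbT.
Qed.

End NonlocalBound.

(** * Concentration at large values *)

Section Doubling.
Context {R : realType}.

Lemma contAt_max (T : topologicalType) (p : T) (f g : T -> R) :
  {for p, continuous f} -> {for p, continuous g} ->
  {for p, continuous (fun x => Num.max (f x) (g x))}.
Proof. by move=> cf cg; exact: (@continuous_max R T f g p cf cg). Qed.

Lemma contAt_min (T : topologicalType) (p : T) (f g : T -> R) :
  {for p, continuous f} -> {for p, continuous g} ->
  {for p, continuous (fun x => Num.min (f x) (g x))}.
Proof.
move=> cf cg.
have -> : (fun x => Num.min (f x) (g x)) = (fun x => f x + g x - Num.max (f x) (g x)).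
  by apply/funext => x; rewrite minEle maxEle; case: ifP => _; ring.
by apply: contAtB; [exact: contAtD|exact: contAt_max].
Qed.

Lemma ltr_powR_cancel (a b e : R) : 0 < e -> 0 <= a -> 0 <= b -> a `^ e < b `^ e -> a < b.
Proof.
move=> e0 a0 b0; apply: contraTT; rewrite -!leNgt => ba.
by apply: ge0_ler_powR; rewrite ?nnegrE// ltW.
Qed.

Lemma ler_powR_root (a b e : R) : 0 < e -> 0 <= a -> 0 <= b -> a `^ e <= b -> a <= b `^ e^-1.
Proof.
move=> e0 a0 b0 h.
have -> : a = (a `^ e) `^ e^-1 by rewrite -powRrM mulfV ?gt_eqF// powRr1.
by apply: ge0_ler_powR; rewrite ?nnegrE ?powR_ge0// invr_ge0 ltW.
Qed.

(* Using [max u 1] instead of [u] keeps the power continuous where [u] vanishes;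
   the smallness of [d] forces the maximum to be attained where [u > 1]. *)
Lemma doubling_point (n : nat) (u : 'rV[R]_n -> R -> R) (x0 : 'rV[R]_n) (d theta kappa : R) :
  0 < d -> 0 < theta -> 0 < kappa -> d ^+ 2 <= 32 * kappa ^+ 2 ->
  (forall (x : 'rV[R]_n) (t : R), `|x - x0| <= d -> d ^+ 2 / 2 <= t <= d ^+ 2 ->
    0 <= u x t /\ jcont u x t) ->
  32 * kappa ^+ 2 < u x0 (d ^+ 2) `^ (2 * theta) * d ^+ 2 ->
  exists x1 t1 M rho, [/\ u x1 t1 = M /\ 0 < M, rho = kappa * M `^ (- theta),
    32 * kappa ^+ 2 < M `^ (2 * theta) * d ^+ 2,
    `|x1 - x0| + 4 * rho <= d /\ d ^+ 2 / 2 + 16 * rho ^+ 2 <= t1 <= d ^+ 2 &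
    forall (y : 'rV[R]_n) (s : R), `|y - x1| <= 2 * rho -> t1 - 2 * rho ^+ 2 <= s <= t1 ->
      u y s <= 4 `^ (2 * theta)^-1 * M].
Proof.
move=> d0 th0 ka0 dka uc big.
have d20 : 0 < d ^+ 2 by rewrite exprn_gt0.
have th20 : 0 < 2 * theta by rewrite mulr_gt0.
have ka20 : 0 < kappa ^+ 2 by rewrite exprn_gt0.
pose V x t := Num.max (u x t) 1.
have V1 x t : 1 <= V x t by rewrite le_max lexx orbT.
(* Squared parabolic distance to the lateral boundary and the bottom. *)
pose m x t := Num.min ((d - `|x - x0|) ^+ 2) (t - d ^+ 2 / 2).
pose F (p : 'rV[R]_n * R) := V p.1 p.2 `^ (2 * theta) * m p.1 p.2.
pose A : set ('rV[R]_n * R) := [set y : 'rV[R]_n | `|y - x0| <= d] `*` `[d ^+ 2 / 2, d ^+ 2].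
have cF0 (x : 'rV[R]_n) (t : R) : `|x - x0| <= d -> d ^+ 2 / 2 <= t <= d ^+ 2 ->
    {for (x, t), continuous F}.
  move=> xd td; have [u0 uj] := uc x t xd td.
  apply: (@contAtM _ _ _ (fun p : 'rV[R]_n * R => V p.1 p.2 `^ (2 * theta)) (fun p => m p.1 p.2)).
    apply: (@contAt_powR _ _ _ (fun p : 'rV[R]_n * R => V p.1 p.2)).
      by rewrite /= (lt_le_trans ltr01).
    by apply: contAt_max; [exact: uj|exact: contAtC].
  have c1 : {for (x, t), continuous (fun p : 'rV[R]_n * R => p.1)} by exact: cvg_fst.
  have c2 : {for (x, t), continuous (fun p : 'rV[R]_n * R => p.2)} by exact: cvg_snd.
  have c3 : {for (x, t), continuous (fun p : 'rV[R]_n * R => d - `|p.1 - x0|)}.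
    apply: contAtB; first exact: contAtC.
    exact: (continuous_comp c1 (@continuous_norm_sub _ _ x0 _)).
  apply: contAt_min; first by apply: contAtM.
  by apply: contAtB; [exact: c2|exact: contAtC].
have cF : {within A, continuous F}.
  apply: continuous_in_subspaceT => -[x t]; rewrite inE => -[/= xd]; rewrite in_itv/=.
  exact: cF0.
have A0 : A (x0, d ^+ 2).
  by split => /=; [rewrite subrr normr0 ltW|rewrite in_itv/= lexx andbT; move: d20; clear; lra].
have [[x1 t1]] := compact_EVT_max (ex_intro _ _ A0) (@cylinder_compact _ _ _ _ _ _) cF.
rewrite inE => -[/= x1d]; rewrite in_itv/= => t1d Fmax.
(* At the centre of the top [m] is d^2/2, which turns 32 into 16; since M^(2 theta) rho^2 = kappa^2,
   this puts the maximum point farther than 4 rho from the boundary. *)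
have F1 : 16 * kappa ^+ 2 < F (x1, t1).
  apply: lt_le_trans (Fmax _ (mem_set A0)); rewrite /F /m/= subrr normr0 subr0.
  have -> : Num.min (d ^+ 2) (d ^+ 2 - d ^+ 2 / 2) = d ^+ 2 / 2.
    by rewrite min_r; move: d20; clear; lra.
  have u0 : 0 <= u x0 (d ^+ 2).
    have [] // := uc x0 (d ^+ 2); first by rewrite subrr normr0 ltW.
    by rewrite lexx andbT; move: d20; clear; lra.
  apply: (@lt_le_trans _ _ (u x0 (d ^+ 2) `^ (2 * theta) * (d ^+ 2 / 2))).
    by rewrite mulrA ltr_pdivlMr//; move: big; clear; lra.
  apply: ler_wpM2r; first by rewrite divr_ge0 ?ltW.
  apply: ge0_ler_powR; rewrite ?nnegrE ?(ltW th20)//; last by rewrite le_max lexx.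
  exact: le_trans (V1 _ _).
set m1 := m x1 t1.
rewrite /F/= -/m1 in F1.
have m1d : m1 <= d ^+ 2 / 2.
  by apply: (@le_trans _ _ (t1 - d ^+ 2 / 2)); [rewrite ge_min lexx orbT|move: t1d; clear; lra].
have Vp x t : 0 < V x t `^ (2 * theta) by rewrite powR_gt0// (lt_le_trans ltr01).
have VQ : 32 * kappa ^+ 2 < V x1 t1 `^ (2 * theta) * d ^+ 2.
  have : V x1 t1 `^ (2 * theta) * m1 <= V x1 t1 `^ (2 * theta) * (d ^+ 2 / 2) by rewrite ler_pM2l.
  by move: F1; clear; lra.
have [M1|M1] := leP (u x1 t1) 1.
  exfalso; move: VQ; rewrite /V max_r// powR1 mul1r => VQ.
  by move: VQ dka; clear; lra.
have VM : V x1 t1 = u x1 t1 by rewrite /V max_l// ltW.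
set M := u x1 t1 in M1 VM.
have M0 : 0 < M by exact: lt_trans M1.
rewrite VM in F1 VQ.
set Q := M `^ (2 * theta) in F1 VQ.
have Q0 : 0 < Q by rewrite powR_gt0.
pose rho := kappa * M `^ (- theta).
have rho0 : 0 < rho by rewrite mulr_gt0 ?powR_gt0.
have Qrho : Q * rho ^+ 2 = kappa ^+ 2.
  have -> : Q = M `^ theta ^+ 2.
    by rewrite /Q -powR_mulrn ?powR_ge0// -powRrM mulrC.
  rewrite /rho powRN; field; rewrite gt_eqF// powR_gt0//.
have m1rho : 16 * rho ^+ 2 < m1.
  by rewrite -(ltr_pM2l Q0) mulrCA Qrho.
have [m1a m1b] : m1 <= (d - `|x1 - x0|) ^+ 2 /\ m1 <= t1 - d ^+ 2 / 2.
  by split; rewrite ge_min lexx ?orbT.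
have D4 : 4 * rho < d - `|x1 - x0|.
  have r4 : 0 <= 4 * rho by move: rho0; clear; lra.
  rewrite -(@ltr_pXn2r _ 2)// ?nnegrE ?subr_ge0//.
  by rewrite exprMn; apply: lt_le_trans m1a; move: m1rho; clear; lra.
exists x1, t1, M, rho; split => //.
  split; first by move: D4; clear; lra.
  by move: m1b m1rho t1d; clear; lra.
move=> y s y1 s1.
have yx0 : `|y - x0| <= `|y - x1| + `|x1 - x0| by rewrite -[y - x0](subrKA x1) ler_normD.
have a1 : (d - `|x1 - x0|) / 2 <= d - `|y - x0|.
  by move: yx0 y1 D4; clear; lra.
have D0 : 0 < d - `|x1 - x0| by apply: lt_trans D4; rewrite mulr_gt0.
have m10 : 0 < m1 by apply: lt_trans m1rho; rewrite mulr_gt0 ?exprn_gt0.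
(* Within 2 rho the distance to the sides at most halves, so its square keeps a quarter; hence [L]
   is the root of order 2 theta of 4. *)
have ys : m1 / 4 <= m y s.
  rewrite /m le_min; apply/andP; split.
    apply: (@le_trans _ _ (((d - `|x1 - x0|) / 2) ^+ 2)).
      by rewrite expr_div_n; move: m1a; clear; lra.
    rewrite lerXn2r ?nnegrE// ?divr_ge0 ?(ltW D0)//.
    by apply: le_trans a1; rewrite divr_ge0 ?(ltW D0).
  by move: s1 m1b m1rho m10; clear; lra.
have Ays : A (y, s).
  split => /=; first by move: a1 D0; clear; lra.
  by rewrite in_itv/=; move: s1 t1d m1b m1rho m10; clear; lra.
have := Fmax _ (mem_set Ays); rewrite /F/= VM -/m1 -/Q => FF.
have VV : V y s `^ (2 * theta) <= 4 * Q.
  rewrite -(ler_pM2r m10).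
  have : V y s `^ (2 * theta) * (m1 / 4) <= V y s `^ (2 * theta) * m y s by rewrite ler_pM2l.
  by move: FF; clear; lra.
apply: (@le_trans _ _ (V y s)); first by rewrite le_max lexx.
have -> : 4 `^ (2 * theta)^-1 * M = (4 * Q) `^ (2 * theta)^-1.
  rewrite powRM ?(ltW Q0)//; congr (_ * _).
  by rewrite /Q -powRrM mulfV ?gt_eqF// powRr1// ltW.
apply: ler_powR_root => //; first exact: le_trans (V1 _ _).
by rewrite mulr_ge0// ltW.
Qed.

End Doubling.

(** * The bump around a large value *)

Section Concentration.
Context {R : realType}.

Lemma powR_eventually_small (K e : R) : 0 <= K -> e < 0 ->
  exists2 M0 : R, 0 < M0 & forall M, M0 <= M -> K * M `^ e <= 1 / 2.
Proof.
move=> K0 e0; have z0 : 0 < 2 * K + 1 by move: K0; clear; lra.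
pose M0 : R := (2 * K + 1) `^ (- e)^-1.
have M00 : 0 < M0 by rewrite powR_gt0.
have ne0 : 0 < - e by rewrite oppr_gt0.
exists M0 => // M M0M; have M0' : 0 < M by exact: lt_le_trans M0M.
rewrite -[e]opprK powRN ler_pdivrMr ?powR_gt0//.
apply: (@le_trans _ _ (1 / 2 * (2 * K + 1))); first by move: K0; clear; lra.
rewrite ler_wpM2l//.
have -> : 2 * K + 1 = M0 `^ (- e).
  by rewrite /M0 -powRrM mulVf ?gt_eqF// powRr1// ltW.
by apply: ge0_ler_powR; rewrite ?nnegrE ?(ltW ne0) ?(ltW M00) ?(ltW M0').
Qed.

(** Factoring out the target bound L M / rho^2 leaves a pure power of M, whose exponent has to be
    negative. In logarithms the identity is polynomial. *)
Lemma scaling_identity (L M kappa theta p s : R) : 0 < L -> 0 < M -> 0 < kappa ->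
  (L * M) `^ p * ((kappa * M `^ (- theta)) ^+ 2) `^ s =
  L * M / (kappa * M `^ (- theta)) ^+ 2 *
  (L `^ (p - 1) * (kappa ^+ 2) `^ (s + 1) * M `^ (p - 1 - 2 * theta * (s + 1))).
Proof.
move=> L0 M0 k0.
have [l ->] : exists l, L = expR l by exists (ln L); rewrite lnK.
have [m ->] : exists m, M = expR m by exists (ln M); rewrite lnK.
have [k ->] : exists k, kappa = expR k by exists (ln kappa); rewrite lnK.
rewrite !expr2 -!expRD -!expRM -!expRD -!expRM -expRN -!expRD.
by congr expR; ring.
Qed.

Definition local_problem (n : nat) (u : 'rV[R]_n -> R -> R)
    (T alpha lam sigma r tau : R) (xc : 'rV[R]_n) :=
  forall (x : 'rV[R]_n) (t : R), `|x - xc| <= r -> 0 < t < tau ->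
    exists2 c : R, 0 <= c & heat_at u x t c /\
    (c%:E <= int_strip T (fun y s =>
        (heat_kernel (x - y) (t - s) `^ (alpha / n%:R) * u y s `^ lam)%:E) *
      (u x t `^ sigma)%:E)%E.

Lemma concentrated_bump (n : nat) (u : 'rV[R]_n -> R -> R)
    (T alpha lam sigma gam theta A r2 tau : R) (xc : 'rV[R]_n) (X : 'rV[R]_n -> R -> Prop) :
  0 <= lam -> 0 <= sigma -> 0 < theta -> 0 <= A -> 0 < r2 -> 0 < tau <= T ->
  (forall (y : 'rV[R]_n) (s : R), 0 < s < T -> 0 <= u y s) ->
  (forall (y : 'rV[R]_n) (s : R), 0 < s < T -> jcont u y s) ->
  local_problem u T alpha lam sigma r2 tau xc ->
  nonlocal_bound u T alpha lam gam A X ->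
  (forall (x : 'rV[R]_n) (t : R), `|x - xc| <= r2 -> 0 < t < tau -> X x t) ->
  lam + sigma - 1 - theta * (n%:R + 2 - alpha) - 2 * theta < 0 ->
  sigma - 1 + theta * (alpha - gam) - 2 * theta < 0 ->
  exists2 c : R, 0 < c <= 1 / 4 & forall kappa, 0 < kappa -> exists2 delta : R, 0 < delta &
    forall (x0 : 'rV[R]_n) (t0 : R), `|x0 - xc| <= r2 / 2 -> 0 < t0 < delta ->
    32 * kappa ^+ 2 < u x0 t0 `^ (2 * theta) * t0 ->
    exists x1 t1 M rho, [/\ 0 < M, rho = kappa * M `^ (- theta), `|x1 - xc| <= r2,
      t0 / 2 + 16 * rho ^+ 2 <= t1 <= t0 &
      forall (x : 'rV[R]_n) (t : R), `|x - x1| <= c * rho -> t1 - c * rho ^+ 2 <= t <= t1 ->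
        M / 2 <= u x t].
Proof.
move=> lam0 sig0 th0 A0 r20 /andP[tau0 tauT] u0 uj uheat nb Xr E1 E2.
have th20 : 0 < 2 * theta by rewrite mulr_gt0.
pose L : R := 4 `^ (2 * theta)^-1.
have L0 : 0 < L by rewrite powR_gt0.
have [c c14 hc] := bump_lower_bound n L0.
exists c => // kappa ka0.
have ka20 : 0 < kappa ^+ 2 by rewrite exprn_gt0.
pose a := (n%:R + 2 - alpha) / 2.
pose b := - ((alpha - gam) / 2).
pose e1 := lam + sigma - 1 - 2 * theta * (a + 1).
pose e2 := sigma - 1 - 2 * theta * (b + 1).
have e10 : e1 < 0.
  by have <- : lam + sigma - 1 - theta * (n%:R + 2 - alpha) - 2 * theta = e1 by rewrite /e1 /a; field.
have e20 : e2 < 0.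
  by have <- : sigma - 1 + theta * (alpha - gam) - 2 * theta = e2 by rewrite /e2 /b; field.
pose K1 := A * (L `^ (lam + sigma - 1) * (kappa ^+ 2) `^ (a + 1)).
pose K2 := A * (L `^ (sigma - 1) * (kappa ^+ 2) `^ (b + 1)).
have K10 : 0 <= K1 by rewrite mulr_ge0// mulr_ge0 ?powR_ge0.
have K20 : 0 <= K2 by rewrite mulr_ge0// mulr_ge0 ?powR_ge0.
have [M1 M10 hM1] := powR_eventually_small K10 e10.
have [M2 M20 hM2] := powR_eventually_small K20 e20.
pose M0 := Num.max M1 M2.
have M00 : 0 < M0 by rewrite lt_max M10.
have q0 : 0 < M0 `^ (2 * theta) by rewrite powR_gt0.
(* In turn: the smallness required by [doubling_point], a maximum M above [M0], times below [tau],
   and a cylinder inside the cube of radius [r2]. *)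
pose delta := Num.min (Num.min (32 * kappa ^+ 2) (32 * kappa ^+ 2 / M0 `^ (2 * theta)))
  (Num.min tau ((r2 / 2) ^+ 2)).
exists delta.
  by rewrite !lt_min tau0 !mulr_gt0 ?invr_gt0 ?exprn_gt0 ?divr_gt0// powR_gt0.
move=> x0 t0 x0r /andP[t00 t0d] big.
have [[d1 d2] [d3 d4]] : (t0 < 32 * kappa ^+ 2 /\ t0 < 32 * kappa ^+ 2 / M0 `^ (2 * theta)) /\
    (t0 < tau /\ t0 < (r2 / 2) ^+ 2).
  by move: t0d; rewrite !lt_min => /andP[/andP[-> ->] /andP[-> ->]].
(* The doubling cylinder has its top at [t0], and its lower half, which reaches time 0, is left
   out. *)
pose d := Num.sqrt t0.
have dt : d ^+ 2 = t0 by rewrite sqr_sqrtr// ltW.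
have d0 : 0 < d by rewrite sqrtr_gt0.
have dr : d < r2 / 2.
  by rewrite -(@ltr_pXn2r _ 2)// ?nnegrE ?(ltW d0) ?divr_ge0 ?(ltW r20)// dt.
have t0T t : t0 / 2 <= t <= t0 -> 0 < t < T by move: t00 d3 tauT; clear; lra.
have := @doubling_point _ n u x0 d theta kappa d0 th0 ka0.
rewrite !dt => /(_ (ltW d1)); case.
- by move=> x t _ /t0T tT; split; [exact: u0|exact: uj].
- exact: big.
move=> x1 [t1 [M [rho [[uM Mp] rhoE MQ [x1d t1d] uB]]]].
have rho0 : 0 < rho by rewrite rhoE mulr_gt0 ?powR_gt0.
have rr0 : 0 < rho ^+ 2 by rewrite exprn_gt0.
have MM0 : M0 < M.
  apply: (@ltr_powR_cancel _ _ _ (2 * theta)) => //; try exact: ltW.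
  have h1 : t0 * M0 `^ (2 * theta) < 32 * kappa ^+ 2 by rewrite -ltr_pdivlMr.
  by rewrite -(ltr_pM2l t00); move: h1 MQ; clear; lra.
have MM : M1 <= M /\ M2 <= M.
  by split; apply: le_trans (ltW MM0); rewrite le_max lexx ?orbT.
have x1c : `|x1 - xc| <= `|x1 - x0| + `|x0 - xc| by rewrite -[x1 - xc](subrKA x0) ler_normD.
exists x1, t1, M, rho; split => //.
  by move: x1c x1d x0r dr rho0; clear; lra.
have LM0 : 0 < L * M by rewrite mulr_gt0.
have region (x : 'rV[R]_n) (t : R) : `|x - x1| <= rho -> t1 - rho ^+ 2 <= t <= t1 ->
    [/\ `|x - xc| <= r2, 0 < t < tau, 0 < t < T & u x t <= L * M].
  move=> xr tr.
  have xxc : `|x - xc| <= `|x - x1| + `|x1 - xc| by rewrite -[x - xc](subrKA x1) ler_normD.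
  split.
  - by move: xxc x1c x1d x0r dr rho0 xr; clear; lra.
  - by move: tr t1d t00 d3 rr0; clear; lra.
  - by move: tr t1d t00 d3 rr0 tauT; clear; lra.
  - by apply: uB; [move: xr rho0; clear; lra|move: tr rr0; clear; lra].
apply: hc => //; last first.
  by move=> x t xr tr; have [_ _ tT _] := region x t xr tr; exact: u0.
move=> x t xr tr; have [xc2 ttau tT uLM] := region x t xr tr.
have ux0 := u0 x t tT.
split; first exact: uj.
  by rewrite ger0_norm.
have [c' c'0 [hc' c'N]] := uheat x t xc2 ttau.
exists c' => //; rewrite ger0_norm//.
have NB : (int_strip T (fun y s => (heat_kernel (x - y) (t - s) `^ (alpha / n%:R) * u y s `^ lam)%:E) <=
   (A * ((L * M) `^ lam * (rho ^+ 2) `^ a + (rho ^+ 2) `^ b))%:E)%E.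
  apply: nb => //; [exact: Xr|exact: ltW|].
  move=> y s sT yx st; apply: uB.
    have : `|y - x1| <= `|y - x| + `|x - x1| by rewrite -[y - x1](subrKA x) ler_normD.
    by move: yx xr; clear; lra.
  by move: st tr; clear; lra.
have Z0 : 0 <= A * ((L * M) `^ lam * (rho ^+ 2) `^ a + (rho ^+ 2) `^ b).
  by rewrite mulr_ge0// addr_ge0// ?mulr_ge0 ?powR_ge0.
have cZ : c' <= A * ((L * M) `^ lam * (rho ^+ 2) `^ a + (rho ^+ 2) `^ b) * (L * M) `^ sigma.
  rewrite -lee_fin; apply: (le_trans c'N); rewrite EFinM.
  apply: (@le_trans _ _ ((A * ((L * M) `^ lam * (rho ^+ 2) `^ a + (rho ^+ 2) `^ b))%:E * (u x t `^ sigma)%:E)%E).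
    by apply: lee_wpmul2r; rewrite ?lee_fin ?powR_ge0.
  apply: lee_wpmul2l; rewrite lee_fin//.
  by apply: ge0_ler_powR; rewrite ?nnegrE// ltW.
apply: (le_trans cZ).
have -> : A * ((L * M) `^ lam * (rho ^+ 2) `^ a + (rho ^+ 2) `^ b) * (L * M) `^ sigma =
    A * ((L * M) `^ (lam + sigma) * (rho ^+ 2) `^ a) + A * ((L * M) `^ sigma * (rho ^+ 2) `^ b).
  by rewrite powRD_gt0//; ring.
rewrite rhoE !scaling_identity// -rhoE -/e1 -/e2.
have -> : A * (L * M / rho ^+ 2 * (L `^ (lam + sigma - 1) * (kappa ^+ 2) `^ (a + 1) * M `^ e1)) +
    A * (L * M / rho ^+ 2 * (L `^ (sigma - 1) * (kappa ^+ 2) `^ (b + 1) * M `^ e2)) =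
    L * M / rho ^+ 2 * (K1 * M `^ e1 + K2 * M `^ e2) by rewrite /K1 /K2; ring.
rewrite ler_piMr ?divr_ge0 ?(ltW LM0) ?(ltW rr0)//.
have := hM1 M MM.1; have := hM2 M MM.2; clear; lra.
Qed.

End Concentration.

(** * Blow-up rates *)

Section LocalBounds.
Context {R : realType}.

Lemma powR_decay (v t k e : R) : 0 < e -> 0 <= v -> 0 < t -> 0 <= k ->
  v `^ e * t <= k -> v <= k `^ e^-1 * t `^ (- e^-1).
Proof.
move=> e0 v0 t0 k0 h.
have -> : k `^ e^-1 * t `^ (- e^-1) = (k / t) `^ e^-1.
  rewrite powRM ?invr_ge0 ?(ltW t0)//; congr (_ * _).
  by rewrite -[t^-1]powR_inv1 ?(ltW t0)// -powRrM mulN1r.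
apply: ler_powR_root => //; first by rewrite divr_ge0 ?(ltW t0).
by rewrite ler_pdivlMr.
Qed.

(** With theta = 1/n and after multiplication by n, everything is linear in n lam, n sigma, alpha
    and gam. *)
Lemma subcritical_exponents (n : nat) (alpha lam sigma : R) : (0 < n)%N ->
  0 < alpha < n%:R + 2 -> 0 < lam -> sigma < g_alpha n alpha lam -> lam < (n%:R + 2) / n%:R ->
  lam + sigma - 1 - n%:R^-1 * (n%:R + 2 - alpha) - 2 * n%:R^-1 < 0 /\
  exists gam, [/\ 0 <= gam <= alpha, lam * n%:R + gam < n%:R + 2 &
    sigma - 1 + n%:R^-1 * (alpha - gam) - 2 * n%:R^-1 < 0].
Proof.
move=> n_gt0 al lam0; rewrite /g_alpha.
have n0 : 0 < n%:R :> R by rewrite ltr0n.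
rewrite !ltr_pdivlMr// => sg ll; rewrite ll in sg.
have scale (z : R) : (z < 0) = (n%:R * z < 0) by rewrite pmulr_rlt0.
have N1 : n%:R * n%:R^-1 = 1 :> R by rewrite mulfV// gt_eqF.
have e1 : n%:R * (lam + sigma - 1 - n%:R^-1 * (n%:R + 2 - alpha) - 2 * n%:R^-1) =
    n%:R * lam + n%:R * sigma - n%:R - (n%:R + 2 - alpha) - 2 by field; rewrite gt_eqF.
have e2 gam : n%:R * (sigma - 1 + n%:R^-1 * (alpha - gam) - 2 * n%:R^-1) =
    n%:R * sigma - n%:R + (alpha - gam) - 2 by field; rewrite gt_eqF.
have [lt|ge] := ltP (lam * n%:R) (n%:R + 2 - alpha).
  rewrite lt ltr_pdivlMr// in sg.
  split; first by rewrite scale e1; move: lt sg al; clear; lra.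
  (* On the first branch of [g_alpha] the power lam + alpha/n is still below (n+2)/n, so the whole
     kernel can be absorbed. *)
  exists alpha; split; first by move: al; clear; lra.
    by move: lt; clear; lra.
  by rewrite scale e2; move: sg; clear; lra.
rewrite (le_gtF ge) in sg.
have sg' : n%:R * sigma < 2 * (n%:R + 2) - alpha - lam * n%:R.
  have : n%:R * sigma < n%:R * ((2 * (n%:R + 2) - alpha) / n%:R - lam) by rewrite ltr_pM2l.
  have -> : n%:R * ((2 * (n%:R + 2) - alpha) / n%:R - lam) = 2 * (n%:R + 2) - alpha - lam * n%:R :> R.
    by field; rewrite gt_eqF.
  by [].
split; first by rewrite scale e1; move: sg'; clear; lra.
(* Lower bounds on gam; n + 2 - lam n is the upper one, at most alpha here. The second branch of
   [g_alpha] says that there is room between them, and the midpoint is taken. *)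
pose m := Num.max 0 (n%:R * sigma - n%:R - 2 + alpha).
have [m0 m1] : 0 <= m /\ n%:R * sigma - n%:R - 2 + alpha <= m.
  by split; rewrite le_max lexx ?orbT.
have m2 : m < n%:R + 2 - lam * n%:R.
  by rewrite gt_max; apply/andP; split; [move: ll|move: sg']; clear; lra.
exists ((m + (n%:R + 2 - lam * n%:R)) / 2); split.
- by move: m0 m2 ge; clear; lra.
- by move: m2; clear; lra.
- by rewrite scale e2; move: m1 m2; clear; lra.
Qed.

Lemma supercritical_exponents (n : nat) (alpha lam sigma : R) : (0 < n)%N ->
  0 < alpha -> 0 <= sigma -> sigma < g_alpha n alpha lam -> (n%:R + 2) / n%:R <= lam ->
  sigma - 1 + lam / (n%:R + 2) * (alpha - 0) - 2 * (lam / (n%:R + 2)) < 0.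
Proof.
move=> n_gt0 al sig0; rewrite /g_alpha.
have n0 : 0 < n%:R :> R by rewrite ltr0n.
have n2 : 0 < n%:R + 2 :> R by rewrite ltr_wpDr.
move=> sg ll; rewrite (le_gtF ll) in sg.
have ll' : (n%:R + 2 - alpha) / n%:R <= lam.
  by apply: le_trans ll; rewrite ler_pM2r ?invr_gt0//; move: al; clear; lra.
(* The value 0 of the maximum would force sigma < 0. *)
rewrite (le_gtF ll') lt_max in sg; case/orP: sg => sg; first by move: sg sig0; clear; lra.
have -> : sigma - 1 + lam / (n%:R + 2) * (alpha - 0) - 2 * (lam / (n%:R + 2)) =
    sigma - (1 - (alpha - 2) / (n%:R + 2) * lam) by ring.
by rewrite subr_lt0.
Qed.

(** Absolute continuity at time 0: by [sint_time_cut] late times carry all but [k] of the finite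
    integral. *)
Lemma strip_integral_small (n : nat) (u : 'rV[R]_n -> R -> R) (T lam k : R) :
  0 < lam -> 0 < T -> 0 < k ->
  (forall (y : 'rV[R]_n) (s : R), 0 < s < T -> 0 <= u y s) ->
  (forall (y : 'rV[R]_n) (s : R), 0 < s < T -> jcont u y s) ->
  (int_strip T (fun y s => (u y s `^ lam)%:E) < +oo)%E ->
  exists2 e : R, 0 < e & forall d, 0 < d < e ->
    (sint (fun p : R * 'rV[R]_n => ((0 < p.1 < d)%R%:R * u p.2 p.1 `^ lam)%:E) < k%:E)%E.
Proof.
move=> lam0 T0 k0 u0 uj uI.
pose F (p : R * 'rV[R]_n) : \bar R := ((0 < p.1 < T)%R%:R * u p.2 p.1 `^ lam)%:E.
have F0 p : (0 <= F p)%E by rewrite lee_fin mulr_ge0 ?powR_ge0.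
have lF : lower_semicontinuous F by exact: lsc_strip_powR.
have FI : sint F = int_strip T (fun y s => (u y s `^ lam)%:E).
  by rewrite /F (sint_patch_strip T (fun p : R * 'rV[R]_n => u p.2 p.1 `^ lam)).
rewrite -FI in uI.
have I0 : (0 <= sint F)%E by exact: sint_ge0.
have If : sint F = (fine (sint F))%:E by rewrite fineK// ge0_fin_numE.
have [|e e0 he] := sint_time_cut (C := fine (sint F) - k) F0 lF.
  apply: (@lt_le_trans _ _ (sint F)); first by rewrite [X in (_ < X)%E]If lte_fin gtrBl.
  apply: sint_mono => // p; rewrite /F -EFinM lee_fin mulrA -natrM mulnb.
  by case: (0 < p.1); rewrite //= mul0r.
exists (Num.min e T); first by rewrite lt_min e0.
move=> d; rewrite lt_min => /and3P[d0 de dT].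
have := he d; rewrite d0 de => /(_ isT) hd.
pose G (p : R * 'rV[R]_n) : \bar R := ((0 < p.1 < d)%R%:R * u p.2 p.1 `^ lam)%:E.
pose H (p : R * 'rV[R]_n) : \bar R := (((d < p.1)%R%:R)%:E * F p)%E.
have G0 p : (0 <= G p)%E by rewrite lee_fin mulr_ge0 ?powR_ge0.
have H0 p : (0 <= H p)%E by rewrite mule_ge0.
have lG : lower_semicontinuous G by apply: (@lsc_strip_powR _ _ u T) => //; exact: ltW.
have lH : lower_semicontinuous H.
  apply: lsc_indicM => //; apply: open_lt_fun => p; first exact: contAtC.
  by case: p => s y; exact: cvg_fst.
have GHF : (sint G + sint H <= sint F)%E.
  rewrite -sintD//; apply: sint_mono => p; first exact: adde_ge0.
  rewrite /G /H /F -EFinM -EFinD lee_fin mulrA -mulrDl ler_wpM2r ?powR_ge0//.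
  rewrite -natrM -natrD ler_nat.
  have [dp|dp] := ltP d p.1.
    rewrite mul1n (_ : p.1 < d = false) ?andbF//.
    by apply/negbTE; rewrite -leNgt ltW.
  rewrite mul0n addn0.
  by case: (0 < p.1) => //=; case: ltP => // pd; rewrite (lt_trans pd dT).
rewrite ltNge; apply/negP => kG.
move: GHF; rewrite leNgt => /negP; apply.
apply: (@lt_le_trans _ _ (k%:E + sint H)%E); last by rewrite leeD2r.
apply: (@le_lt_trans _ _ (k%:E + (fine (sint F) - k)%:E)%E); last by rewrite lteD2lE.
by rewrite -EFinD addrC subrK -If.
Qed.

End LocalBounds.

Section LocalRates.
Context {R : realType}.

Lemma subcritical_rate (n : nat) (u : 'rV[R]_n -> R -> R) (T alpha lam sigma r : R) (xc : 'rV[R]_n) :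
  (0 < n)%N -> 0 < alpha < n%:R + 2 -> 0 < lam -> 0 < T -> 0 <= sigma ->
  sigma < g_alpha n alpha lam -> lam < (n%:R + 2) / n%:R -> 0 < r ->
  (forall (y : 'rV[R]_n) (s : R), 0 < s < T -> 0 <= u y s) ->
  (forall (y : 'rV[R]_n) (s : R), 0 < s < T -> jcont u y s) ->
  (int_strip T (fun y s => (u y s `^ lam)%:E) < +oo)%E ->
  local_problem u T alpha lam sigma (3 * r) T xc ->
  exists C, exists2 d : R, 0 < d & forall (x : 'rV[R]_n) (t : R), `|x - xc| <= d -> 0 < t < d ->
    u x t <= C * t `^ (- (n%:R / 2)).
Proof.
move=> n_gt0 al lam0 T0 sig0 sg ll r0 u0 uj uI up.
have n0 : 0 < n%:R :> R by rewrite ltr0n.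
have n1 : 1 <= n%:R :> R by rewrite ler1n.
have r20 : 0 < r ^+ 2 by rewrite exprn_gt0.
have [E1 [gam [ga lg E2]]] := subcritical_exponents n_gt0 al lam0 sg ll.
(* The factor 10 n yields both geometric conditions of [capacity] at once. *)
pose ts := Num.min (T / 2) (r ^+ 2 / (10 * n%:R)).
have ts0 : 0 < ts by rewrite lt_min !divr_gt0// mulr_gt0.
have tsT : ts <= T / 2 by rewrite ge_min lexx.
have tsn : ts * (10 * n%:R) <= r ^+ 2.
  by rewrite -ler_pdivlMr ?mulr_gt0// ge_min lexx orbT.
have h1 : n%:R / 2 * (5 * ts) <= 4 * r ^+ 2 by move: tsn r20; clear; lra.
have h2 : 10 * ts <= r ^+ 2.
  apply: le_trans tsn; rewrite mulrC ler_pM2l//.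
  by move: n1; clear; lra.
have uh : supersolution u xc (3 * r) ts.
  move=> x t xr tts; have tT : 0 < t < T by move: tts tsT T0; clear; lra.
  have [c c0 [hc _]] := up x t xr tT.
  by split; [exact: u0|exact: uj|exists c].
have [C0 C00 cap] := capacity n_gt0 r0 ts0 h1 h2 uh.
(* The cube of radius [r1] lies in the Euclidean ball of radius [r], where the capacity estimate
   wants its centres. *)
pose r1 := r / n%:R.
have r10 : 0 < r1 by rewrite divr_gt0.
have r1r : r1 <= r by rewrite ler_pdivrMr// ler_peMr// ltW.
have nr1 : n%:R * r1 ^+ 2 <= r ^+ 2.
  have -> : n%:R * r1 ^+ 2 = r1 * r by rewrite /r1; field; rewrite gt_eqF.
  by rewrite expr2 ler_pM2r.
have [ga0 ga1] := andP ga.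
have q0 : 0 < lam + gam / n%:R by rewrite ltr_pwDl// divr_ge0// ltW.
have nq : n%:R * (lam + gam / n%:R) < n%:R + 2.
  by have -> : n%:R * (lam + gam / n%:R) = lam * n%:R + gam by field; rewrite gt_eqF.
have [Cq Cq0 hq] := sint_powR_bound n_gt0 r0 ts0 h1 h2 uh r10 nr1 q0 nq.
have tau : 0 < ts / 2 <= T by move: ts0 tsT T0; clear; lra.
have [A A0 nb] := nonlocal_bound_local n_gt0 al lam0 ga lg u0 uj uI r10 tau hq.
have r120 : 0 < r1 / 2 by rewrite divr_gt0.
have th0 : 0 < n%:R^-1 :> R by rewrite invr_gt0.
have uheat : local_problem u T alpha lam sigma (r1 / 2) (ts / 2) xc.
  move=> x t xr tt; apply: up; first by move: xr r1r r0; clear; lra.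
  by move: tt tsT T0; clear; lra.
have [c c14 bump] := concentrated_bump (ltW lam0) sig0 th0 A0 r120 tau u0 uj uheat nb
  (fun x t xr tt => conj xr tt) E1 E2.
have c0 : 0 < c by move: c14; clear; lra.
(* The bump then has size h = c rho = (2 C0 + 1) M^(-1/n), so that (M/2) h^n = (2 C0 + 1)^n / 2
   exceeds [C0]. *)
pose kappa := (2 * C0 + 1) / c.
have ka0 : 0 < kappa by rewrite divr_gt0//; move: C00; clear; lra.
have [dl dl0 hdl] := bump kappa ka0.
pose d := Num.min (Num.min dl (r1 / 2 / 2)) (Num.min (ts / 2) (ts ^+ 2 / r ^+ 2)).
exists ((32 * kappa ^+ 2) `^ (2 * n%:R^-1)^-1).
exists d; first by rewrite !lt_min dl0 !divr_gt0// exprn_gt0.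
move=> x0 t0 x0d /andP[t00 t0d].
have [[d1 d2] [d3 d4]] : (t0 < dl /\ `|x0 - xc| <= r1 / 2 / 2) /\ (t0 < ts / 2 /\ t0 < ts ^+ 2 / r ^+ 2).
  move: t0d x0d; rewrite !lt_min !le_min => /andP[/andP[-> _] /andP[-> ->]].
  by move=> /andP[/andP[_ ->] _].
have -> : n%:R / 2 = (2 * n%:R^-1)^-1 :> R by field; rewrite gt_eqF.
have k32 : 0 <= 32 * kappa ^+ 2 by rewrite mulr_ge0// sqr_ge0.
apply: powR_decay => //; first by rewrite mulr_gt0.
  by apply: u0; move: t00 d3 tsT T0; clear; lra.
rewrite leNgt; apply/negP => big.
have [|x1 [t1 [M [rho [M0 rhoE x1r t1d ub]]]]] := hdl x0 t0 d2 _ big; first by rewrite t00.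
have rho0 : 0 < rho by rewrite rhoE mulr_gt0 ?powR_gt0.
have rr0 : 0 < rho ^+ 2 by rewrite exprn_gt0.
have rrt : rho ^+ 2 <= t0 by move: t1d rr0; clear; lra.
pose h := c * rho.
have h0 : 0 < h by rewrite mulr_gt0.
have hr : h ^+ 2 <= rho ^+ 2.
  rewrite exprMn ler_piMl ?(ltW rr0)// expr_le1 ?(ltW c0)//.
  by move: c14; clear; lra.
have hts : r ^+ 2 * h ^+ 2 <= ts ^+ 2.
  have h3 : t0 * r ^+ 2 <= ts ^+ 2 by rewrite -ler_pdivlMr// ltW.
  apply: le_trans h3; rewrite mulrC ler_pM2r//.
  exact: le_trans rrt.
(* Capacity estimate with one level and one centre. *)
have capN : M / 2 * (\sum_(0 <= l < 1) size [:: x1])%:R `^ (n%:R / (n%:R + 2)) * h ^+ n <= C0.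
  apply: (cap h t1 (M / 2) (fun=> [:: x1]) 1%N) => //.
  - by move: hr rrt d3 ts0; clear; lra.
  - move=> l _; split => // [y|y y']; rewrite !inE; last by move=> /eqP -> /eqP ->; rewrite eqxx.
    move=> /eqP ->; apply: le_trans (sqnorm_le_norm_sqr _) _.
    apply: le_trans nr1; rewrite ler_pM2l// distrC lerXn2r ?nnegrE ?(ltW r10)//.
    by move: x1r r10; clear; lra.
  - by move: t1d t00 rr0; clear; lra.
  - exact: divr_gt0.
  - move=> l; rewrite ltnS leqn0 => /eqP ->; rewrite /level mul0r addr0.
    by move: t1d d3; clear; lra.
  - move=> l x y; rewrite ltnS leqn0 => /eqP -> /[!inE]/eqP -> xh; rewrite /level mul0r addr0.
    apply: ub; first exact: ltW.
    by rewrite lexx andbT gerBl mulr_ge0 ?(ltW c0) ?(ltW rr0).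
rewrite big_nat1/= powR1 mulr1 in capN.
have hE : h ^+ n = (2 * C0 + 1) ^+ n / M.
  have -> : h = (2 * C0 + 1) * M `^ (- n%:R^-1).
    by rewrite /h rhoE /kappa; field; rewrite gt_eqF.
  rewrite exprMn; congr (_ * _).
  by rewrite -powR_mulrn ?powR_ge0// -powRrM mulNr mulVf ?gt_eqF// powR_inv1// ltW.
have C1 : 2 * C0 + 1 <= (2 * C0 + 1) ^+ n.
  by rewrite -[leLHS]expr1 ler_weXn2l//; move: C00; clear; lra.
have capE : M / 2 * h ^+ n = (2 * C0 + 1) ^+ n / 2 by rewrite hE; field; rewrite gt_eqF.
by move: capN; rewrite capE; move: C1; clear; lra.
Qed.

Lemma supercritical_rate (n : nat) (u : 'rV[R]_n -> R -> R) (T alpha lam sigma r eps : R)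
    (xc : 'rV[R]_n) :
  (0 < n)%N -> 0 < alpha < n%:R + 2 -> 0 < lam -> 0 < T -> 0 <= sigma ->
  sigma < g_alpha n alpha lam -> (n%:R + 2) / n%:R <= lam -> 0 < r -> 0 < eps ->
  (forall (y : 'rV[R]_n) (s : R), 0 < s < T -> 0 <= u y s) ->
  (forall (y : 'rV[R]_n) (s : R), 0 < s < T -> jcont u y s) ->
  (int_strip T (fun y s => (u y s `^ lam)%:E) < +oo)%E ->
  local_problem u T alpha lam sigma r T xc ->
  exists2 d : R, 0 < d & forall (x : 'rV[R]_n) (t : R), `|x - xc| <= d -> 0 < t < d ->
    u x t <= eps * t `^ (- ((n%:R + 2) / (2 * lam))).
Proof.
move=> n_gt0 al lam0 T0 sig0 sg ll r0 eps0 u0 uj uI up.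
have n20 : 0 < n%:R + 2 :> R by rewrite ltr_wpDl.
have al0 : 0 < alpha by case/andP: al.
pose theta := lam / (n%:R + 2).
have th0 : 0 < theta by rewrite divr_gt0.
have thE : theta * (n%:R + 2) = lam by rewrite /theta; field; rewrite gt_eqF.
have E2 := supercritical_exponents n_gt0 al0 sig0 sg ll.
(* Since theta (n + 2) = lam, the exponents of the near and the far term coincide. *)
have E1 : lam + sigma - 1 - theta * (n%:R + 2 - alpha) - 2 * theta < 0.
  have -> : lam + sigma - 1 - theta * (n%:R + 2 - alpha) - 2 * theta =
      (lam - theta * (n%:R + 2)) + (sigma - 1 + theta * (alpha - 0) - 2 * theta) by ring.
  by rewrite thE subrr add0r.
have [A A0 nb] := nonlocal_bound_integrable n_gt0 al lam0 u0 uj uI.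
have tau : 0 < T <= T by rewrite T0 lexx.
have [c c14 bump] := concentrated_bump (ltW lam0) sig0 th0 A0 r0 tau u0 uj up nb
  (fun _ _ _ _ => I) E1 E2.
have c0 : 0 < c by move: c14; clear; lra.
have th20 : 0 < 2 * theta by rewrite mulr_gt0.
(* Chosen so that a violation of the rate with constant [eps] is the hypothesis of [bump]. *)
pose kappa := Num.sqrt (eps `^ (2 * theta) / 32).
have kaE : 32 * kappa ^+ 2 = eps `^ (2 * theta).
  rewrite sqr_sqrtr; first by field.
  by rewrite divr_ge0 ?powR_ge0.
have ka0 : 0 < kappa by rewrite sqrtr_gt0 divr_gt0 ?powR_gt0.
(* The integral of (M/2)^lam over the bump box, free of M because M^lam rho^(n+2) = kappa^(n+2). *)
pose k := 2^-1 `^ lam * kappa ^+ (n + 2) * ((2 * c) ^+ n * c).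
have k0 : 0 < k by rewrite !mulr_gt0 ?powR_gt0 ?exprn_gt0 ?mulr_gt0 ?invr_gt0.
have [dl dl0 hdl] := bump kappa ka0.
have [e e0 he] := strip_integral_small lam0 T0 k0 u0 uj uI.
exists (Num.min (Num.min dl (r / 2)) (Num.min e T)).
  by rewrite !lt_min dl0 e0 T0 divr_gt0.
move=> x0 t0 x0d /andP[t00 t0d].
have [[d1 d2] [d3 d4]] : (t0 < dl /\ `|x0 - xc| <= r / 2) /\ (t0 < e /\ t0 < T).
  move: t0d x0d; rewrite !lt_min !le_min => /andP[/andP[-> _] /andP[-> ->]].
  by move=> /andP[/andP[_ ->] _].
have -> : (n%:R + 2) / (2 * lam) = (2 * theta)^-1 :> R.
  by rewrite /theta; field; rewrite !gt_eqF.
have -> : eps = (32 * kappa ^+ 2) `^ (2 * theta)^-1.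
  by rewrite kaE -powRrM mulfV ?gt_eqF// powRr1// ltW.
apply: powR_decay => //.
- by apply: u0; rewrite t00.
- by rewrite mulr_ge0// sqr_ge0.
rewrite leNgt; apply/negP => big.
have [|x1 [t1 [M [rho [M0 rhoE x1r t1d ub]]]]] := hdl x0 t0 d2 _ big; first by rewrite t00.
have rho0 : 0 < rho by rewrite rhoE mulr_gt0 ?powR_gt0.
have rr0 : 0 < rho ^+ 2 by rewrite exprn_gt0.
have := he t0; rewrite t00 d3 => /(_ isT); rewrite ltNge => /negP; apply.
have crho : 0 < c * rho by rewrite mulr_gt0.
have crr : 0 < c * rho ^+ 2 by rewrite mulr_gt0.
have crr1 : c * rho ^+ 2 <= rho ^+ 2 by rewrite ler_piMl ?(ltW rr0)//; move: c14; clear; lra.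
have M2 : 0 <= (M / 2) `^ lam by exact: powR_ge0.
have kE : k = (M / 2) `^ lam * ((2 * (c * rho)) ^+ n * (c * rho ^+ 2)).
  have Mrho : M `^ lam * rho ^+ (n + 2) = kappa ^+ (n + 2).
    rewrite rhoE exprMn mulrCA (_ : M `^ lam * _ = 1) ?mulr1//.
    rewrite -powR_mulrn ?powR_ge0// -powRrM natrD mulNr thE.
    by rewrite powRN mulfV// gt_eqF// powR_gt0.
  rewrite /k -Mrho [(M / 2) `^ lam]powRM ?(ltW M0)// !exprMn exprD.
  by ring.
rewrite kE -(@sint_box _ _ x1 _ _ (t1 - c * rho ^+ 2))//.
apply: sint_mono => [p|[s y]]; first by rewrite lee_fin mulr_ge0.
rewrite lee_fin/= subrK.
have [/andP[yx st]|_] := boolP ((`|y - x1| < c * rho) && _); last first.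
  by rewrite mulr0 mulr_ge0 ?powR_ge0.
have -> : 0 < s < t0.
  by move: st t1d crr1 rr0 t00; clear; lra.
rewrite mul1r mulr1; apply: ge0_ler_powR; rewrite ?nnegrE ?(ltW lam0) ?divr_ge0 ?(ltW M0)//.
  by apply: u0; move: st t1d crr1 rr0 t00 d4; clear; lra.
by apply: ub; [exact: ltW|move: st; clear; lra].
Qed.

End LocalRates.

(** * From points to compact sets *)

Lemma compact_locally_uniform (R : realType) (n : nat) (K : set 'rV[R]_n)
    (P : R -> 'rV[R]_n -> Prop) : compact K ->
  (forall (i j : R) (x : 'rV[R]_n), i <= j -> P i x -> P j x) ->
  (forall x, K x -> exists i, exists2 e : R, 0 < e & forall y, `|y - x| <= e -> P i y) ->
  exists i, forall x, K x -> P i x.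
Proof.
move=> /compact_near_coveringP cK Pmono Ploc.
have [i [_ hi]] : \forall i \near +oo, K `<=` P i.
  apply: cK => x /Ploc[i [e e0 he]].
  exists (ball x e, [set j | i < j]) => /=.
    split; first exact: nbhsx_ballx.
    by exists i; split => //; exact: num_real.
  move=> [y j] /= [xy ij]; apply: (Pmono i); first exact: ltW.
  by apply: he; move: xy; rewrite -ball_normE/= distrC => /ltW.
by exists (i + 1) => x Kx; apply: (hi (i + 1)) => //; rewrite ltrDl.
Qed.

Theorem theorem1p1 (R : realType) (n : nat) (alpha lam T sigma : R)
  (Omega : set 'rV[R]_n) (u : 'rV[R]_n -> R -> R) :
  (1 <= n)%N ->
  0 < alpha < n%:R + 2 ->
  0 < lam -> 0 < T ->
  0 <= sigma -> sigma < g_alpha n alpha lam ->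
  open Omega ->
  (forall x t, 0 < t < T -> 0 <= u x t) ->
  C21 T u ->
  (int_strip T (fun y s => ((u y s) `^ lam)%:E) < +oo)%E ->
  (forall x t, Omega x -> 0 < t < T ->
     0 <= dt u x t - laplacian u x t /\
     ((dt u x t - laplacian u x t)%:E <=
       int_strip T (fun y s =>
         ((heat_kernel (x - y) (t - s)) `^ (alpha / n%:R)
          * (u y s) `^ lam)%:E)
       * ((u x t) `^ sigma)%:E)%E) ->
  forall K : set 'rV[R]_n, compact K -> K `<=` Omega ->
  (lam < (n%:R + 2) / n%:R ->
     exists C : R, exists2 delta : R, 0 < delta &
       forall t, 0 < t < delta -> forall x, K x ->
         u x t <= C * t `^ (- (n%:R / 2)))
  /\
  ((n%:R + 2) / n%:R <= lam ->
     forall eps : R, 0 < eps -> exists2 delta : R, 0 < delta &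
       forall t, 0 < t < delta -> forall x, K x ->
         u x t <= eps * t `^ (- ((n%:R + 2) / (2 * lam)))).
Proof.
move=> n_gt0 al lam0 T0 sig0 sg oO u0 uC uI ineq K cK KO.
have uj (y : 'rV[R]_n) (s : R) : 0 < s < T -> jcont u y s.
  by move=> sT; have [_ _ _ [? _] _] := uC y s sT.
have loc x : Omega x -> exists2 r, 0 < r & local_problem u T alpha lam sigma (3 * r) T x.
  move=> Ox; have /nbhs_ballP[e /= e0 he] : nbhs x Omega by exact: open_nbhs_nbhs.
  exists (e / 6); first by rewrite divr_gt0.
  move=> y t yx tT; have [|c0 cN] := ineq y t _ tT.
    apply: he; rewrite -ball_normE/= distrC; apply: (le_lt_trans yx).
    by move: e0; clear; lra.
  by exists (dt u y t - laplacian u y t) => //; split => //; exact: (@C21_heat_at _ _ T).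
have small (i t : R) : 0 < t < (Num.max 1 i)^-1 -> t * i < 1.
  move=> /andP[t0]; have m0 : 0 < Num.max 1 i by rewrite lt_max ltr01.
  rewrite -[ltRHS]div1r ltr_pdivlMr//; apply: le_lt_trans.
  by rewrite ler_pM2l// le_max lexx orbT.
have delta0 (i : R) : 0 < (Num.max 1 i)^-1 by rewrite invr_gt0 lt_max ltr01.
have large (d i t : R) : 0 < d -> 0 < t -> d^-1 <= i -> t * i < 1 -> t < d.
  move=> d0 t0 di ti; rewrite -[d]invrK -[ltRHS]div1r ltr_pdivlMr ?invr_gt0//.
  by apply: le_lt_trans ti; rewrite ler_pM2l.
split => [ll|ll eps eps0].
  (* One monotone index [i] serves both as the constant and, through t i < 1, as the inverse of the
     time threshold. *)
  have [||i hi] := @compact_locally_uniform _ _ K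
    (fun i x => forall t, 0 < t -> t * i < 1 -> u x t <= i * t `^ (- (n%:R / 2))) cK.
  - move=> i j x ij h t t0 tj.
    apply: (@le_trans _ _ (i * t `^ (- (n%:R / 2)))); last by rewrite ler_wpM2r ?powR_ge0.
    by apply: h => //; apply: le_lt_trans tj; rewrite ler_pM2l.
  - move=> x Kx; have [r r0 up] := loc x (KO x Kx).
    have [C [d d0 hC]] := subcritical_rate n_gt0 al lam0 T0 sig0 sg ll r0 u0 uj uI up.
    exists (Num.max C d^-1), d => // y yx t t0 ti.
    apply: (@le_trans _ _ (C * t `^ (- (n%:R / 2)))).
      by apply: hC => //; rewrite t0 (large d _ _ d0 t0 _ ti)// le_max lexx orbT.
    by rewrite ler_wpM2r ?powR_ge0// le_max lexx.
  exists i, (Num.max 1 i)^-1 => // t tm x Kx.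
  by apply: hi => //; [case/andP: tm|exact: small].
have [||i hi] := @compact_locally_uniform _ _ K
  (fun i x => forall t, 0 < t -> t * i < 1 -> u x t <= eps * t `^ (- ((n%:R + 2) / (2 * lam)))) cK.
- move=> i j x ij h t t0 tj.
  by apply: h => //; apply: le_lt_trans tj; rewrite ler_pM2l.
- move=> x Kx; have [r r0 up] := loc x (KO x Kx).
  have r30 : 0 < 3 * r by rewrite mulr_gt0.
  have [d d0 hd] := supercritical_rate n_gt0 al lam0 T0 sig0 sg ll r30 eps0 u0 uj uI up.
  exists d^-1, d => // y yx t t0 ti.
  by apply: hd => //; rewrite t0 (large d _ _ d0 t0 _ ti).
exists (Num.max 1 i)^-1 => // t tm x Kx.
by apply: hi => //; [case/andP: tm|exact: small].
Qed.
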